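(* Let $\mathcal K=\mathcal K_1\times\cdots\times\mathcal K_J$ be a product of second-order cones $\mathcal K_i\subset\mathbb{R}^{m_i}$, $m=\sum_{i=1}^Jm_i$, let $\Lambda\subseteq\mathbb{R}^l$ be closed, and let $F:\mathbb{R}^n\to\mathbb{R}^l$, $G=(G_1,\dots,G_J),H=(H_1,\dots,H_J):\mathbb{R}^n\to\mathbb{R}^m$ be continuously differentiable with $G_i,H_i:\mathbb{R}^n\to\mathbb{R}^{m_i}$. Let $\mathcal F$ be the set of $z\in\mathbb{R}^n$ with $\mathcal K\ni G(z)\perp H(z)\in\mathcal K$ and $F(z)\in\Lambda$, and let $z^*\in\mathcal F$. Suppose that the set-valued mapping $M(z):=F(z)-\Lambda$ is metrically subregular at $(z^*,0)$. Consider the following two conditions. (A) For every $0\neq w\in\mathbb{R}^n$ with $\nabla F(z^* )w\in T_\Lambda(F(z^* ))$ and $(\nabla G_i(z^* )w,\nabla H_i(z^* )w)\in T_{\Omega_i}(G_i(z^* ),H_i(z^* ))$, $i=1,\dots,J$, one has $$\left.\begin{array}{l}\nabla F(z^* )^T\lambda^F+\sum_{i=1}^J\{\nabla G_i(z^* )^T\lambda_i^G+\nabla H_i(z^* )^T\lambda_i^H\}=0,\\ \lambda^F\in N_\Lambda(F(z^* );\nabla F(z^* )w),\\ (\lambda_i^G,\lambda_i^H)\in N_{\Omega_i}\big((G_i(z^* ),H_i(z^* ));(\nabla G_i(z^* )w,\nabla H_i(z^* )w)\big),\ i=1,\dots,J\end{array}\right\}\Longrightarrow(\lambda^G,\lambda^H)=0.$$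 (B) For every $0\neq w\in\mathbb{R}^n$ with $\nabla F(z^* )w\in T_\Lambda(F(z^* ))$ and $(\nabla G(z^* )w,\nabla H(z^* )w)\in T_\Omega(G(z^* ),H(z^* ))$, one has $$\left.\begin{array}{l}\nabla F(z^* )^T\lambda^F+\nabla G(z^* )^T\lambda^G+\nabla H(z^* )^T\lambda^H=0,\\ \lambda^F\in N_\Lambda(F(z^* );\nabla F(z^* )w),\\ (\lambda^G,\lambda^H)\in N_\Omega\big((G(z^* ),H(z^* ));(\nabla G(z^* )w,\nabla H(z^* )w)\big)\end{array}\right\}\Longrightarrow(\lambda^G,\lambda^H)=0.$$ Conditions (A) and (B) are equivalent, and if (A) (equivalently (B)) holds, then the system $\mathcal K\ni G(z)\perp H(z)\in\mathcal K$, $F(z)\in\Lambda$ has a local error bound at $z^*$.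
   Context: $\mathcal K_i=\{(x_1,x_2)\in\mathbb{R}\times\mathbb{R}^{m_i-1}:x_1\ge\|x_2\|\}$ ($=\mathbb{R}_+$ if $m_i=1$). $\Omega=\{(x,y)\in\mathbb{R}^m\times\mathbb{R}^m:\mathcal K\ni x\perp y\in\mathcal K\}$, $\Omega_i=\{(x,y)\in\mathbb{R}^{m_i}\times\mathbb{R}^{m_i}:\mathcal K_i\ni x\perp y\in\mathcal K_i\}$; $\lambda^G=(\lambda_1^G,\dots,\lambda_J^G)$, $\lambda^H=(\lambda_1^H,\dots,\lambda_J^H)$ with $\lambda_i^G,\lambda_i^H\in\mathbb{R}^{m_i}$. $\nabla$ denotes the Jacobian matrix; $d_C(z)=d(z,C)$ is Euclidean distance. $M(z)=F(z)-\Lambda$ is metrically subregular at $(z^*,0)$ if there are a neighborhood $V$ of $z^*$ and $\kappa>0$ with $d(z,\{z':F(z')\in\Lambda\})\le\kappa\,d_\Lambda(F(z))$ for all $z\in V$. The system has a local error bound at $z^*\in\mathcal F$ if there are $\kappa>0$ and a neighborhood $U$ of $z^*$ with $d(z,\mathcal F)\le\kappa\{d_\Lambda(F(z))+\sum_{i=1}^Jd_{\Omega_i}(G_i(z),H_i(z))\}$ for all $z\in U$. For $C\subseteq\mathbb{R}^n$, $z\in C$: $T_C(z)=\{u:\exists t_k\downarrow 0,\ u_k\to u \text{ with } z+t_ku_k\in C\ \forall k\}$; regular normal cone $\widehat N_C(z)=\{v:\langle v,z'-z\rangle\le o(\|z'-z\|)\ \forall z'\in C\}$ for $z\in C$ and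 $\emptyset$ for $z\notin C$; directional limiting normal cone $N_C(z;d)=\{v:\exists t_k\downarrow0,\ d_k\to d,\ v_k\to v\text{ with }v_k\in\widehat N_C(z+t_kd_k)\ \forall k\}$. *)

(* Defs.v *)
From HB Require Import structures.
From mathcomp Require Export all_boot all_order all_algebra.
From mathcomp Require Export boolp classical_sets reals topology normedtype.
From mathcomp Require Export sequences derive.
Export Order.TTheory GRing.Theory Num.Theory numFieldNormedType.Exports.

#[export] Set Implicit Arguments.
#[export] Unset Strict Implicit.
#[export] Unset Printing Implicit Defensive.

#[local] Open Scope classical_set_scope.
#[local] Open Scope ring_scope.

(* R^k is 'rV[R]_k with the library's topology.  The library norm `|x| on
   matrices is the sup norm, so the Euclidean structure is introduced here. *)
Section Euclidean.
Context {R : realType}.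

Definition dot k (x y : 'rV[R]_k) : R := \sum_(j < k) x ord0 j * y ord0 j.

Definition enorm k (x : 'rV[R]_k) : R := Num.sqrt (dot x x).

(* inf is the real-valued infimum: the value is meaningful only for C
   nonempty (inf set0 = 0). *)
Definition dist k (C : set 'rV[R]_k) (z : 'rV[R]_k) : R :=
  inf [set enorm (z - c) | c in C].

End Euclidean.

Section Variational.
Context {R : realType}.

Definition decreases_to0 (t : nat -> R) : Prop :=
  (forall k, 0 < t k) /\ t @ \oo --> (0 : R).

Definition tangent_cone k (C : set 'rV[R]_k) (z : 'rV[R]_k) : set 'rV[R]_k :=
  [set u | exists (t : nat -> R) (us : nat -> 'rV[R]_k),
     [/\ decreases_to0 t, us @ \oo --> u &
         forall j, C (z + t j *: us j)]].

Definition regular_normal_cone k (C : set 'rV[R]_k) (z : 'rV[R]_k) :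
    set 'rV[R]_k :=
  [set v | C z /\
     forall e : R, 0 < e -> \forall z' \near z,
       C z' -> dot v (z' - z) <= e * enorm (z' - z)].

Definition dir_normal_cone k (C : set 'rV[R]_k) (z d : 'rV[R]_k) :
    set 'rV[R]_k :=
  [set v | exists (t : nat -> R) (ds vs : nat -> 'rV[R]_k),
     [/\ decreases_to0 t, ds @ \oo --> d, vs @ \oo --> v &
         forall j, regular_normal_cone C (z + t j *: ds j) (vs j)]].

(* 'J f z acts on row vectors: w *m 'J f z is the derivative of f at z along
   w, so 'J f z is the transpose of the usual Jacobian matrix. *)
Definition C1 n k (f : 'rV[R]_n -> 'rV[R]_k) : Prop :=
  (forall z, differentiable f z) /\ continuous (jacobian f : 'rV[R]_n -> 'M[R]_(n, k)).

(* ∇f(z) w *)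
Definition jac n k (f : 'rV[R]_n -> 'rV[R]_k) (z w : 'rV[R]_n) : 'rV[R]_k :=
  w *m 'J f z.

(* ∇f(z)^T lam *)
Definition jacT n k (f : 'rV[R]_n -> 'rV[R]_k) (z : 'rV[R]_n)
    (lam : 'rV[R]_k) : 'rV[R]_n :=
  lam *m ('J f z)^T.

(* Metric subregularity at (zs, 0) of the set-valued map z |-> F z - Lam. *)
Definition metrically_subregular n l (F : 'rV[R]_n -> 'rV[R]_l)
    (Lam : set 'rV[R]_l) (zs : 'rV[R]_n) : Prop :=
  exists kappa : R, 0 < kappa /\
    \forall z \near zs, dist (F @^-1` Lam) z <= kappa * dist Lam (F z).

End Variational.

Section SOCComplementarity.
Context {R : realType}.

(* The second-order cone in R^(k+1), that is x_1 >= ||x_2||; for k = 0 the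
   second component is the empty vector and the cone is R_+. *)
Definition soc k : set 'rV[R]_k.+1 :=
  [set x | enorm (rsubmx (x : 'rV[R]_(1 + k))) <= x ord0 ord0].

(* R^k x R^k is encoded as 'rV_(k + k), the pair (x, y) being row_mx x y. *)
Definition compl_set k (K : set 'rV[R]_k) : set 'rV[R]_(k + k) :=
  [set v | [/\ K (lsubmx v), K (rsubmx v) & dot (lsubmx v) (rsubmx v) = 0]].

(* The i-th block has dimension m_i = (p i).+1, so that m_i >= 1; R^m with
   m = \sum_i m_i carries the block decomposition submxrow _ i. *)
Context {J : nat} (p : 'I_J -> nat).

Definition tdim : nat := (\sum_(i < J) (p i).+1)%N.

Definition block (x : 'rV[R]_tdim) (i : 'I_J) : 'rV[R]_(p i).+1 :=
  @submxrow R J (fun i => (p i).+1) 1 x i.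

Definition prod_soc : set 'rV[R]_tdim := [set x | forall i, soc (block x i)].

Definition Omega : set 'rV[R]_(tdim + tdim) := compl_set prod_soc.

Definition Omega_ (i : 'I_J) : set 'rV[R]_((p i).+1 + (p i).+1) :=
  compl_set (@soc (p i)).

Context {n l : nat}.

Definition component (G : 'rV[R]_n -> 'rV[R]_tdim) (i : 'I_J) :
    'rV[R]_n -> 'rV[R]_(p i).+1 := fun z => block (G z) i.

Context (F : 'rV[R]_n -> 'rV[R]_l) (G H : 'rV[R]_n -> 'rV[R]_tdim)
  (Lam : set 'rV[R]_l).

Definition feasible : set 'rV[R]_n :=
  [set z | [/\ prod_soc (G z), prod_soc (H z), dot (G z) (H z) = 0 &
               Lam (F z)]].

Definition local_error_bound (zs : 'rV[R]_n) : Prop :=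
  exists kappa : R, 0 < kappa /\
    \forall z \near zs,
      dist feasible z <=
        kappa * (dist Lam (F z) +
                 \sum_(i < J) dist (@Omega_ i) (row_mx (component G i z) (component H i z))).

Definition blockwise_condition (zs : 'rV[R]_n) : Prop :=
  forall w : 'rV[R]_n, w != 0 ->
    tangent_cone Lam (F zs) (jac F zs w) ->
    (forall i, tangent_cone (@Omega_ i)
       (row_mx (component G i zs) (component H i zs))
       (row_mx (jac (component G i) zs w) (jac (component H i) zs w))) ->
  forall (lamF : 'rV[R]_l) (lamG lamH : 'rV[R]_tdim),
    jacT F zs lamF +
      \sum_(i < J) (jacT (component G i) zs (block lamG i) +
                    jacT (component H i) zs (block lamH i)) = 0 ->
    dir_normal_cone Lam (F zs) (jac F zs w) lamF ->
    (forall i, dir_normal_cone (@Omega_ i)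
       (row_mx (component G i zs) (component H i zs))
       (row_mx (jac (component G i) zs w) (jac (component H i) zs w))
       (row_mx (block lamG i) (block lamH i))) ->
    lamG = 0 /\ lamH = 0.

Definition full_condition (zs : 'rV[R]_n) : Prop :=
  forall w : 'rV[R]_n, w != 0 ->
    tangent_cone Lam (F zs) (jac F zs w) ->
    tangent_cone Omega (row_mx (G zs) (H zs))
      (row_mx (jac G zs w) (jac H zs w)) ->
  forall (lamF : 'rV[R]_l) (lamG lamH : 'rV[R]_tdim),
    jacT F zs lamF + jacT G zs lamG + jacT H zs lamH = 0 ->
    dir_normal_cone Lam (F zs) (jac F zs w) lamF ->
    dir_normal_cone Omega (row_mx (G zs) (H zs))
      (row_mx (jac G zs w) (jac H zs w)) (row_mx lamG lamH) ->
    lamG = 0 /\ lamH = 0.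

End SOCComplementarity.

(* Main.v *)
From HB Require Import structures.
Require Import Defs.
From mathcomp Require Import functions landau realfun ring lra.
Local Open Scope classical_set_scope.
Local Open Scope ring_scope.

(* The distance to the solution set is compared with the residual by a penalty
   argument.  If no error bound holds for [P = (G, H)] and [D = Omega], the functions
   [sqrt (d_D(P z)^2 + d^2) + c sqrt (d_Lam(F z)^2 + d^2) + eta sqrt (|z - z0|^2 + d^2)]
   have local minimizers near [zs] outside the solution set; metric subregularity of
   [F - Lam] allows one to fix [c] so large that the normalized multiplier of [D] stays
   bounded away from 0.  Projecting onto [D] and [Lam] turns the first-order condition
   into proximal normals, and a limit along a subsequence contradicts the directional
   condition, with [w] the limit direction of the minimizers.

   For the equivalence, the inclusion of the directional normals to a product in the
   product of the directional normals is immediate; the converse requires the factors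
   to share their steps [t_k].  An explicit formula for the regular normals to the
   second-order cone complementarity set shows that each of its directional normals can
   be realized along arbitrary small steps. *)

(** * Euclidean geometry and distance functions *)

(** The square roots serve two ends. With the nearest points frozen, each has a quadratic majorant
    touching it, so a first-order condition is available although distances are not smooth. Moreover
    the multiplier of [D] has norm [dD / sqrt (dD^2 + d^2)], at least 1/2 as soon as [d <= dD]. The
    shift [d] is fixed after a positive lower bound for [dD + c dL] on a ball free of solutions;
    since the size of [c] forces [dL] below a multiple of [d], the residual [dD] cannot be small as
    well. The other multiplier is bounded by [c] whatever the accuracy, so compactness applies.

    The obstacle in the equivalence is that normals realized along different step sequences in
    different factors cannot be combined. When [x] or [y] is nonzero, the complementarity set is
    locally a smooth pullback of the angle [{0 <= a, 0 <= b, a b = 0}]. Base points then have three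
    types, and for each type there is a curve with the given direction carrying constant
    multipliers, hence a normal at every small step. At the origin the set is a cone, and rescaling
    a single base point suffices. *)

Section Euclidean.
Context {R : realType}.
Implicit Types k : nat.

Lemma dotE k (x y : 'rV[R]_k) : dot x y = (x *m y^T) ord0 ord0.
Proof. by rewrite mxE; apply: eq_bigr => j _; rewrite mxE. Qed.

Lemma dotC k (x y : 'rV[R]_k) : dot x y = dot y x.
Proof. by apply: eq_bigr => j _; rewrite mulrC. Qed.

Lemma dotDl k (x y z : 'rV[R]_k) : dot (x + y) z = dot x z + dot y z.
Proof. by rewrite !dotE mulmxDl mxE. Qed.

Lemma dotZl k a (x z : 'rV[R]_k) : dot (a *: x) z = a * dot x z.
Proof. by rewrite !dotE -scalemxAl mxE. Qed.

Lemma dotDr k (z x y : 'rV[R]_k) : dot z (x + y) = dot z x + dot z y.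
Proof. by rewrite dotC dotDl !(dotC z). Qed.

Lemma dotZr k a (z x : 'rV[R]_k) : dot z (a *: x) = a * dot z x.
Proof. by rewrite dotC dotZl (dotC z). Qed.

Lemma dotNl k (x z : 'rV[R]_k) : dot (- x) z = - dot x z.
Proof. by rewrite -scaleN1r dotZl mulN1r. Qed.

Lemma dotNr k (z x : 'rV[R]_k) : dot z (- x) = - dot z x.
Proof. by rewrite dotC dotNl (dotC z). Qed.

Lemma dotBl k (x y z : 'rV[R]_k) : dot (x - y) z = dot x z - dot y z.
Proof. by rewrite dotDl dotNl. Qed.

Lemma dotBr k (z x y : 'rV[R]_k) : dot z (x - y) = dot z x - dot z y.
Proof. by rewrite dotDr dotNr. Qed.

Lemma dot0l k (x : 'rV[R]_k) : dot 0 x = 0.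
Proof. by rewrite -(scale0r x) dotZl mul0r. Qed.

Lemma dot0r k (x : 'rV[R]_k) : dot x 0 = 0.
Proof. by rewrite dotC dot0l. Qed.

Definition dotDZ := (dotDl, dotDr, dotBl, dotBr, dotNl, dotNr, dotZl, dotZr).

Lemma dotxx_ge0 k (x : 'rV[R]_k) : 0 <= dot x x.
Proof. by apply: sumr_ge0 => j _; rewrite -expr2 sqr_ge0. Qed.

Lemma dotxx_eq0 k (x : 'rV[R]_k) : dot x x = 0 -> x = 0.
Proof.
move=> /psumr_eq0P xx0; apply/rowP => j; rewrite mxE; apply/eqP.
by rewrite -sqrf_eq0 expr2 xx0// => i _; rewrite -expr2 sqr_ge0.
Qed.

Lemma dot_row_mx k1 k2 (a c : 'rV[R]_k1) (b d : 'rV[R]_k2) :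
  dot (row_mx a b) (row_mx c d) = dot a c + dot b d.
Proof. by rewrite !dotE tr_row_mx mul_row_col mxE. Qed.

Lemma dot_split k1 k2 (x y : 'rV[R]_(k1 + k2)) :
  dot x y = dot (lsubmx x) (lsubmx y) + dot (rsubmx x) (rsubmx y).
Proof. by rewrite -dot_row_mx !hsubmxK. Qed.

Lemma enorm_ge0 k (x : 'rV[R]_k) : 0 <= enorm x.
Proof. exact: sqrtr_ge0. Qed.
Hint Resolve enorm_ge0 : core.

Lemma enorm_sqr k (x : 'rV[R]_k) : enorm x ^+ 2 = dot x x.
Proof. by rewrite sqr_sqrtr// dotxx_ge0. Qed.

Lemma enorm0 k : enorm (0 : 'rV[R]_k) = 0.
Proof. by rewrite /enorm dot0l sqrtr0. Qed.

Lemma enorm_eq0 k (x : 'rV[R]_k) : enorm x = 0 -> x = 0.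
Proof. by move=> x0; apply: dotxx_eq0; rewrite -enorm_sqr x0 expr0n. Qed.

Lemma enorm_gt0 k (x : 'rV[R]_k) : x != 0 -> 0 < enorm x.
Proof.
by move=> x0; rewrite lt_neqAle enorm_ge0 andbT eq_sym; apply: contra_neq x0 => /enorm_eq0.
Qed.

Lemma enormZ k a (x : 'rV[R]_k) : enorm (a *: x) = `|a| * enorm x.
Proof.
by rewrite /enorm dotZl dotZr mulrA -expr2 sqrtrM ?sqr_ge0// sqrtr_sqr.
Qed.

Lemma enormN k (x : 'rV[R]_k) : enorm (- x) = enorm x.
Proof. by rewrite -scaleN1r enormZ normrN1 mul1r. Qed.

Lemma enormB k (x y : 'rV[R]_k) : enorm (x - y) = enorm (y - x).
Proof. by rewrite -enormN opprB. Qed.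

Lemma dot_le_enorm k (x y : 'rV[R]_k) : dot x y <= enorm x * enorm y.
Proof.
have [->|/enorm_gt0 x0] := eqVneq x 0; first by rewrite dot0l enorm0 mul0r.
have [->|/enorm_gt0 y0] := eqVneq y 0; first by rewrite dot0r enorm0 mulr0.
(* The square equals [2 |x| |y| (|x| |y| - dot x y)]. *)
have := dotxx_ge0 (enorm y *: x - enorm x *: y).
rewrite !dotDZ -!enorm_sqr (dotC y x) => h.
have xy0 : 0 < enorm x * enorm y by rewrite mulr_gt0.
rewrite -(ler_pM2l xy0); nra.
Qed.

Lemma normr_dot k (x y : 'rV[R]_k) : `|dot x y| <= enorm x * enorm y.
Proof.
by rewrite ler_norml dot_le_enorm andbT lerNl -dotNl -(enormN x) dot_le_enorm.
Qed.

Lemma enormD k (x y : 'rV[R]_k) : enorm (x + y) <= enorm x + enorm y.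
Proof.
rewrite -(@ler_pXn2r _ 2)// ?nnegrE ?addr_ge0//.
rewrite sqrrD !enorm_sqr !dotDZ (dotC y x) -!enorm_sqr.
by have := dot_le_enorm x y; lra.
Qed.

Lemma enorm_triangle k (x y z : 'rV[R]_k) : enorm (x - z) <= enorm (x - y) + enorm (y - z).
Proof. by rewrite -[x - z](subrKA y) enormD. Qed.

Lemma normr_coord_le k (x : 'rV[R]_k) j : `|x ord0 j| <= enorm x.
Proof.
rewrite -sqrtr_sqr ler_wsqrtr// /dot (bigD1 j)//= expr2 lerDl.
by apply: sumr_ge0 => i _; rewrite -expr2 sqr_ge0.
Qed.

Lemma norm_le_enorm k (x : 'rV[R]_k) : `|x| <= enorm x.
Proof.
rewrite [`|x|]mx_normrE; apply/bigmax_leP; split=> // -[i j] _ /=.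
by rewrite ord1 normr_coord_le.
Qed.

Lemma enorm_le_norm k (x : 'rV[R]_k) : enorm x <= k%:R * `|x|.
Proof.
rewrite -(@ler_pXn2r _ 2)// ?nnegrE ?mulr_ge0//.
rewrite enorm_sqr exprMn; apply: (@le_trans _ _ (\sum_(j < k) `|x| ^+ 2)).
  apply: ler_sum => j _; rewrite -expr2 -[leLHS]ger0_norm ?sqr_ge0// normrX.
  rewrite lerXn2r ?nnegrE//.
  rewrite [`|x|]mx_normrE.
  exact: (le_bigmax _ (fun ij : 'I_1 * 'I_k => `|x ij.1 ij.2|) (ord0, j)).
rewrite sumr_const card_ord -[leLHS]mulr_natl ler_wpM2r ?sqr_ge0//.
by rewrite -natrX ler_nat; case: (k) => // k'; rewrite leq_pmulr.
Qed.

(** Equivalence of the sup norm and the Euclidean norm; it lets every later neighbourhood argument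
    use Euclidean balls. *)
Lemma near_enormP k (a : 'rV[R]_k) (Q : set 'rV[R]_k) :
  (\forall z \near a, Q z) <->
  exists2 r : R, 0 < r & forall z, enorm (z - a) < r -> Q z.
Proof.
split=> [/nbhs_normP[r /= r0 rQ]|[r r0 rQ]].
  exists r => // z za; apply: rQ => /=.
  by rewrite distrC; apply: le_lt_trans za; exact: norm_le_enorm.
apply/nbhs_normP; exists (r / k.+1%:R) => /=; first by rewrite divr_gt0.
move=> z /=; rewrite distrC ltr_pdivlMr// => za; apply: rQ.
apply: le_lt_trans za; rewrite mulrC (le_trans (enorm_le_norm _))//.
by rewrite ler_wpM2r// ler_nat.
Qed.

Lemma cvg_enormP (T : Type) (F : set_system T) {FF : Filter F} k
    (u : T -> 'rV[R]_k) (a : 'rV[R]_k) :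
  u @ F --> a <->
  forall e : R, 0 < e -> \forall x \near F, enorm (u x - a) < e.
Proof.
split=> [ua e e0|ua].
  by apply: (ua (fun z => enorm (z - a) < e)); apply/near_enormP; exists e.
by move=> Q /near_enormP[r r0 rQ]; apply: filterS (ua r r0) => x; exact: rQ.
Qed.

Lemma cvg_dot (T : Type) (F : set_system T) {FF : Filter F} k
    (u v : T -> 'rV[R]_k) (a b : 'rV[R]_k) :
  u @ F --> a -> v @ F --> b -> (fun x => dot (u x) (v x)) @ F --> dot a b.
Proof.
move=> ua vb; rewrite /dot.
apply: cvg_big => //; first exact: add_continuous.
move=> j _; apply: cvgM.
  exact: (continuous_cvg _ (@coord_continuous R 1 k ord0 j a) ua).
exact: (continuous_cvg _ (@coord_continuous R 1 k ord0 j b) vb).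
Qed.

Lemma cvg_enorm (T : Type) (F : set_system T) {FF : Filter F} k
    (u : T -> 'rV[R]_k) (a : 'rV[R]_k) :
  u @ F --> a -> (fun x => enorm (u x)) @ F --> enorm a.
Proof.
move=> ua; apply: (continuous_cvg _ (@sqrt_continuous R (dot a a))).
exact: cvg_dot.
Qed.

Lemma dist_ge0 k (C : set 'rV[R]_k) z : 0 <= dist C z.
Proof.
have [[c Cc]|C0] := pselect (C !=set0).
  by apply: lb_le_inf; [exists (enorm (z - c)); exists c|move=> _ [d _ <-]].
rewrite /dist (_ : C = set0) ?image_set0 ?inf0//.
by apply/notP => /eqP/set0P.
Qed.

Lemma dist_le k (C : set 'rV[R]_k) z c : C c -> dist C z <= enorm (z - c).
Proof.
move=> Cc.
have lbC : has_lbound [set enorm (z - c) | c in C] by exists 0 => _ [d _ <-].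
by apply: (ge_inf lbC); exists c.
Qed.

Lemma dist_eq0 k (C : set 'rV[R]_k) z : C z -> dist C z = 0.
Proof.
by move=> Cz; have := dist_le z Cz; rewrite subrr enorm0 => h; apply/le_anti; rewrite h dist_ge0.
Qed.

Lemma continuous_enormB k (a : 'rV[R]_k) : continuous (fun z : 'rV[R]_k => enorm (z - a)).
Proof.
move=> z; apply/(@cvgrPdist_lt _ _ _ (nbhs z)) => e e0.
apply/near_enormP; exists e => // y yz.
apply: le_lt_trans yz; rewrite ler_norml.
have := enorm_triangle z y a; have := enorm_triangle y z a.
by rewrite (enormB z y) => h1 h2; apply/andP; split; lra.
Qed.

Lemma enorm_ball_compact k (a : 'rV[R]_k) r : compact [set z | enorm (z - a) <= r].
Proof.
apply: bounded_closed_compact.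
  exists (`|a| + r); split; first exact: num_real.
  move=> M /ltW rM z /= za; apply: le_trans rM.
  rewrite -[z](subrK a) addrC (le_trans (ler_normD _ _))// lerD2l.
  exact: le_trans (norm_le_enorm _) za.
have := (@closed_comp _ _ (fun z : 'rV[R]_k => enorm (z - a)) [set t : R | t <= r]).
apply; last exact: closed_le.
by move=> z _; exact: continuous_enormB.
Qed.

Lemma dist_attained k (C : set 'rV[R]_k) z : closed C -> C !=set0 ->
  exists2 c, C c & dist C z = enorm (z - c).
Proof.
move=> clC [c0 Cc0].
(* Only points of [C] at least as close to [z] as [c0] compete, and they form a compact set. *)
pose B := C `&` [set c | enorm (c - z) <= enorm (c0 - z)].
have cB : compact B by rewrite /B setIC; apply: compact_closedI => //; exact: enorm_ball_compact.
have cont : {within B, continuous (fun c : 'rV[R]_k => enorm (c - z))}.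
  exact/continuous_subspaceT/continuous_enormB.
have B0 : B !=set0 by exists c0; split => /=.
have [c /set_mem[Cc _] cmin] := EVT_min_rV B0 cB cont.
exists c => //; apply/le_anti; rewrite dist_le//=.
apply: lb_le_inf; first by exists (enorm (z - c)); exists c.
move=> _ [d Cd <-]; rewrite (enormB z) (enormB z).
have [dz|dz] := leP (enorm (d - z)) (enorm (c0 - z)).
  by apply: cmin; rewrite inE.
by apply: le_trans (ltW dz); apply: cmin; rewrite inE; split => /=.
Qed.

Lemma dist_lip k (C : set 'rV[R]_k) z z' : closed C -> C !=set0 ->
  dist C z <= dist C z' + enorm (z - z').
Proof.
move=> clC C0; have [c Cc ->] := dist_attained z' clC C0.
by rewrite addrC (le_trans (dist_le z Cc))// enorm_triangle.
Qed.

Lemma continuous_dist k (C : set 'rV[R]_k) : closed C -> C !=set0 ->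
  continuous (dist C).
Proof.
move=> clC C0 z; apply/(@cvgrPdist_lt _ _ _ (nbhs z)) => e e0.
apply/near_enormP; exists e => // y yz; apply: le_lt_trans yz; rewrite ler_norml.
have := dist_lip z y clC C0; have := dist_lip y z clC C0.
by rewrite (enormB z) => h1 h2; apply/andP; split; lra.
Qed.

Lemma dist0_mem k (C : set 'rV[R]_k) z : closed C -> C !=set0 ->
  dist C z = 0 -> C z.
Proof.
move=> clC C0; have [c Cc ->] := dist_attained z clC C0.
by move=> /enorm_eq0/eqP; rewrite subr_eq0 => /eqP ->.
Qed.

(** Expanding [|y - c|^2 <= |y - c'|^2] bounds [dot (y - c) (c' - c)] by [|c' - c|^2 / 2], which is
    of second order. *)
Lemma proximal_normal k (C : set 'rV[R]_k) y c s : C c -> 0 <= s ->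
  (forall c', C c' -> enorm (y - c) <= enorm (y - c')) ->
  regular_normal_cone C c (s *: (y - c)).
Proof.
move=> Cc s0 cmin; split=> // e e0; apply/near_enormP.
exists (e / (s + 1)); first by rewrite divr_gt0// ltr_wpDl.
move=> c' c'c Cc'.
have h : dot (y - c) (c' - c) <= enorm (c' - c) ^+ 2 / 2.
  have := cmin _ Cc'; rewrite -(@ler_pXn2r _ 2)// ?nnegrE//.
  have -> : y - c' = (y - c) - (c' - c) by rewrite opprB addrA subrK.
  by rewrite !enorm_sqr !dotDZ; rewrite (dotC c' y) (dotC c y) (dotC c' c); lra.
rewrite dotZl.
have {}c'c : enorm (c' - c) * (s + 1) <= e by rewrite -ler_pdivlMr ?ltW// ltr_wpDl.
have := enorm_ge0 (c' - c); nra.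
Qed.

Lemma regular_normal_in k (C : set 'rV[R]_k) z v : regular_normal_cone C z v -> C z.
Proof. by case. Qed.

End Euclidean.
#[global] Hint Extern 0 (is_true (@Order.le _ _ _ (enorm _))) =>
  solve[exact: enorm_ge0] : core.

(** * Smooth maps and approximate multipliers *)

Section Smooth.
Context {R : realType}.

Lemma jacobian_expansion n k (f : 'rV[R]_n -> 'rV[R]_k) z : differentiable f z ->
  forall e : R, 0 < e -> exists2 r : R, 0 < r &
    forall h, enorm h < r -> enorm (f (z + h) - f z - jac f z h) <= e * enorm h.
Proof.
move=> df e e0.
have e'0 : 0 < e / k.+1%:R by rewrite divr_gt0.
have := diff_locally df => /eqaddoP /(_ _ e'0) /near_enormP[r r0 H].
exists r => // h hr.
have := H h; rewrite subr0 => /(_ hr) /=.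
rewrite /jac /jacobian mul_rV_lin1.
rewrite [X in `|X| <= _ -> _](_ : _ = f (z + h) - f z - 'd f z h); last first.
  by rewrite -[LHS]/(f (h + z) - (f z + 'd f z h)) opprD addrA (addrC z).
move=> hh; apply: (le_trans (enorm_le_norm _)).
apply: (@le_trans _ _ (k.+1%:R * (e / k.+1%:R * `|h|))).
  by apply: ler_pM => //; rewrite ler_nat.
rewrite mulrA (mulrC k.+1%:R) divfK ?pnatr_eq0//.
by rewrite ler_wpM2l ?norm_le_enorm// ltW.
Qed.

Lemma enorm_mulmx n k (h : 'rV[R]_n) (A : 'M[R]_(n, k)) :
  enorm (h *m A) <= k%:R * (n%:R * `|A|) * enorm h.
Proof.
apply: (le_trans (enorm_le_norm _)); rewrite -!mulrA; apply: ler_wpM2l => //.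
rewrite [leLHS]mx_normrE; apply/bigmax_leP; split=> [|[i j] _ /=].
  by do ?apply: mulr_ge0.
rewrite mxE; apply: (le_trans (ler_norm_sum _ _ _)).
apply: (@le_trans _ _ (\sum_(i0 < n) (`|A| * enorm h))); last first.
  by rewrite sumr_const card_ord -[leLHS]mulr_natl.
apply: ler_sum => q _; rewrite normrM mulrC ord1; apply: ler_pM => //.
  rewrite [`|A|]mx_normrE.
  exact: (le_bigmax _ (fun ij : 'I_n * 'I_k => `|A ij.1 ij.2|) (q, j)).
exact: normr_coord_le.
Qed.

Lemma jac_continuous_bound n k (f : 'rV[R]_n -> 'rV[R]_k) a : C1 f ->
  exists L r : R, [/\ 0 < L, 0 < r & forall z h, enorm (z - a) < r ->
    enorm (jac f z h) <= L * enorm h].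
Proof.
move=> [_ /(_ a) cf].
have := cf; move/(@cvgrPdist_lt _ _ _ (nbhs a)) => /(_ 1 ltr01) /near_enormP[r r0 H].
exists (k%:R * (n%:R * (`|'J f a| + 1)) + 1), r; split=> //.
  by rewrite ltr_wpDl// !mulr_ge0// addr_ge0.
move=> z h /H zr; apply: (le_trans (enorm_mulmx _ _)).
apply: ler_wpM2r => //; rewrite -[leLHS]addr0; apply: lerD => //; do 2!apply: ler_wpM2l => //.
have -> : 'J f z = 'J f a - ('J f a - 'J f z) by rewrite opprB addrC subrK.
by rewrite (le_trans (ler_normB _ _))// lerD2l ltW.
Qed.

(** The mean value theorem is applied to each coordinate along the segment from [y] to [x]; passing
    from coordinates to the Euclidean norm costs the factor [k.+1]. *)
Lemma C1_lipschitz n k (f : 'rV[R]_n -> 'rV[R]_k) a : C1 f ->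
  exists L r : R, [/\ 0 < L, 0 < r & forall x y, enorm (x - a) < r -> enorm (y - a) < r ->
    enorm (f x - f y) <= L * enorm (x - y)].
Proof.
move=> f1; have [L [r [L0 r0 Lr]]] := jac_continuous_bound a f1.
exists (k.+1%:R * L), r; split=> //; first by rewrite mulr_gt0.
move=> x y xa ya; apply: (le_trans (enorm_le_norm _)).
have [df cf] := f1.
have main j : `|(f x - f y) ord0 j| <= L * enorm (x - y).
  set u := x - y.
  pose c : R -> 'rV[R]_n := cst y + ( *:%R ^~ u).
  pose pj : 'rV[R]_k -> R := fun v : 'rV[R]_k => v ord0 j.
  have dc (s : R) : is_diff s c ( *:%R ^~ u).
    rewrite -[X in is_diff _ _ X]add0r; exact: is_diffD.
  have [pjl pjE] : exists pjl : {linear 'rV[R]_k -> R}, pjl =1 pj.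
    have pjlin : linear pj by move=> b v w; rewrite /pj !mxE.
    pose l := GRing.isLinear.Build R 'rV[R]_k R _ pj pjlin.
    by exists (HB.pack pj l : {linear 'rV[R]_k -> R}).
  have {}pjE : pj = pjl by apply/funext => v; rewrite pjE.
  have dpj v : is_diff v pj pj.
    rewrite pjE; have cpj : continuous pjl by rewrite -pjE; exact: coord_continuous.
    by apply: DiffDef; [exact: linear_differentiable|rewrite diff_lin].
  have d1 (s : R) : differentiable (pj \o f) (c s) by apply: differentiable_comp.
  have d2 (s : R) : differentiable (pj \o f \o c) s.
    exact: (differentiable_comp _ (d1 s)).
  have dg (s : R) : is_derive s (1 : R) (pj \o f \o c) ((jac f (c s) u) ord0 j).
    apply: DeriveDef; first exact: diff_derivable.
    rewrite deriveE// diff_comp//= diff_val scale1r diff_comp//= diff_val.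
    by rewrite /jac /jacobian mul_rV_lin1.
  have cg : {within `[(0:R), 1], continuous (pj \o f \o c)}.
    apply: continuous_subspaceT => s; exact/differentiable_continuous/d2.
  have [s s01] := MVT ltr01 (fun s _ => dg s) cg.
  rewrite subr0 mulr1 => hs.
  have -> : (f x - f y) ord0 j = (pj \o f \o c) 1 - (pj \o f \o c) 0.
    rewrite /pj /= /c -![(_ + _ : _ -> _) _]/(_ + _) /cst /= scale1r scale0r addr0 /u.
    by rewrite addrC subrK !mxE.
  rewrite hs; apply: (le_trans (normr_coord_le _ _)); apply: Lr.
  rewrite -[c s]/(y + s *: u).
  (* A convex combination of two points of the ball stays in the ball. *)
  have -> : y + s *: u - a = (1 - s) *: (y - a) + s *: (x - a).
    by rewrite /u !scalerBr scalerBl !scale1r; apply/rowP => i; rewrite !mxE; ring.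
  apply: (le_lt_trans (enormD _ _)); rewrite !enormZ.
  move: s01; rewrite in_itv /= => /andP[s0 s1].
  rewrite ger0_norm ?subr_ge0 1?ltW// gtr0_norm//.
  by nra.
rewrite -mulrA; apply: ler_pM => //; first by rewrite ler_nat.
rewrite [`|f x - f y|]mx_normrE.
apply/bigmax_leP; split=> [|[i j] _ /=]; last by rewrite ord1 main.
by rewrite mulr_ge0// ltW.
Qed.

Lemma C1_continuous n k (f : 'rV[R]_n -> 'rV[R]_k) : C1 f -> continuous f.
Proof. by move=> [df _] z; exact: differentiable_continuous. Qed.

Lemma dot_jac n k (f : 'rV[R]_n -> 'rV[R]_k) z u v :
  dot (jac f z u) v = dot u (jacT f z v).
Proof. by rewrite !dotE /jac /jacT trmx_mul trmxK mulmxA. Qed.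

Lemma jacTZ n k (f : 'rV[R]_n -> 'rV[R]_k) z a v :
  jacT f z (a *: v) = a *: jacT f z v.
Proof. by rewrite /jacT -scalemxAl. Qed.

Lemma jac_cvg n k (f : 'rV[R]_n -> 'rV[R]_k) z u : differentiable f z ->
  (fun s : R => s^-1 *: (f (z + s *: u) - f z)) @ 0^'+ --> jac f z u.
Proof.
move=> df; apply/cvg_enormP => e e0.
have e'0 : 0 < e / (enorm u + 1) by rewrite divr_gt0// ltr_wpDl.
have [r r0 H] := jacobian_expansion df e'0.
have r'0 : 0 < r / (enorm u + 1) by rewrite divr_gt0// ltr_wpDl.
near=> s.
have s0 : 0 < s by [].
have sr : s * (enorm u + 1) < r.
  by rewrite -ltr_pdivlMr ?ltr_wpDl//; near: s; exact: nbhs_right_lt.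
have su : enorm (s *: u) < r by rewrite enormZ gtr0_norm//; nra.
have -> : s^-1 *: (f (z + s *: u) - f z) - jac f z u =
    s^-1 *: (f (z + s *: u) - f z - jac f z (s *: u)).
  by rewrite [in RHS]scalerBr [in RHS]/jac -scalemxAl scalerA mulVf ?gt_eqF// scale1r.
rewrite enormZ gtr0_norm ?invr_gt0// mulrC ltr_pdivrMr//.
apply: (le_lt_trans (H _ su)); rewrite enormZ gtr0_norm//.
rewrite [X in _ < X](_ : _ = e / (enorm u + 1) * (s * (enorm u + 1))); last first.
  by field; rewrite gt_eqF// ltr_wpDl.
by rewrite ltr_pM2l// ltr_pM2l// ltrDl.
Unshelve. all: by end_near. Qed.

(** With [a = f (z + s u) - f z] and [b = f z - c], the difference of squares is [dot a (a + 2 b)];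
    after division by [s] the two factors tend to [d] and [2 b]. *)
Lemma sqdist_cvg n k (f : 'rV[R]_n -> 'rV[R]_k) z u c d :
  (fun s : R => s^-1 *: (f (z + s *: u) - f z)) @ 0^'+ --> d ->
  (fun s : R => s^-1 * (enorm (f (z + s *: u) - c) ^+ 2 - enorm (f z - c) ^+ 2)) @ 0^'+
  --> 2 * dot d (f z - c).
Proof.
move=> fd.
have id0 : (fun s : R => s) @ 0^'+ --> (0 : R).
  by apply: cvg_at_right_filter; exact: cvg_id.
have : (fun s : R => dot (s^-1 *: (f (z + s *: u) - f z))
    (s *: (s^-1 *: (f (z + s *: u) - f z)) + 2 *: (f z - c))) @ 0^'+ -->
    dot d (0 *: d + 2 *: (f z - c)).
  by apply: cvg_dot => //; apply: cvgD; [exact: cvgZ|exact: cvg_cst].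
rewrite scale0r add0r dotZr; apply: cvg_trans; apply: near_eq_cvg.
near=> s; have s0 : s != 0 by rewrite gt_eqF.
rewrite scalerA divff// scale1r dotZl !enorm_sqr.
have -> : f (z + s *: u) - c = (f (z + s *: u) - f z) + (f z - c) by rewrite addrA subrK.
move: (f (z + s *: u) - f z) (f z - c) => a b.
by rewrite !dotDl !dotDr !dotZr (dotC b a); ring.
Unshelve. all: by end_near. Qed.

End Smooth.

(** * Smoothed penalty functions and their minimizers *)

Section ErrorBound.
Context {R : realType}.

Lemma mul_le_divr (a b x : R) : 0 < a -> x <= b / a -> a * x <= b.
Proof. by move=> a0; rewrite ler_pdivlMr// mulrC. Qed.

Lemma min_quarter (a b : R) :
  4 * (Num.min a b / 4) <= a /\ 4 * (Num.min a b / 4) <= b.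
Proof. by case: (leP a b) => h; split; lra. Qed.

(** A smooth substitute for the absolute value, within [|d|] of it; its slope [a / smooth_abs d a]
    becomes the norm of a multiplier. *)
Definition smooth_abs (d a : R) : R := Num.sqrt (a ^+ 2 + d ^+ 2).

Lemma smooth_abs_sqr d a : smooth_abs d a ^+ 2 = a ^+ 2 + d ^+ 2.
Proof. by rewrite sqr_sqrtr// addr_ge0// sqr_ge0. Qed.

Lemma smooth_abs_ge0 d a : 0 <= smooth_abs d a.
Proof. exact: sqrtr_ge0. Qed.

Lemma smooth_abs_gt0 d a : 0 < d -> 0 < smooth_abs d a.
Proof. by move=> d0; rewrite sqrtr_gt0 ltr_wpDl ?sqr_ge0// exprn_gt0. Qed.

Lemma smooth_abs_ge d a : a <= smooth_abs d a.
Proof.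
have := smooth_abs_sqr d a; have := smooth_abs_ge0 d a.
by have := sqr_ge0 d; nra.
Qed.

Lemma smooth_abs0 d : 0 <= d -> smooth_abs d 0 = d.
Proof. by move=> d0; rewrite /smooth_abs expr0n add0r sqrtr_sqr ger0_norm. Qed.

Lemma smooth_abs_le d a b : 0 <= a -> a <= b -> smooth_abs d a <= smooth_abs d b.
Proof.
move=> a0 ab; rewrite ler_wsqrtr// lerD2r lerXn2r// ?nnegrE//.
exact: le_trans ab.
Qed.

Lemma smooth_absD d a x : 0 <= a -> 0 <= x ->
  smooth_abs d (a + x) <= smooth_abs d a + x.
Proof.
move=> a0 x0; rewrite -(@ler_pXn2r _ 2)// ?nnegrE ?addr_ge0 ?smooth_abs_ge0//.
have := smooth_abs_ge d a; rewrite sqrrD !smooth_abs_sqr; nra.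
Qed.

(** Squaring gives [3 x^2 <= 4 d x]. This turns an estimate of the penalty term at a minimizer into
    a bound of the residual by the shift. *)
Lemma smooth_abs_slack d x : 0 <= d -> 0 <= x ->
  2 * smooth_abs d x <= 2 * d + x -> 3 * x <= 4 * d.
Proof.
move=> d0 x0 h; have := smooth_abs_sqr d x; have := smooth_abs_ge0 d x.
move: (smooth_abs d x) h => y h y0 xy.
have h2 : (2 * y) ^+ 2 <= (2 * d + x) ^+ 2 by rewrite lerXn2r// ?nnegrE; lra.
have h3 : x * (3 * x) <= x * (4 * d) by nra.
have [->|xn0] := eqVneq x 0; first by lra.
by rewrite ler_pM2l// in h3; rewrite lt_neqAle eq_sym xn0.
Qed.

(** Tangent-line inequality for the square root as a function of [a ^+ 2]; the gap is a nonnegative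
    multiple of [(smooth_abs d b - smooth_abs d a) ^+ 2]. *)
Lemma smooth_abs_concave d a b : 0 < d ->
  smooth_abs d b <= smooth_abs d a + (2 * smooth_abs d a)^-1 * (b ^+ 2 - a ^+ 2).
Proof.
move=> d0; have a0 := smooth_abs_gt0 a d0.
have -> : b ^+ 2 - a ^+ 2 = smooth_abs d b ^+ 2 - smooth_abs d a ^+ 2.
  by rewrite !smooth_abs_sqr; ring.
rewrite -subr_ge0.
have -> : smooth_abs d a + (2 * smooth_abs d a)^-1 * (smooth_abs d b ^+ 2 - smooth_abs d a ^+ 2)
   - smooth_abs d b = (2 * smooth_abs d a)^-1 * (smooth_abs d b - smooth_abs d a) ^+ 2.
  by field; rewrite gt_eqF.
by rewrite mulr_ge0 ?sqr_ge0// invr_ge0 mulr_ge0// ltW.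
Qed.

Lemma cvg_smooth_abs (T : Type) (F : set_system T) {FF : Filter F} d (u : T -> R) a :
  u @ F --> a -> (fun x => smooth_abs d (u x)) @ F --> smooth_abs d a.
Proof.
move=> ua; apply: (continuous_cvg _ (@sqrt_continuous R (a ^+ 2 + d ^+ 2))).
by apply: cvgD; [exact: cvgM|exact: cvg_cst].
Qed.

Lemma continuous_addM (T : topologicalType) (f g : T -> R) c :
  continuous f -> continuous g -> continuous (fun x => f x + c * g x).
Proof.
move=> cf cg x; apply: cvgD; first exact: cf.
by apply: cvgM; [exact: cvg_cst|exact: cg].
Qed.

Lemma continuous_smooth_abs (T : topologicalType) d (f : T -> R) :
  continuous f -> continuous (fun x => smooth_abs d (f x)).
Proof. by move=> cf x; apply: cvg_smooth_abs; exact: cf. Qed.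

(** Fermat's rule. The one-sided derivative along [u] is [2 dot u V], where [V] is the vector
    claimed to vanish; it is nonnegative for every [u], in particular for [- V]. *)
Lemma sqdist_stationary n l m (F : 'rV[R]_n -> 'rV[R]_l) (P : 'rV[R]_n -> 'rV[R]_m)
    z z0 q r (a b c rho : R) :
  differentiable F z -> differentiable P z -> 0 < rho ->
  (forall u, enorm u < rho ->
    a * enorm (P z - r) ^+ 2 + b * enorm (F z - q) ^+ 2 + c * enorm (z - z0) ^+ 2
    <= a * enorm (P (z + u) - r) ^+ 2 + b * enorm (F (z + u) - q) ^+ 2
       + c * enorm (z + u - z0) ^+ 2) ->
  jacT P z (a *: (P z - r)) + jacT F z (b *: (F z - q)) + c *: (z - z0) = 0.
Proof.
move=> dF dP rho0 zmin.
set V := (X in X = 0).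
have main u : 0 <= 2 * dot u V.
  have idu : (fun s : R => s^-1 *: (id (z + s *: u) - id z)) @ 0^'+ --> u.
    apply/cvg_enormP => e e0; near=> s.
    have s0 : s != 0 by rewrite gt_eqF.
    by rewrite /= [z + _]addrC addrK scalerA mulVf// scale1r subrr enorm0.
  have cP := sqdist_cvg (c := r) (jac_cvg (u := u) dP).
  have cF := sqdist_cvg (c := q) (jac_cvg (u := u) dF).
  have cz := sqdist_cvg (f := id) (c := z0) idu.
  have cv : (fun s : R =>
      a * (s^-1 * (enorm (P (z + s *: u) - r) ^+ 2 - enorm (P z - r) ^+ 2)) +
      b * (s^-1 * (enorm (F (z + s *: u) - q) ^+ 2 - enorm (F z - q) ^+ 2)) +
      c * (s^-1 * (enorm (z + s *: u - z0) ^+ 2 - enorm (z - z0) ^+ 2))) @ 0^'+ -->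
      2 * dot u V.
    rewrite [X in _ --> X](_ : _ = a * (2 * dot (jac P z u) (P z - r)) +
      b * (2 * dot (jac F z u) (F z - q)) + c * (2 * dot u (z - z0))).
      by apply: cvgD; [apply: cvgD|]; (apply: cvgM; [exact: cvg_cst|]).
    rewrite !dot_jac /V; move: (z - z0) => v.
    by rewrite !dotDr /jacT -!scalemxAl !dotZr; ring.
  rewrite -(cvg_lim _ cv)//; apply: limr_ge; first by apply: cvgP cv.
  near=> s; have s0 : 0 < s by [].
  have su : enorm (s *: u) < rho.
    rewrite enormZ gtr0_norm//.
    have : s * (enorm u + 1) < rho.
      rewrite -ltr_pdivlMr ?ltr_wpDl//; near: s; apply: nbhs_right_lt.
      by rewrite divr_gt0// ltr_wpDl.
    by nra.
  have := zmin _ su; rewrite /= -subr_ge0 => h.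
  rewrite [X in 0 <= X](_ : _ = s^-1 * (a * enorm (P (z + s *: u) - r) ^+ 2 +
    b * enorm (F (z + s *: u) - q) ^+ 2 + c * enorm (z + s *: u - z0) ^+ 2 -
    (a * enorm (P z - r) ^+ 2 + b * enorm (F z - q) ^+ 2 + c * enorm (z - z0) ^+ 2))).
    by rewrite mulr_ge0// invr_ge0 ltW.
  by ring.
apply: dotxx_eq0; apply/le_anti; rewrite dotxx_ge0 andbT.
by have := main (- V); rewrite dotNl; lra.
Unshelve. all: by end_near. Qed.

Definition solution_set n l m (F : 'rV[R]_n -> 'rV[R]_l) (P : 'rV[R]_n -> 'rV[R]_m)
    (Lam : set 'rV[R]_l) (D : set 'rV[R]_m) : set 'rV[R]_n :=
  [set z | Lam (F z) /\ D (P z)].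

Definition error_bound n l m (F : 'rV[R]_n -> 'rV[R]_l) (P : 'rV[R]_n -> 'rV[R]_m)
    (Lam : set 'rV[R]_l) (D : set 'rV[R]_m) (zs : 'rV[R]_n) : Prop :=
  exists kappa : R, 0 < kappa /\ \forall z \near zs,
    dist (solution_set F P Lam D) z <= kappa * (dist Lam (F z) + dist D (P z)).

Lemma continuous_dist_comp n k (f : 'rV[R]_n -> 'rV[R]_k) (C : set 'rV[R]_k) :
  C1 f -> closed C -> C !=set0 -> continuous (fun z => dist C (f z)).
Proof.
move=> f1 clC C0 z; apply: (@continuous_comp _ _ _ f (dist C)).
  exact: C1_continuous.
exact: continuous_dist.
Qed.

(** [C] precedes [e], so the multipliers stay in one compact set as [e] tends to 0, while the lower
    bound on [mu] survives in the limit. The points [q] and [r] are close relative to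
    [enorm (z - zs)], hence have the same limiting directions as [F z] and [P z]. *)
Lemma approximate_multipliers n l m (F : 'rV[R]_n -> 'rV[R]_l)
    (P : 'rV[R]_n -> 'rV[R]_m) (Lam : set 'rV[R]_l) (D : set 'rV[R]_m)
    (zs : 'rV[R]_n) :
  closed Lam -> closed D -> C1 F -> C1 P -> Lam (F zs) -> D (P zs) ->
  metrically_subregular F Lam zs -> ~ error_bound F P Lam D zs ->
  exists C : R, forall e : R, 0 < e ->
  exists (z : 'rV[R]_n) (q nu : 'rV[R]_l) (r mu : 'rV[R]_m),
  [/\ z != zs, enorm (z - zs) < e,
      regular_normal_cone Lam q nu & regular_normal_cone D r mu] /\
  [/\ enorm (q - F z) <= e * enorm (z - zs), enorm (r - P z) <= e * enorm (z - zs),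
      enorm (jacT P z mu + jacT F z nu) <= e,
      1 / 2 <= enorm mu <= 1 & enorm nu <= C].
Proof.
move=> Lam_closed D_closed F1 P1 zsF zsP Fsub neb.
have Lam0 : Lam !=set0 by exists (F zs).
have D0 : D !=set0 by exists (P zs).
have continuous_dL := continuous_dist_comp F1 Lam_closed Lam0.
have continuous_dD := continuous_dist_comp P1 D_closed D0.
pose dL z := dist Lam (F z); pose dD z := dist D (P z).
have dL_ge0 z : 0 <= dL z by exact: dist_ge0.
have dD_ge0 z : 0 <= dD z by exact: dist_ge0.
have [kappa [kappa0 /near_enormP[r1 r10 Sdist]]] := Fsub.
have [L [r2 [L0 r20 PL]]] := C1_lipschitz zs P1.
set c := 2 * kappa * (L + 1) + 1.
have c1 : 1 <= c by rewrite lerDr !mulr_ge0// ?addr_ge0// ltW.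
have c0 : 0 < c by apply: lt_le_trans c1.
exists c => e e0.
pose r0 := Num.min r1 r2 / 4.
have r00 : 0 < r0 by rewrite divr_gt0// lt_min r10 r20.
have [r0r1 r0r2] := min_quarter r1 r2; rewrite -/r0 in r0r1 r0r2.
pose ep := Num.min e 1 / 4.
have ep0 : 0 < ep by rewrite divr_gt0// lt_min e0/=.
have ep20 : 0 < ep ^+ 2 by exact: exprn_gt0.
have c10 : 0 < 1 + c by exact: addr_gt0.
have [epe ep1] := min_quarter e 1; rewrite -/ep in epe ep1.
pose e1 := Num.min e r0 / 4.
have e10 : 0 < e1 by rewrite divr_gt0// lt_min e0/=.
have [e1e e1r0] := min_quarter e r0; rewrite -/e1 in e1e e1r0.
clearbody r0 ep e1.
(* With this constant the penalized residual at [z0] is at most [ep ^+ 2] times the distance to the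
   solutions: one factor [ep] pays for the weight [eta], the other keeps the minimizer near [z0]. *)
have [z0 [z0zs z0bad]] : exists z0, enorm (z0 - zs) < e1 /\
    (1 + c) / ep ^+ 2 * (dL z0 + dD z0) < dist (solution_set F P Lam D) z0.
  apply: contrapT => H; apply: neb; exists ((1 + c) / ep ^+ 2).
  split; first exact: divr_gt0.
  apply/near_enormP; exists e1 => // z ze; rewrite leNgt; apply/negP => zb.
  by apply: H; exists z.
set dF0 := dist (solution_set F P Lam D) z0 in z0bad.
have solzs : solution_set F P Lam D zs by [].
have dF00 : 0 < dF0.
  apply: le_lt_trans z0bad; by rewrite mulr_ge0 ?addr_ge0// divr_ge0// ltW.
have dF0le : dF0 <= enorm (z0 - zs) by exact: dist_le.
pose psi z := dD z + c * dL z.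
have psi0 : psi z0 <= ep ^+ 2 * dF0.
  apply: (@le_trans _ _ ((1 + c) * (dL z0 + dD z0))).
    by rewrite /psi; have := dL_ge0 z0; have := dD_ge0 z0; nra.
  rewrite -ler_pdivrMl// mulrA (mulrC _ (1 + c)); exact: ltW.
(* A ball of half the distance to the solution set contains no solution, so [psi] has a positive
   minimum on it. *)
have [mm mm0 psimm] : exists2 mm : R, 0 < mm &
    forall z, enorm (z - z0) <= dF0 / 2 -> mm <= psi z.
  pose B := [set z : 'rV[R]_n | enorm (z - z0) <= dF0 / 2].
  have cpsi : {within B, continuous psi}.
    apply: continuous_subspaceT.
    exact: (continuous_addM (c := c) continuous_dD continuous_dL).
  have B0 : B !=set0 by exists z0; rewrite /B /= subrr enorm0 divr_ge0// ltW.
  have [zm /set_mem zmB zmmin] := EVT_min_rV B0 (@enorm_ball_compact R _ _ _) cpsi.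
  exists (psi zm); last by move=> z zB; apply: zmmin; rewrite inE.
  rewrite lt_neqAle addr_ge0 ?mulr_ge0 ?dD_ge0 ?dL_ge0 1?ltW// andbT eq_sym; apply/eqP => psi00.
  have dD00 : dD zm = 0.
    by apply/le_anti; have := dL_ge0 zm; have := dD_ge0 zm; rewrite /psi in psi00; nra.
  have dL00 : dL zm = 0.
    by apply/le_anti; have := dL_ge0 zm; have := dD_ge0 zm; rewrite /psi in psi00; nra.
  have : solution_set F P Lam D zm by split; apply: dist0_mem.
  move=> /(dist_le z0); rewrite -/dF0 enormB.
  by move: zmB; rewrite /B /=; lra.
pose eta := 4 * ep.
have eta0 : 0 < eta by rewrite mulr_gt0.
(* The first bound limits the cost of smoothing at [z0]; the second prevents both residuals at the
   minimizer from being of order [de]. *)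
pose de := Num.min (ep ^+ 2 * dF0 / (1 + c + eta)) (mm / (1 + 2 * c)).
have de0 : 0 < de.
  rewrite lt_min; apply/andP; split; apply: divr_gt0 => //.
  - exact: mulr_gt0.
  - exact: addr_gt0.
  - by rewrite addr_gt0// mulr_gt0.
have de1 : (1 + c + eta) * de <= ep ^+ 2 * dF0.
  by apply: mul_le_divr; [exact: addr_gt0|rewrite ge_min lexx].
have de2 : (1 + 2 * c) * de <= mm.
  by apply: mul_le_divr; [rewrite addr_gt0// mulr_gt0|rewrite ge_min lexx orbT].
clearbody de.
pose g z := smooth_abs de (dD z) + c * smooth_abs de (dL z) +
  eta * smooth_abs de (enorm (z - z0)).
have cg : {within [set z | enorm (z - zs) <= r0], continuous g}.
  apply: continuous_subspaceT; apply: continuous_addM.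
    by apply: continuous_addM; exact: continuous_smooth_abs.
  exact/continuous_smooth_abs/continuous_enormB.
have B0 : [set z | enorm (z - zs) <= r0] !=set0.
  by exists zs; rewrite /= subrr enorm0 ltW.
have [zd /set_mem /= zdB zdmin] := EVT_min_rV B0 (@enorm_ball_compact R _ _ _) cg.
have {}zdmin z : enorm (z - zs) <= r0 -> g zd <= g z by move=> h; apply: zdmin; rewrite inE.
have smd a : 0 <= a -> smooth_abs de a <= a + de.
  move=> a0; rewrite -{1}[a]add0r; apply: (le_trans (smooth_absD _ _ _)) => //.
  by rewrite (smooth_abs0 (ltW de0)) addrC.
have gz0 : g z0 <= 2 * ep ^+ 2 * dF0.
  rewrite /g subrr enorm0 smooth_abs0 ?(ltW de0)//.
  have := smd _ (dD_ge0 z0); have := smd _ (dL_ge0 z0).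
  by move: psi0; rewrite /psi; nra.
have G1 : psi zd + eta * enorm (zd - z0) <= 2 * ep ^+ 2 * dF0.
  apply: (@le_trans _ _ (g zd)); last first.
    by apply: le_trans (zdmin _ _) gz0; lra.
  by rewrite /g /psi !lerD ?ler_pM2l ?smooth_abs_ge.
have zdz0 : enorm (zd - z0) <= dF0 / 2.
  have : 0 <= psi zd by rewrite addr_ge0// mulr_ge0// ltW.
  move: G1; rewrite /eta => h1 h2.
  have : ep * (4 * enorm (zd - z0)) <= ep * (2 * ep * dF0) by move: h1 h2; clear; nra.
  by rewrite ler_pM2l//; move: ep1 dF00; clear; nra.
(* As [4 * e1 <= r0], the minimizer may be perturbed by [2 * e1] without leaving the ball on which
   it is minimal. *)
have zdzs : enorm (zd - zs) <= 2 * e1.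
  by have := enorm_triangle zd z0 zs; move: zdz0 z0zs dF0le e10; clear; lra.
have clS : closed (F @^-1` Lam) by apply: closed_comp => // z _; exact: C1_continuous.
have S0 : (F @^-1` Lam) !=set0 by exists zs.
(* [c] exceeds twice the rate at which the other terms of [g] can grow when [zd] is moved
   to the nearest point of the preimage of [Lam]. *)
have G2 : 3 * dL zd <= 4 * de.
  have [zt St dzt] := dist_attained zd clS S0.
  have ztzd : enorm (zd - zt) <= kappa * dL zd by rewrite -dzt; apply: Sdist; move: zdzs e1r0 r0r1 r00; clear; lra.
  have ztzs : enorm (zd - zt) <= enorm (zd - zs) by rewrite -dzt; exact: dist_le.
  have ztB : enorm (zt - zs) <= 4 * e1.
    by have := enorm_triangle zt zd zs; rewrite (enormB zt zd); move: ztzs zdzs; clear; lra.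
  have gzt : g zd <= g zt by apply: zdmin; move: ztB e1r0; clear; lra.
  have dDzt : dD zt <= dD zd + L * kappa * dL zd.
    apply: (le_trans (dist_lip (P zt) (P zd) D_closed D0)); rewrite lerD2l.
    apply: (@le_trans _ _ (L * enorm (zt - zd))); first by apply: PL; move: ztB zdzs e1r0 r0r2 r00; clear; lra.
    by rewrite -mulrA ler_pM2l// enormB.
  have dLzt : dL zt = 0 by exact: dist_eq0.
  have ztz0 : enorm (zt - z0) <= enorm (zd - z0) + kappa * dL zd.
    by have := enorm_triangle zt zd z0; rewrite (enormB zt zd); move: ztzd; clear; lra.
  have smD : smooth_abs de (dD zt) <= smooth_abs de (dD zd) + L * kappa * dL zd.
    apply: (le_trans (smooth_abs_le _ _ dDzt)) => //.
    by apply: smooth_absD => //; rewrite !mulr_ge0// ltW.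
  have smz : smooth_abs de (enorm (zt - z0)) <=
      smooth_abs de (enorm (zd - z0)) + kappa * dL zd.
    apply: (le_trans (smooth_abs_le _ _ ztz0)) => //.
    by apply: smooth_absD => //; rewrite !mulr_ge0// ltW.
  have smL : c * smooth_abs de (dL zd) <= c * de + (L + 1) * kappa * dL zd.
    move: gzt; rewrite /g dLzt smooth_abs0 ?(ltW de0)//.
    have : eta * smooth_abs de (enorm (zt - z0)) <=
      eta * smooth_abs de (enorm (zd - z0)) + kappa * dL zd.
      have : 0 <= kappa * dL zd by rewrite mulr_ge0// ltW.
      rewrite /eta; move: smz ep1 ep0 (smooth_abs_ge0 de (enorm (zt - z0))); clear.
      move: (smooth_abs _ _) (smooth_abs _ _) (_ * _) => x y v xy e1 e0 x0 v0.
      by nra.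
    by move: smD; clear; lra.
  have smL2 : 2 * smooth_abs de (dL zd) <= 2 * de + dL zd.
    have : (2 * (L + 1) * kappa) * dL zd <= c * dL zd.
      by rewrite ler_wpM2r// /c; clear; lra.
    by move=> h; rewrite -(ler_pM2l c0); move: h smL; clear; lra.
  by apply: smooth_abs_slack => //; exact: ltW.
(* Otherwise [psi zd < de + c (4 / 3) de <= (1 + 2 c) de <= mm]. *)
have G3 : de <= dD zd.
  rewrite leNgt; apply/negP => dDd.
  by have := psimm _ zdz0; rewrite /psi; move: G2 de2 dDd c1 de0; clear; nra.
have [r Dr dDr] := dist_attained (P zd) D_closed D0; rewrite -/(dD zd) in dDr.
have [q Lq dLq] := dist_attained (F zd) Lam_closed Lam0; rewrite -/(dL zd) in dLq.
have sD0 : 0 < smooth_abs de (dD zd) by exact: smooth_abs_gt0.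
have sL0 : 0 < smooth_abs de (dL zd) by exact: smooth_abs_gt0.
have sz0 : 0 < smooth_abs de (enorm (zd - z0)) by exact: smooth_abs_gt0.
set sD := smooth_abs de (dD zd) in sD0; set sL := smooth_abs de (dL zd) in sL0.
set sz := smooth_abs de (enorm (zd - z0)) in sz0.
have [F1d _] := F1; have [P1d _] := P1.
(* Concavity of the square root replaces [g] by a quadratic majorant touching it at [zd]. *)
have stat : jacT P zd ((2 * sD)^-1 *: (P zd - r)) +
    jacT F zd ((c * (2 * sL)^-1) *: (F zd - q)) +
    (eta * (2 * sz)^-1) *: (zd - z0) = 0.
  apply: (@sqdist_stationary _ _ _ F P zd z0 q r _ _ _ (2 * e1)) => //.
    by rewrite mulr_gt0.
  move=> u ue.
  have gu : g zd <= g (zd + u).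
    apply: zdmin; have := enormD (zd - zs) u.
    by rewrite addrAC; move: zdzs ue e1r0; clear; lra.
  have cD : smooth_abs de (dD (zd + u)) <=
      sD + (2 * sD)^-1 * (enorm (P (zd + u) - r) ^+ 2 - enorm (P zd - r) ^+ 2).
    rewrite -dDr; apply: le_trans (smooth_abs_concave _ _ de0).
    by apply: smooth_abs_le => //; exact: dist_le.
  have cL : smooth_abs de (dL (zd + u)) <=
      sL + (2 * sL)^-1 * (enorm (F (zd + u) - q) ^+ 2 - enorm (F zd - q) ^+ 2).
    rewrite -dLq; apply: le_trans (smooth_abs_concave _ _ de0).
    by apply: smooth_abs_le => //; exact: dist_le.
  have cz := smooth_abs_concave (enorm (zd - z0)) (enorm (zd + u - z0)) de0.
  rewrite -/sz in cz; move: gu; rewrite /g -/sD -/sL -/sz.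
  have := ler_wpM2l (ltW c0) cL; have := ler_wpM2l (ltW eta0) cz; move: cD.
  by clear; lra.
pose mu := sD^-1 *: (P zd - r); pose nu := (c / sL) *: (F zd - q).
(* Bounds relative to [dF0] thereby become bounds relative to [enorm (zd - zs)]; it also gives
   [zd != zs]. *)
have zdt : dF0 <= 2 * enorm (zd - zs).
  have := enorm_triangle z0 zd zs; rewrite (enormB z0 zd); move: zdz0 dF0le.
  have := dist_le z0 solzs; rewrite -/dF0; clear; lra.
have psizd : psi zd <= e * enorm (zd - zs).
  have : 0 <= eta * enorm (zd - z0) by rewrite mulr_ge0// ltW.
  have := enorm_ge0 (zd - zs).
  move: G1 zdt ep0 ep1 epe; rewrite /eta; clear.
  move: (psi zd) (enorm (zd - zs)) (enorm (zd - z0)) => x t y h1 h2 h3 h4 h5 h6 h7.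
  have : 2 * ep ^+ 2 * dF0 <= e * t.
    have : ep * dF0 <= t by nra.
    nra.
  lra.
exists zd, q, nu, r, mu; split; split.
- apply/eqP => zdzs0; move: zdt; by rewrite zdzs0 subrr enorm0; move: dF00; clear; lra.
- by apply: le_lt_trans zdzs _; move: e1e e10; clear; lra.
- apply: proximal_normal => //; first by rewrite divr_ge0 ?ltW.
  by move=> q' Lq'; rewrite -dLq; exact: dist_le.
- apply: proximal_normal => //; first by rewrite invr_ge0 ltW.
  by move=> r' Dr'; rewrite -dDr; exact: dist_le.
- rewrite enormB -dLq; apply: le_trans psizd; rewrite /psi.
  by have := dL_ge0 zd; have := dD_ge0 zd; move: c1; clear; nra.
- rewrite enormB -dDr; apply: le_trans psizd; rewrite /psi lerDl mulr_ge0//.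
  exact: ltW.
- have -> : jacT P zd mu + jacT F zd nu = - ((eta / sz) *: (zd - z0)).
    have muE : mu = 2 *: ((2 * sD)^-1 *: (P zd - r)).
      by rewrite scalerA; congr (_ *: _); field; exact: lt0r_neq0.
    have nuE : nu = 2 *: ((c * (2 * sL)^-1) *: (F zd - q)).
      by rewrite scalerA; congr (_ *: _); field; exact: lt0r_neq0.
    have zdE : (eta / sz) *: (zd - z0) = 2 *: ((eta * (2 * sz)^-1) *: (zd - z0)).
      by rewrite scalerA; congr (_ *: _); field; exact: lt0r_neq0.
    apply/eqP; rewrite -addr_eq0; apply/eqP.
    rewrite muE nuE zdE !(jacTZ _ _ 2); move: stat; clear.
    move: (jacT P zd _) (jacT F zd _) (_ *: (zd - z0)) => u v w uvw.
    by rewrite -!scalerDr uvw scaler0.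
  rewrite enormN enormZ gtr0_norm ?divr_gt0// mulrAC ler_pdivrMr//.
  apply: ler_pM => //; first exact: ltW.
  exact: smooth_abs_ge.
- have -> : enorm mu = dD zd / sD.
    by rewrite /mu enormZ gtr0_norm ?invr_gt0// -dDr mulrC.
  apply/andP; split; last first.
    by rewrite ler_pdivrMr// mul1r; exact: smooth_abs_ge.
  rewrite ler_pdivlMr//.
  (* [sD <= dD zd + de <= 2 * dD zd]. *)
  by move: (smd _ (dD_ge0 zd)) G3; rewrite -/sD; clear; lra.
- rewrite /nu enormZ gtr0_norm ?divr_gt0// -dLq mulrAC ler_pdivrMr// ler_pM2l//.
  exact: smooth_abs_ge.
Qed.

End ErrorBound.

(** * Error bounds under directional conditions *)

Section Limit.
Context {R : realType}.

Lemma cvg_near0 (T : Type) (F : set_system T) {FF : Filter F} (u : T -> R) :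
  (forall e : R, 0 < e -> \forall x \near F, `|u x| < e) -> u @ F --> (0 : R).
Proof.
move=> h; apply/cvgrPdist_lt => e /h; apply: filterS => x.
by rewrite sub0r normrN.
Qed.

Lemma near_invn_lt (e : R) : 0 < e -> \forall j \near \oo, (j.+1%:R^-1 : R) < e.
Proof.
move=> e0; have /cvgrPdist_lt/(_ _ e0) := @cvg_harmonic R.
by apply: filterS => j; rewrite sub0r normrN ger0_norm// /harmonic invr_ge0.
Qed.

(** A cluster point has, beyond each [j], a term within [1 / (j + 1)]. The condition [j <= phi j]
    replaces monotonicity of [phi] and is enough to carry limits over. *)
Lemma bounded_subsequence N (s : nat -> 'rV[R]_N) (B : R) :
  (forall j, enorm (s j) <= B) ->
  exists (x : 'rV[R]_N) (phi : nat -> nat),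
    (forall j, (j <= phi j)%N) /\ (fun j => s (phi j)) @ \oo --> x.
Proof.
move=> sB.
have [x [_ xcl]] : [set z : 'rV[R]_N | enorm (z - 0) <= B] `&` cluster (s @ \oo) !=set0.
  by apply: (@enorm_ball_compact R N 0 B); exists 0%N => // j _ /=; rewrite subr0.
have ex j : exists k, (j <= k)%N /\ enorm (s k - x) < j.+1%:R^-1.
  have [] := xcl [set s k | k in [set k | (j <= k)%N]]
      [set z : 'rV[R]_N | enorm (z - x) < j.+1%:R^-1].
  - by exists j => // k /= jk; exists k.
  - by apply/near_enormP; exists j.+1%:R^-1 => //; rewrite invr_gt0.
  - by move=> _ [[k /= jk <-] kx]; exists k.
have [phi phiP] := choice ex.
exists x, phi; split; first by move=> j; have [] := phiP j.
apply/cvg_enormP => e e0.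
near=> j; have [_ /lt_trans] := phiP j; apply.
by near: j; exact: near_invn_lt.
Unshelve. all: by end_near. Qed.

Lemma enorm_row_mx k1 k2 (a : 'rV[R]_k1) (b : 'rV[R]_k2) :
  enorm (row_mx a b) <= enorm a + enorm b.
Proof.
rewrite -(@ler_pXn2r _ 2)// ?nnegrE ?addr_ge0//.
rewrite sqrrD !enorm_sqr dot_row_mx lerD2r lerDl.
by rewrite mulrn_wge0// mulr_ge0.
Qed.

Lemma enorm_rsubmx_le k1 k2 (v : 'rV[R]_(k1 + k2)) : enorm (rsubmx v) <= enorm v.
Proof. by rewrite ler_wsqrtr// dot_split lerDr dotxx_ge0. Qed.

Lemma enorm_lsubmx_le k1 k2 (v : 'rV[R]_(k1 + k2)) : enorm (lsubmx v) <= enorm v.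
Proof. by rewrite ler_wsqrtr// dot_split lerDl dotxx_ge0. Qed.

Lemma cvg_lsubmx (T : Type) (F : set_system T) {FF : Filter F} k1 k2
    (u : T -> 'rV[R]_(k1 + k2)) (a : 'rV[R]_(k1 + k2)) :
  u @ F --> a -> (fun x => lsubmx (u x)) @ F --> (lsubmx a : 'rV[R]_k1).
Proof.
move/cvg_enormP => ua; apply/cvg_enormP => e /ua; apply: filterS => x.
by apply: le_lt_trans; rewrite -linearB enorm_lsubmx_le.
Qed.

Lemma cvg_rsubmx (T : Type) (F : set_system T) {FF : Filter F} k1 k2
    (u : T -> 'rV[R]_(k1 + k2)) (a : 'rV[R]_(k1 + k2)) :
  u @ F --> a -> (fun x => rsubmx (u x)) @ F --> (rsubmx a : 'rV[R]_k2).
Proof.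
move/cvg_enormP => ua; apply/cvg_enormP => e /ua; apply: filterS => x.
by apply: le_lt_trans; rewrite -linearB enorm_rsubmx_le.
Qed.

Lemma cvg_jac_base (T : Type) (F : set_system T) {FF : Filter F} n k
    (f : 'rV[R]_n -> 'rV[R]_k) (z : T -> 'rV[R]_n) a u :
  C1 f -> z @ F --> a -> (fun x => jac f (z x) u) @ F --> jac f a u.
Proof.
move=> [_ cJ] za; apply/cvg_enormP => e e0.
have := cJ a; move/(@cvgrPdist_lt _ _ _ (nbhs a)) => cJa.
pose K := k%:R * n%:R * enorm u + 1.
have K0 : 0 < K by rewrite ltr_wpDl// !mulr_ge0.
have eK : 0 < e / K by rewrite divr_gt0.
apply: (@filterS _ F _ (fun x => `|'J f a - 'J f (z x)| < e / K) _ _ (za _ (cJa _ eK))) => x /=.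
rewrite distrC => h; rewrite /jac -mulmxBr; apply: (le_lt_trans (enorm_mulmx _ _)).
rewrite ltr_pdivlMr// in h; apply: le_lt_trans h; rewrite /K.
have := normr_ge0 ('J f (z x) - 'J f a).
move: `|_| => N N0; nra.
Qed.

Lemma cvg_jac_dir (T : Type) (F : set_system T) {FF : Filter F} n k
    (f : 'rV[R]_n -> 'rV[R]_k) a (u : T -> 'rV[R]_n) w :
  u @ F --> w -> (fun x => jac f a (u x)) @ F --> jac f a w.
Proof.
move/cvg_enormP => uw; apply/cvg_enormP => e e0.
pose K := k%:R * (n%:R * `|'J f a|) + 1.
have K0 : 0 < K by rewrite ltr_wpDl// !mulr_ge0.
have eK : 0 < e / K by rewrite divr_gt0.
apply: filterS (uw _ eK) => x h.
rewrite /jac -mulmxBl; apply: (le_lt_trans (enorm_mulmx _ _)).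
rewrite ltr_pdivlMr// in h; apply: le_lt_trans h; rewrite /K mulrC.
by rewrite mulrDr mulr1 lerDl.
Qed.

(** Moving [f (z x)] by [o(|z x - a|)] does not change the limit of the quotients. So the
    projections onto [Lam] and [D] approach along the image of [w]. *)
Lemma cvg_quotient (T : Type) (F : set_system T) {FF : Filter F} n k
    (f : 'rV[R]_n -> 'rV[R]_k) a (z : T -> 'rV[R]_n) (q : T -> 'rV[R]_k) w
    (e : T -> R) :
  differentiable f a -> (forall x, z x != a) -> z @ F --> a ->
  (fun x => (enorm (z x - a))^-1 *: (z x - a)) @ F --> w ->
  e @ F --> (0 : R) ->
  (forall x, enorm (q x - f (z x)) <= e x * enorm (z x - a)) ->
  (fun x => (enorm (z x - a))^-1 *: (q x - f a)) @ F --> jac f a w.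
Proof.
move=> df za0 za zw e0 qe; apply/cvg_enormP => d d0.
have d30 : 0 < d / 3 by rewrite divr_gt0.
have [r r0 H] := jacobian_expansion df d30.
have jw : (fun x => jac f a ((enorm (z x - a))^-1 *: (z x - a))) @ F --> jac f a w.
  exact: cvg_jac_dir.
have /cvg_enormP/(_ _ d30) h1 := jw.
have /cvgrPdist_lt/(_ _ d30) h2 := e0.
have /cvg_enormP/(_ _ r0) h3 := za.
near=> x.
have hw : enorm (jac f a ((enorm (z x - a))^-1 *: (z x - a)) - jac f a w) < d / 3.
  by near: x.
have he : `|0 - e x| < d / 3 by near: x.
have hz : enorm (z x - a) < r by near: x.
have t0 : 0 < enorm (z x - a) by rewrite enorm_gt0// subr_eq0.
have := H _ hz; rewrite [a + _]addrC subrK => hf.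
set t := enorm (z x - a) in t0 *.
have E : t^-1 *: (q x - f a) - jac f a w = t^-1 *: (q x - f (z x)) +
    t^-1 *: (f (z x) - f a - jac f a (z x - a)) +
    (jac f a (t^-1 *: (z x - a)) - jac f a w).
  rewrite -scalerDr addrA /jac -scalemxAl; congr (_ - _).
  by rewrite -scalerDr !addrA !subrK.
rewrite E; apply: (le_lt_trans (enormD _ _)).
have a1 : enorm (t^-1 *: (q x - f (z x))) < d / 3.
  rewrite enormZ gtr0_norm ?invr_gt0// mulrC ltr_pdivrMr//.
  apply: (le_lt_trans (qe x)); rewrite ltr_pM2r//.
  by apply: le_lt_trans he; rewrite sub0r normrN ler_norm.
have a2 : enorm (t^-1 *: (f (z x) - f a - jac f a (z x - a))) <= d / 3.
  by rewrite enormZ gtr0_norm ?invr_gt0// mulrC ler_pdivrMr.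
have := enormD (t^-1 *: (q x - f (z x))) (t^-1 *: (f (z x) - f a - jac f a (z x - a))).
move: a1 a2 hw; rewrite -/t; lra.
Unshelve. all: by end_near. Qed.

Lemma regular_dir_normal k (C : set 'rV[R]_k) a d v (t : nat -> R) (q vs : nat -> 'rV[R]_k) :
  (forall j, 0 < t j) -> t @ \oo --> (0 : R) ->
  (fun j => (t j)^-1 *: (q j - a)) @ \oo --> d -> vs @ \oo --> v ->
  (forall j, regular_normal_cone C (q j) (vs j)) ->
  dir_normal_cone C a d v.
Proof.
move=> t0 tt qd vv qv; exists t, (fun j => (t j)^-1 *: (q j - a)), vs; split=> //.
by move=> j; rewrite scalerA divff ?gt_eqF// scale1r [a + _]addrC subrK.
Qed.

Theorem directional_error_bound n l m (F : 'rV[R]_n -> 'rV[R]_l)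
    (P : 'rV[R]_n -> 'rV[R]_m) (Lam : set 'rV[R]_l) (D : set 'rV[R]_m)
    (zs : 'rV[R]_n) :
  closed Lam -> closed D -> C1 F -> C1 P -> Lam (F zs) -> D (P zs) ->
  metrically_subregular F Lam zs ->
  (forall w, w != 0 -> forall nu mu, jacT P zs mu + jacT F zs nu = 0 ->
    dir_normal_cone Lam (F zs) (jac F zs w) nu ->
    dir_normal_cone D (P zs) (jac P zs w) mu -> mu = 0) ->
  error_bound F P Lam D zs.
Proof.
move=> Lam_closed D_closed F1 P1 zsF zsP Fsub cond.
apply: contrapT => neb.
have [C HC] := approximate_multipliers Lam_closed D_closed F1 P1 zsF zsP Fsub neb.
have [z /choice[q /choice[nu /choice[r /choice[mu H]]]]] :
    exists z : nat -> 'rV[R]_n, forall j : nat,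
    exists (q nu : 'rV[R]_l) (r mu : 'rV[R]_m),
    let e := j.+1%:R^-1 in
    [/\ z j != zs, enorm (z j - zs) < e,
      regular_normal_cone Lam q nu & regular_normal_cone D r mu] /\
    [/\ enorm (q - F (z j)) <= e * enorm (z j - zs),
      enorm (r - P (z j)) <= e * enorm (z j - zs),
      enorm (jacT P (z j) mu + jacT F (z j) nu) <= e,
      1 / 2 <= enorm mu <= 1 & enorm nu <= C].
  have {}HC (j : nat) := HC j.+1%:R^-1 (ltac:(by rewrite invr_gt0)).
  by have [z Hz] := choice HC; exists z.
pose W j := (enorm (z j - zs))^-1 *: (z j - zs).
have W1 j : enorm (W j) = 1.
  have [[zj _ _ _] _] := H j.
  have t0 : 0 < enorm (z j - zs) by rewrite enorm_gt0// subr_eq0.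
  by rewrite enormZ gtr0_norm ?invr_gt0// mulVf// gt_eqF.
(* Direction and multipliers are stacked in one vector so that one subsequence serves all three. *)
have [|x [phi [phij xcv]]] :=
    @bounded_subsequence _ (fun j => row_mx (W j) (row_mx (mu j) (nu j))) (1 + (1 + C)).
  move=> j; apply: (le_trans (enorm_row_mx _ _)); rewrite W1 lerD2l.
  apply: (le_trans (enorm_row_mx _ _)).
  by have [_ [_ _ _ /andP[_ h] h']] := H j; exact: lerD.
have Wcv : (fun j => W (phi j)) @ \oo --> lsubmx x.
  rewrite (_ : (fun j => W (phi j)) =
      fun j => lsubmx (row_mx (W (phi j)) (row_mx (mu (phi j)) (nu (phi j))))).
    exact: cvg_lsubmx.
  by apply/funext => j; rewrite row_mxKl.
have xcv2 : (fun j => row_mx (mu (phi j)) (nu (phi j))) @ \oo --> (rsubmx x : 'rV_(m + l)).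
  rewrite (_ : (fun j => _) =
      fun j => rsubmx (row_mx (W (phi j)) (row_mx (mu (phi j)) (nu (phi j))))).
    exact: cvg_rsubmx.
  by apply/funext => j; rewrite row_mxKr.
have mucv : (fun j => mu (phi j)) @ \oo --> lsubmx (rsubmx x).
  rewrite (_ : (fun j => mu (phi j)) = fun j => lsubmx (row_mx (mu (phi j)) (nu (phi j)))).
    exact: cvg_lsubmx.
  by apply/funext => j; rewrite row_mxKl.
have nucv : (fun j => nu (phi j)) @ \oo --> rsubmx (rsubmx x).
  rewrite (_ : (fun j => nu (phi j)) = fun j => rsubmx (row_mx (mu (phi j)) (nu (phi j)))).
    exact: cvg_rsubmx.
  by apply/funext => j; rewrite row_mxKr.
set w := lsubmx x in Wcv; set mu0 := lsubmx _ in mucv; set nu0 := rsubmx _ in nucv.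
have ecv : (fun j => (phi j).+1%:R^-1 : R) @ \oo --> (0 : R).
  apply: cvg_near0 => e e0; near=> j.
  rewrite ger0_norm ?invr_ge0//; apply: (@le_lt_trans _ _ j.+1%:R^-1).
    by rewrite lef_pV2 ?posrE// ler_nat ltnS.
  by near: j; exact: near_invn_lt.
have zcv : (fun j => z (phi j)) @ \oo --> zs.
  apply/cvg_enormP => e e0; move/cvgrPdist_lt: ecv => /(_ _ e0).
  apply: filterS => j; rewrite sub0r normrN ger0_norm ?invr_ge0//; apply: le_lt_trans.
  by have [[_ /ltW ? _ _] _] := H (phi j).
have w1 : enorm w = 1.
  have cv : (fun j => enorm (W (phi j))) @ \oo --> enorm w by exact: cvg_enorm.
  rewrite -(cvg_lim _ cv)//; apply: cvg_lim => //.
  by under eq_fun do rewrite W1; exact: cvg_cst.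
have mu1 : 1 / 2 <= enorm mu0.
  have cv : (fun j => enorm (mu (phi j))) @ \oo --> enorm mu0 by exact: cvg_enorm.
  rewrite -(cvg_lim _ cv)//; apply: limr_ge.
    by apply: cvgP cv.
  by near=> j; have [_ [_ _ _ /andP[h _] _]] := H (phi j).
have zn j : z (phi j) != zs by have [[]] := H (phi j).
have t0 j : 0 < enorm (z (phi j) - zs) by rewrite enorm_gt0// subr_eq0.
have tcv : (fun j => enorm (z (phi j) - zs)) @ \oo --> (0 : R).
  apply: cvg_near0 => e e0; move/cvg_enormP: zcv => /(_ _ e0).
  by apply: filterS => j; rewrite ger0_norm.
have [F1d _] := F1; have [P1d _] := P1.
(* Pairing with the fixed vector [V] moves the adjoints off the multipliers, so continuity of the
   Jacobians along [V] suffices; the pairings tend both to [dot V V] and to 0. *)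
have V0 : jacT P zs mu0 + jacT F zs nu0 = 0.
  set V := LHS; pose Vs j := jacT P (z (phi j)) (mu (phi j)) + jacT F (z (phi j)) (nu (phi j)).
  have VE j : dot V (Vs j) = dot (jac P (z (phi j)) V) (mu (phi j)) +
      dot (jac F (z (phi j)) V) (nu (phi j)).
    by rewrite /Vs dotDr -!dot_jac.
  have cv1 : (fun j => dot V (Vs j)) @ \oo --> dot V V.
    under eq_fun do rewrite VE.
    rewrite {2}/V dotDr -!dot_jac.
    by apply: cvgD; apply: cvg_dot => //; exact: cvg_jac_base.
  have cv2 : (fun j => dot V (Vs j)) @ \oo --> (0 : R).
    apply: cvg_near0 => e e0.
    have ev : 0 < e / (enorm V + 1) by rewrite divr_gt0// ltr_wpDl.
    move/cvgrPdist_lt: ecv => /(_ _ ev); apply: filterS => j.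
    rewrite sub0r normrN ger0_norm ?invr_ge0// ltr_pdivlMr ?ltr_wpDl// => h.
    apply: (le_lt_trans (normr_dot _ _)); apply: le_lt_trans h.
    have [_ [_ _ + _ _]] := H (phi j); rewrite -/(Vs j).
    by move=> h; rewrite mulrC; apply: ler_pM => //; rewrite lerDl.
  by apply: dotxx_eq0; rewrite -(cvg_lim _ cv1)//; exact: cvg_lim.
have mu00 : mu0 = 0.
  apply: (cond w _ nu0 mu0) => //.
  - by apply/eqP => w0; move: w1; rewrite w0 enorm0 => /eqP; rewrite eq_sym oner_eq0.
  - apply: (regular_dir_normal t0 tcv (q := fun j => q (phi j)) _ nucv) => [|j].
      apply: (cvg_quotient (F1d zs) zn zcv Wcv ecv) => j.
      by have [_ []] := H (phi j).
    by have [[]] := H (phi j).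
  - apply: (regular_dir_normal t0 tcv (q := fun j => r (phi j)) _ mucv) => [|j].
      apply: (cvg_quotient (P1d zs) zn zcv Wcv ecv) => j.
      by have [_ []] := H (phi j).
    by have [[]] := H (phi j).
by move: mu1; rewrite mu00 enorm0; lra.
Unshelve. all: by end_near. Qed.
End Limit.

(** * The complementarity set of a second-order cone *)

Section SecondOrderCone.
Context {R : realType} {k : nat}.
Implicit Types x y u w : 'rV[R]_k.+1.

Definition hd x : R := x ord0 ord0.
Definition tl x : 'rV[R]_k := rsubmx (x : 'rV[R]_(1 + k)).
Definition mkv (a : R) (b : 'rV[R]_k) : 'rV[R]_k.+1 := row_mx (const_mx a : 'rV[R]_1) b.

Lemma hd_mkv a b : hd (mkv a b) = a.
Proof.
rewrite /hd /mkv; have -> : (ord0 : 'I_k.+1) = lshift k (ord0 : 'I_1) by exact: val_inj.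
by rewrite (@row_mxEl R 1 1 k) mxE.
Qed.

Lemma tl_mkv a b : tl (mkv a b) = b.
Proof. exact: row_mxKr. Qed.

Lemma mkvE x : mkv (hd x) (tl x) = x.
Proof.
rewrite /mkv; have -> : const_mx (hd x) = @lsubmx R 1 1 k x.
  by apply/rowP => i; rewrite !mxE ord1; congr (x _ _); exact: val_inj.
exact: (@hsubmxK R 1 1 k x).
Qed.

Lemma hdD x y : hd (x + y) = hd x + hd y. Proof. by rewrite /hd mxE. Qed.
Lemma hdN x : hd (- x) = - hd x. Proof. by rewrite /hd mxE. Qed.
Lemma hdB x y : hd (x - y) = hd x - hd y. Proof. by rewrite hdD hdN. Qed.
Lemma hdZ a x : hd (a *: x) = a * hd x. Proof. by rewrite /hd mxE. Qed.
Lemma hd0 : hd 0 = 0. Proof. by rewrite /hd mxE. Qed.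
Lemma tlD x y : tl (x + y) = tl x + tl y. Proof. exact: linearD. Qed.
Lemma tlN x : tl (- x) = - tl x. Proof. exact: linearN. Qed.
Lemma tlB x y : tl (x - y) = tl x - tl y. Proof. exact: linearB. Qed.
Lemma tlZ a x : tl (a *: x) = a *: tl x. Proof. exact: linearZ. Qed.
Lemma tl0 : tl 0 = 0. Proof. exact: linear0. Qed.

Definition hdtlE := (hd_mkv, tl_mkv, hdD, hdN, hdZ, hd0, tlD, tlN, tlZ, tl0).

Lemma dot_hdtl x y : dot x y = hd x * hd y + dot (tl x) (tl y).
Proof.
rewrite (@dot_split R 1 k x y); congr (_ + _).
rewrite /dot big_ord1 !mxE; congr (x _ _ * y _ _); exact: val_inj.
Qed.

Lemma hdtl_inj x y : hd x = hd y -> tl x = tl y -> x = y.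
Proof. by move=> h t; rewrite -(mkvE x) -(mkvE y) h t. Qed.

Lemma hd_le_enorm x : `|hd x| <= enorm x.
Proof. exact: normr_coord_le. Qed.

Lemma tl_le_enorm x : enorm (tl x) <= enorm x.
Proof. exact: (@enorm_rsubmx_le R 1 k x). Qed.

Lemma enorm_mkv a b : enorm (mkv a b) <= `|a| + enorm b.
Proof.
apply: (le_trans (@enorm_row_mx R 1 k _ _)); rewrite lerD2r.
by rewrite /enorm /dot big_ord1 mxE -expr2 sqrtr_sqr.
Qed.

Lemma cvg_hd (T : Type) (F : set_system T) {FF : Filter F} (u : T -> 'rV[R]_k.+1)
    (a : 'rV[R]_k.+1) : u @ F --> a -> (fun s => hd (u s)) @ F --> hd a.
Proof. move=> ua; exact: (continuous_cvg _ (@coord_continuous R 1 k.+1 ord0 ord0 a) ua). Qed.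

Lemma cvg_tl (T : Type) (F : set_system T) {FF : Filter F} (u : T -> 'rV[R]_k.+1)
    (a : 'rV[R]_k.+1) : u @ F --> a -> (fun s => tl (u s)) @ F --> tl a.
Proof. move=> ua; exact: (@cvg_rsubmx R T F FF 1 k u a ua). Qed.

Lemma cvg_mkv (T : Type) (F : set_system T) {FF : Filter F} (f : T -> R)
    (g : T -> 'rV[R]_k) (a : R) (b : 'rV[R]_k) :
  f @ F --> a -> g @ F --> b -> (fun s => mkv (f s) (g s)) @ F --> mkv a b.
Proof.
move=> fa gb; apply/cvg_enormP => e e0.
have e20 : 0 < e / 2 by rewrite divr_gt0.
move/cvgrPdist_lt: fa => /(_ _ e20); move/cvg_enormP: gb => /(_ _ e20).
apply: filterS2 => s h1 h2.
have -> : mkv (f s) (g s) - mkv a b = mkv (f s - a) (g s - b).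
  by apply: hdtl_inj; rewrite !hdtlE.
by apply: (le_lt_trans (enorm_mkv _ _)); rewrite distrC; lra.
Qed.

(** The Lorentz form; together with [0 <= hd x], nonnegativity of its quadratic form [Q] describes
    the cone by polynomials. *)
Definition lorentz x y : R := hd x * hd y - dot (tl x) (tl y).
Local Notation Q x := (lorentz x x).
(** Half the Euclidean gradient of [Q] at [x]. *)
Definition refl x : 'rV[R]_k.+1 := mkv (hd x) (- tl x).

Lemma socE x : soc x <-> 0 <= hd x /\ 0 <= Q x.
Proof.
rewrite /soc /= -/(tl x) -/(hd x) /lorentz subr_ge0 -enorm_sqr -expr2; split.
  move=> h; have hx : 0 <= hd x by apply: le_trans h.
  by split=> //; rewrite lerXn2r// ?nnegrE.
by move=> [hx]; rewrite ler_pXn2r// ?nnegrE.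
Qed.

Definition Om : set 'rV[R]_(k.+1 + k.+1) := compl_set (@soc R k).

(* The Jordan product of the spin factor, up to its first component [dot x y]. *)
Definition jordan x y : 'rV[R]_k := hd y *: tl x + hd x *: tl y.

Lemma OmE x y : Om (row_mx x y) <-> [/\ soc x, soc y & dot x y = 0].
Proof. by rewrite /Om /compl_set /= row_mxKl row_mxKr. Qed.

(** With heads [a], [b] and squared tail norms [X <= a^2], [Y <= b^2], orthogonality makes the tail
    product [- a b], so [|jordan x y|^2 = b^2 X + a^2 Y - 2 a^2 b^2 <= 0]. *)
Lemma soc_jordan x y : soc x -> soc y -> dot x y = 0 -> jordan x y = 0.
Proof.
move=> /socE[x0 qx] /socE[y0 qy] xy; apply: dotxx_eq0; apply/le_anti.
rewrite dotxx_ge0 andbT /jordan !dotDZ (dotC (tl y) (tl x)).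
move: xy qx qy; rewrite dot_hdtl /lorentz.
have := dotxx_ge0 (tl x); have := dotxx_ge0 (tl y).
move: (hd x) (hd y) (dot (tl x) (tl x)) (dot (tl y) (tl y)) (dot (tl x) (tl y)) x0 y0.
move=> a b X Y c a0 b0 Y0 X0 h hx hy.
have -> : c = - (a * b) by lra.
have : b * b * X <= b * b * (a * a) by rewrite ler_wpM2l ?mulr_ge0//; lra.
have : a * a * Y <= a * a * (b * b) by rewrite ler_wpM2l ?mulr_ge0//; lra.
lra.
Qed.

Lemma Om_jordan x y : Om (row_mx x y) -> jordan x y = 0.
Proof. by move/OmE=> [? ? ?]; exact: soc_jordan. Qed.

(** When [0 < hd x], the equation [jordan x y = 0] makes [tl y] a multiple of [tl x], and what
    remains is scalar complementarity between [hd y] and [Q x]. *)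
Lemma Om_posE x y : 0 < hd x ->
  Om (row_mx x y) <-> [/\ 0 <= Q x, 0 <= hd y, hd y * Q x = 0 & jordan x y = 0].
Proof.
move=> x0; split.
  move=> xy; have j0 := Om_jordan xy; move/OmE: xy => [/socE[_ qx] /socE[y0 _] xy].
  split=> //; have := congr1 (dot (tl x)) j0.
  move: xy; rewrite /jordan /lorentz dot_hdtl dot0r !dotDZ => h1 h2.
  rewrite mulrBr; have -> : hd y * (hd x * hd x) = hd x * (hd x * hd y) by ring.
  have -> : hd x * hd y = - dot (tl x) (tl y) by lra.
  lra.
move=> [qx y0 yq j0].
have tly : tl y = (- (hd y / hd x)) *: tl x.
  apply: (scalerI (lt0r_neq0 x0)); rewrite scalerA mulrN mulrCA divff ?gt_eqF// mulr1.
  by apply/eqP; rewrite scaleNr -addr_eq0 addrC; apply/eqP.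
apply/OmE; split; first by apply/socE; split => //; exact: ltW.
  apply/socE; split => //; rewrite /lorentz tly !dotDZ.
  have -> : hd y * hd y - - (hd y / hd x) * (- (hd y / hd x) * dot (tl x) (tl x)) =
    (hd y / hd x) ^+ 2 * Q x by rewrite /lorentz; field; rewrite gt_eqF.
  by rewrite mulr_ge0// sqr_ge0.
rewrite dot_hdtl tly dotZr.
have -> : hd x * hd y + - (hd y / hd x) * dot (tl x) (tl x) = (hd y * Q x) / hd x.
  by rewrite /lorentz; field; rewrite gt_eqF.
by rewrite yq mul0r.
Qed.

(* Near a point with [0 < hd x], the set is the preimage of
   [{(a, b, c) | 0 <= a, 0 <= b, a b = 0, c = 0}] under the submersion
   [(x, y) |-> (Q x / 2, hd y, jordan x y)]; this is the transposed derivative. *)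
Definition nform x y (al be : R) (ga : 'rV[R]_k) : 'rV[R]_(k.+1 + k.+1) :=
  row_mx (mkv (dot ga (tl y) + al * hd x) (hd y *: ga - al *: tl x))
         (mkv (dot ga (tl x) + be) (hd x *: ga)).

(** The regular normals [(al, be)] to the angle [{(a, b) | 0 <= a, 0 <= b, a b = 0}] at
    [(Q x, hd y)]. *)
Definition normal_signs x y (al be : R) : Prop :=
  [/\ 0 < Q x -> al = 0, 0 < hd y -> be = 0 &
      Q x = 0 -> hd y = 0 -> al <= 0 /\ be <= 0].

(** The constraint maps are quadratic, so the expansion is exact; as [jordan] vanishes at both ends,
    its linear part is minus its quadratic part. *)
Lemma nform_diff x y x' y' al be ga : jordan x y = 0 -> jordan x' y' = 0 ->
  dot (nform x y al be ga) (row_mx x' y' - row_mx x y) =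
  al * (Q x' - Q x - Q (x' - x)) / 2 + be * (hd y' - hd y)
    - dot ga (jordan (x' - x) (y' - y)).
Proof.
move=> /(congr1 (dot ga)) + /(congr1 (dot ga)).
rewrite /jordan dot0r opp_row_mx add_row_mx dot_row_mx !dot_hdtl /lorentz !hdtlE !dotDZ.
rewrite (dotC (tl x') (tl x)) => h1 h2.
rewrite ?dotDZ.
lra.
Qed.

Lemma lorentz_bound u : `|Q u| <= enorm u ^+ 2.
Proof.
rewrite enorm_sqr dot_hdtl /lorentz ler_norml; have := dotxx_ge0 (tl u).
by have := sqr_ge0 (hd u); rewrite expr2 => h1 h2; apply/andP; split; lra.
Qed.

Lemma jordan_bound u w : enorm (jordan u w) <= 2 * (enorm u * enorm w).
Proof.
apply: (le_trans (enormD _ _)); rewrite !enormZ mulr_natl mulr2n; apply: lerD.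
  by rewrite mulrC; apply: ler_pM => //; [exact: tl_le_enorm|exact: hd_le_enorm].
by apply: ler_pM => //; [exact: hd_le_enorm|exact: tl_le_enorm].
Qed.

Lemma cvg_lorentz (T : Type) (F : set_system T) {FF : Filter F}
    (u : T -> 'rV[R]_k.+1) (a : 'rV[R]_k.+1) :
  u @ F --> a -> (fun s => Q (u s)) @ F --> Q a.
Proof.
move=> ua; apply: cvgB; first by apply: cvgM; exact: cvg_hd.
by apply: cvg_dot; exact: cvg_tl.
Qed.

Lemma near_gt0 (T : Type) (F : set_system T) {FF : Filter F} (f : T -> R) a :
  f @ F --> a -> 0 < a -> \forall s \near F, 0 < f s.
Proof. by move=> fa a0; exact: (cvgr_gt a). Qed.

(** Near the point the sign conditions make the scalar terms of [nform_diff] nonpositive, and the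
    quadratic remainder is at most [K * enorm h ^+ 2]. *)
Lemma nform_regular_normal x y al be ga : 0 < hd x -> Om (row_mx x y) ->
  normal_signs x y al be -> regular_normal_cone Om (row_mx x y) (nform x y al be ga).
Proof.
move=> x0 Oxy [sal sbe sab]; split=> // e e0.
have [qx y0 yq j0] := (Om_posE y x0).1 Oxy.
set p := row_mx x y.
have lcv : (fun z : 'rV[R]_(k.+1 + k.+1) => lsubmx z) @ nbhs p --> x.
  have h := @cvg_lsubmx R _ (nbhs p) _ _ _ id p (@cvg_id _ _).
  by rewrite [lsubmx p]row_mxKl in h; exact: h.
have rcv : (fun z : 'rV[R]_(k.+1 + k.+1) => rsubmx z) @ nbhs p --> y.
  have h := @cvg_rsubmx R _ (nbhs p) _ _ _ id p (@cvg_id _ _).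
  by rewrite [rsubmx p]row_mxKr in h; exact: h.
pose K := `|al| + 2 * enorm ga + 1.
have K0 : 0 < K by rewrite ltr_wpDl// addr_ge0// mulr_ge0.
have n1 : \forall z \near p, 0 < hd (lsubmx z).
  exact: (@near_gt0 _ (nbhs p) _ (fun z => hd (lsubmx z)) _ (cvg_hd lcv) x0).
have n2 : \forall z \near p, 0 < Q x -> 0 < Q (lsubmx z).
  have [qx0|qx0] := ltP 0 (Q x).
    have : \forall z \near p, 0 < Q (lsubmx z).
      exact: (@near_gt0 _ (nbhs p) _ (fun z => Q (lsubmx z)) _ (cvg_lorentz lcv) qx0).
    by apply: filterS.
  by near=> z.
have n3 : \forall z \near p, 0 < hd y -> 0 < hd (rsubmx z).
  have [y1|y1] := ltP 0 (hd y).
    have : \forall z \near p, 0 < hd (rsubmx z).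
      exact: (@near_gt0 _ (nbhs p) _ (fun z => hd (rsubmx z)) _ (cvg_hd rcv) y1).
    by apply: filterS.
  by near=> z.
have n4 : \forall z \near p, enorm (z - p) < e / K.
  by apply/near_enormP; exists (e / K) => //; rewrite divr_gt0.
near=> z => Oz.
have h1 : 0 < hd (lsubmx z) by near: z.
have h2 : 0 < Q x -> 0 < Q (lsubmx z) by near: z.
have h3 : 0 < hd y -> 0 < hd (rsubmx z) by near: z.
have h4 : enorm (z - p) < e / K by near: z.
move: h4 Oz; rewrite -(hsubmxK z); move: (lsubmx z) (rsubmx z) h1 h2 h3.
move=> x' y' h1 h2 h3 h4 Oz.
have [qx' y0' yq' j0'] := (Om_posE y' h1).1 Oz.
rewrite nform_diff//.
have a1 : al * Q x' <= 0.
  have [qx0|qx0] := ltP 0 (Q x); first by rewrite sal// mul0r.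
  have {}qx0 : Q x = 0 by apply/le_anti; rewrite qx0 qx.
  have [y1|y1] := ltP 0 (hd y).
    move/eqP: yq'; rewrite mulf_eq0 (gt_eqF (h3 y1)) => /eqP ->.
    by rewrite mulr0.
  have {}y1 : hd y = 0 by apply/le_anti; rewrite y1 y0.
  by have [al0 _] := sab qx0 y1; rewrite mulr_le0_ge0.
have a2 : al * Q x = 0.
  have [qx0|qx0] := ltP 0 (Q x); first by rewrite sal// mul0r.
  by have -> : Q x = 0 by [apply/le_anti; rewrite qx0 qx]; rewrite mulr0.
have a3 : be * (hd y' - hd y) <= 0.
  have [y1|y1] := ltP 0 (hd y); first by rewrite sbe// mul0r.
  have {}y1 : hd y = 0 by apply/le_anti; rewrite y1 y0.
  rewrite y1 subr0; have [qx0|qx0] := ltP 0 (Q x).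
    move/eqP: yq'; rewrite mulf_eq0 (gt_eqF (h2 qx0)) orbF => /eqP ->.
    by rewrite mulr0.
  have {}qx0 : Q x = 0 by apply/le_anti; rewrite qx0 qx.
  by have [_ be0] := sab qx0 y1; rewrite mulr_le0_ge0.
set h := row_mx x' y' - p in h4 *.
have hE : h = row_mx (x' - x) (y' - y) by rewrite /h opp_row_mx add_row_mx.
have hx : enorm (x' - x) <= enorm h by rewrite -(row_mxKl (x' - x) (y' - y)) -hE enorm_lsubmx_le.
have hy : enorm (y' - y) <= enorm h by rewrite -(row_mxKr (x' - x) (y' - y)) -hE enorm_rsubmx_le.
have b1 : - (al * Q (x' - x)) <= `|al| * enorm h ^+ 2.
  apply: (le_trans (ler_norm _)); rewrite normrN normrM ler_wpM2l//.
  by apply: (le_trans (lorentz_bound _)); rewrite lerXn2r// nnegrE.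
have b2 : - dot ga (jordan (x' - x) (y' - y)) <= enorm ga * (2 * enorm h ^+ 2).
  apply: (le_trans (ler_norm _)); rewrite normrN (le_trans (normr_dot _ _))//.
  rewrite ler_wpM2l// (le_trans (jordan_bound _ _))// ler_wpM2l// expr2.
  exact: ler_pM.
have b3 : enorm h ^+ 2 * K <= e * enorm h.
  rewrite expr2 -mulrA mulrC ler_wpM2r//; move: h4; rewrite ltr_pdivlMr//; exact: ltW.
move: a1 a2 a3 b1 b2 b3; rewrite /K.
have : 0 <= `|al| * enorm h ^+ 2 by rewrite mulr_ge0// sqr_ge0.
have := sqr_ge0 (enorm h).
lra.
Unshelve. all: by end_near. Qed.

(** Solves [jordan x y = 0] for [y] with prescribed first component [b], when [hd x] is nonzero. *)
Definition lift x (b : R) : 'rV[R]_k.+1 := mkv b (- (b / hd x) *: tl x).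

Lemma jordan_lift x b : 0 < hd x -> jordan x (lift x b) = 0.
Proof.
move=> x0; rewrite /jordan !hdtlE scalerA mulrN mulrCA divff ?gt_eqF// mulr1.
by rewrite scaleNr subrr.
Qed.

Lemma jordan0_lift x y : 0 < hd x -> jordan x y = 0 -> y = lift x (hd y).
Proof.
move=> x0 j0; apply: hdtl_inj; rewrite !hdtlE//.
apply: (scalerI (lt0r_neq0 x0)); rewrite scalerA mulrN mulrCA divff ?gt_eqF// mulr1.
by apply/eqP; rewrite scaleNr -addr_eq0 addrC; apply/eqP.
Qed.

Lemma lift_lipschitz x b : 0 < hd x -> exists K rho : R, [/\ 0 < K, 0 < rho &
  forall x' b', enorm (x' - x) < rho -> `|b' - b| < rho ->
    enorm (lift x' b' - lift x b) <= K * (enorm (x' - x) + `|b' - b|)].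
Proof.
move=> x0; set y2 := tl (lift x b).
pose K0 := enorm x + hd x + `|b| + enorm y2.
have K00 : 0 <= K0 by rewrite !addr_ge0// ltW.
exists (1 + 2 / hd x * K0), (hd x / 2); split.
- by rewrite ltr_pwDl// mulr_ge0// divr_ge0// ltW.
- by rewrite divr_gt0.
move=> x' b' xx' bb'.
have hx' : hd x / 2 < hd x'.
  have := le_lt_trans (hd_le_enorm _) xx'; rewrite hdB ltr_norml => /andP[]; lra.
have x'0 : 0 < hd x' by apply: lt_trans hx'; rewrite divr_gt0.
have E : lift x' b' - lift x b = mkv (b' - b) (tl (lift x' b') - y2).
  by apply: hdtl_inj; rewrite /y2 !hdtlE.
rewrite E (le_trans (enorm_mkv _ _))//.
have D0 : 0 <= enorm (x' - x) + `|b' - b| by rewrite addr_ge0.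
suff : enorm (tl (lift x' b') - y2) <= 2 / hd x * K0 * (enorm (x' - x) + `|b' - b|).
  by have := enorm_ge0 (x' - x); lra.
(* The difference of the two equations [jordan = 0]; it remains to divide by [hd x'], which exceeds
   [hd x / 2]. *)
have F : hd x' *: (tl (lift x' b') - y2) =
    - ((b' - b) *: tl x' + b *: (tl (x' - x)) + hd (x' - x) *: y2).
  have h1 := jordan_lift b' x'0; have h2 := jordan_lift b x0.
  rewrite /jordan !hd_mkv -/y2 in h1 h2.
  have {}h1 : hd x' *: tl (lift x' b') = - (b' *: tl x') by apply/eqP; rewrite -addr_eq0 addrC h1.
  have {}h2 : hd x *: y2 = - (b *: tl x) by apply/eqP; rewrite -addr_eq0 addrC h2.
  rewrite scalerBr h1 hdB tlB !scalerBl h2 scalerBr.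
  by apply/rowP => i; rewrite !mxE; ring.
have G : enorm (tl (lift x' b') - y2) =
   (hd x')^-1 * enorm ((b' - b) *: tl x' + b *: (tl (x' - x)) + hd (x' - x) *: y2).
  rewrite -[in RHS]enormN -F enormZ gtr0_norm// mulKf// gt_eqF//.
rewrite G -mulrA; apply: ler_pM => //; first by rewrite invr_ge0 ltW.
  by rewrite -[2 / _]invf_div lef_pV2 ?posrE ?divr_gt0// ltW.
apply: (le_trans (enormD _ _)); apply: (le_trans (lerD (enormD _ _) (lexx _))).
rewrite !enormZ.
have t1 : enorm (tl x') <= enorm x + hd x.
  apply: (le_trans (tl_le_enorm _)); rewrite -[x'](subrK x) addrC.
  apply: (le_trans (enormD _ _)); rewrite lerD2l; move: xx' x0; lra.
have t2 := tl_le_enorm (x' - x); have t3 := hd_le_enorm (x' - x).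
apply: (@le_trans _ _ (`|b' - b| * (enorm x + hd x) + `|b| * enorm (x' - x) +
   enorm (x' - x) * enorm y2)).
  by apply: lerD; [apply: lerD|]; [exact: ler_wpM2l|exact: ler_wpM2l|exact: ler_wpM2r].
have := enorm_ge0 (x' - x); have := normr_ge0 (b' - b); have := normr_ge0 b.
have := enorm_ge0 x; have := enorm_ge0 y2; move: (ltW x0); rewrite /K0.
move: (enorm x) (enorm y2) (enorm (x' - x)) (`|b|) (`|b' - b|) (hd x).
move=> c1 c2 c3 c4 c5 c6 *.
have : 0 <= c5 * (c4 + c2) + c3 * (c1 + c6) by rewrite addr_ge0// mulr_ge0// addr_ge0.
by lra.
Qed.

End SecondOrderCone.

(** * Every regular normal has the explicit form *)

Section NormalsOm.
Context {R : realType} {k : nat}.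
Implicit Types x y u w r : 'rV[R]_k.+1.
Local Notation Q x := (lorentz x x).

(** The coefficients come from solving [v = nform x y al be ga]: the second half of [v] determines
    [ga], then [be]; [coef_r] is what is left of the first half and has to be shown equal to
    [al *: refl x]. *)
Definition coef_ga x (v : 'rV[R]_(k.+1 + k.+1)) : 'rV[R]_k := (hd x)^-1 *: tl (rsubmx v).
Definition coef_be x (v : 'rV[R]_(k.+1 + k.+1)) : R :=
  hd (rsubmx v) - dot (coef_ga x v) (tl x).
Definition coef_r x y (v : 'rV[R]_(k.+1 + k.+1)) : 'rV[R]_k.+1 :=
  lsubmx v - mkv (dot (coef_ga x v) (tl y)) (hd y *: coef_ga x v).
Definition coef_al x y v : R := hd (coef_r x y v) / hd x.

Lemma nform_coef x y v : hd x != 0 -> coef_r x y v = coef_al x y v *: refl x ->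
  v = nform x y (coef_al x y v) (coef_be x v) (coef_ga x v).
Proof.
move=> x0 rE; rewrite -[LHS]hsubmxK /nform; congr row_mx.
  have -> : lsubmx v = coef_r x y v + mkv (dot (coef_ga x v) (tl y)) (hd y *: coef_ga x v).
    by rewrite /coef_r subrK.
  rewrite rE; apply: hdtl_inj; rewrite !hdtlE ?scalerN addrC//.
apply: hdtl_inj; rewrite !hdtlE /coef_be ?[dot _ _ + _]addrC ?subrK//.
by rewrite /coef_ga scalerA divff// scale1r.
Qed.

(** The counterpart of [nform_diff] for arbitrary [v]: removing the [be] and [ga] parts leaves
    [row_mx (coef_r x y v) 0]. *)
Lemma dot_coef x y v x' y' : hd x != 0 -> jordan x y = 0 -> jordan x' y' = 0 ->
  dot v (row_mx x' y' - row_mx x y) =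
  dot (coef_r x y v) (x' - x) + coef_be x v * (hd y' - hd y)
  - dot (coef_ga x v) (jordan (x' - x) (y' - y)).
Proof.
move=> x0 j0 j0'; have := nform_diff 0 (coef_be x v) (coef_ga x v) j0 j0'.
rewrite !mul0r add0r => h; rewrite -addrA -h.
have {1}-> : v = row_mx (coef_r x y v) 0 + nform x y 0 (coef_be x v) (coef_ga x v).
  rewrite /nform add_row_mx mul0r scale0r addr0 subr0 /coef_r subrK add0r.
  rewrite -[LHS]hsubmxK; congr row_mx.
  apply: hdtl_inj; rewrite !hdtlE /coef_be ?[dot _ _ + _]addrC ?subrK//.
  by rewrite /coef_ga scalerA divff// scale1r.
rewrite dotDl; congr (_ + _).
by rewrite opp_row_mx add_row_mx dot_row_mx dot0l addr0.
Qed.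

(* [r] and [be] are a regular normal to [{(x, b) | 0 <= Q x, 0 <= b, b Q x = 0}],
   which parametrizes the complementarity set through [y = lift x b]. *)
Definition reduced_normal x y r (be : R) : Prop :=
  forall e : R, 0 < e -> exists2 rho : R, 0 < rho & forall x' b,
    enorm (x' - x) < rho -> `|b - hd y| < rho ->
    0 <= Q x' -> 0 <= b -> b * Q x' = 0 ->
    dot r (x' - x) + be * (b - hd y) <= e * (enorm (x' - x) + `|b - hd y|).

(** The normal inequality is pulled back along [(x, b) |-> (x, lift x b)]. The Lipschitz bound on
    [lift] controls the increment, and the [jordan] term, quadratic in it, is absorbed by shrinking
    [rho]. *)
Lemma regular_reduced_normal x y v : 0 < hd x ->
  regular_normal_cone Om (row_mx x y) v ->
  reduced_normal x y (coef_r x y v) (coef_be x v).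
Proof.
move=> x0 [Oxy vn] e e0.
have [qx y0 yq j0] := (Om_posE y x0).1 Oxy.
have [K [rho1 [K0 rho10 lip]]] := lift_lipschitz (hd y) x0.
rewrite -(jordan0_lift x0 j0) in lip.
set ga := coef_ga x v.
pose K1 := K + 1; pose M := 2 * enorm ga * K1 ^+ 2 + 1.
have K10 : 0 < K1 by rewrite addr_gt0.
have M0 : 0 < M by rewrite ltr_wpDl// mulr_ge0 ?sqr_ge0// mulr_ge0.
have e10 : 0 < e / (2 * K1) by rewrite divr_gt0// mulr_gt0.
have /near_enormP[rho2 rho20 vn2] := vn _ e10.
pose rho := Num.min (Num.min rho1 (hd x)) (Num.min (rho2 / (2 * K1)) (e / (4 * M))).
have rho0 : 0 < rho.
  by rewrite !lt_min rho10 x0 !divr_gt0 ?mulr_gt0.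
have : [/\ rho <= rho1, rho <= hd x, rho <= rho2 / (2 * K1) & rho <= e / (4 * M)].
  by rewrite !ge_min !lexx !orbT.
rewrite !ler_pdivlMr ?mulr_gt0// => -[r1 r2 r3 r4].
exists rho => // x' b xx' bb' qx' b0 bq.
have x'0 : 0 < hd x'.
  have := le_lt_trans (hd_le_enorm _) (lt_le_trans xx' r2).
  by rewrite hdB ltr_norml => /andP[]; lra.
have Ox' : Om (row_mx x' (lift x' b)).
  by apply/(Om_posE _ x'0); rewrite jordan_lift// hd_mkv.
have lipb := lip _ _ (lt_le_trans xx' r1) (lt_le_trans bb' r1).
set S := enorm (x' - x) + `|b - hd y| in lipb *.
have S0 : 0 <= S by rewrite addr_ge0.
have Srho : S < 2 * rho by move: xx' bb'; rewrite /S; lra.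
set h := row_mx x' (lift x' b) - row_mx x y.
have hE : h = row_mx (x' - x) (lift x' b - y) by rewrite /h opp_row_mx add_row_mx.
have hS : enorm h <= K1 * S.
  rewrite hE (le_trans (enorm_row_mx _ _))// mulrDl mul1r addrC lerD//.
  by rewrite lerDl.
have hrho2 : enorm h < rho2.
  apply: (le_lt_trans hS); apply: lt_le_trans r3; rewrite mulrA mulrC.
  by rewrite [rho * 2]mulrC ltr_pM2r.
have := vn2 (row_mx x' (lift x' b)) hrho2 Ox'.
rewrite dot_coef ?gt_eqF// ?jordan_lift// hd_mkv -/ga -/h => main.
have gb : dot ga (jordan (x' - x) (lift x' b - y)) <= 2 * enorm ga * K1 ^+ 2 * S ^+ 2.
  rewrite (le_trans (dot_le_enorm _ _))//.
  rewrite -!mulrA mulrCA ler_wpM2l// (le_trans (jordan_bound _ _))// ler_wpM2l//.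
  have -> : K1 * (K1 * S ^+ 2) = (K1 * S) * (K1 * S) by ring.
  apply: ler_pM => //; apply: le_trans hS; rewrite hE.
    by rewrite -{1}(row_mxKl (x' - x) (lift x' b - y)) enorm_lsubmx_le.
  by rewrite -{1}(row_mxKr (x' - x) (lift x' b - y)) enorm_rsubmx_le.
have g2 : 2 * enorm ga * K1 ^+ 2 * S ^+ 2 <= e / 2 * S.
  rewrite [S ^+ 2]expr2 mulrA ler_wpM2r//; apply: (@le_trans _ _ (M * S)).
    by rewrite ler_wpM2r// /M lerDl.
  have : M * S <= M * (2 * rho) by rewrite ler_wpM2l ?ltW.
  by move: r4; lra.
have g3 : e / (2 * K1) * enorm h <= e / 2 * S.
  apply: (@le_trans _ _ (e / (2 * K1) * (K1 * S))); first by rewrite ler_wpM2l// ltW.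
  by rewrite le_eqVlt; apply/orP; left; apply/eqP; field; rewrite gt_eqF.
lra.
Qed.

Lemma first_order_le0 (A B M : R) : 0 <= M ->
  (forall e, 0 < e -> exists2 rho : R, 0 < rho &
    forall s, 0 < s -> s < rho -> s * (A + s * B) <= e * (s * M)) -> A <= 0.
Proof.
move=> M0 H; rewrite leNgt; apply/negP => A0.
have e0 : 0 < A / (4 * (M + 1)) by rewrite divr_gt0// mulr_gt0// ltr_wpDl.
have [rho rho0 {}H] := H _ e0.
pose s := Num.min (rho / 2) (A / (4 * (`|B| + 1))).
have s0 : 0 < s by rewrite lt_min !divr_gt0// mulr_gt0// ltr_wpDl.
have [s1 s2] : s <= rho / 2 /\ s <= A / (4 * (`|B| + 1)).
  by rewrite !ge_min !lexx orbT.
have srho : s < rho by lra.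
have := H s s0 srho; rewrite mulrCA ler_pM2l// => h.
have h1 : A / (4 * (M + 1)) * M <= A / 4.
  have -> : A / 4 = A / (4 * (M + 1)) * (M + 1) by field; rewrite gt_eqF// ltr_wpDl.
  by rewrite ler_wpM2l ?(ltW e0)// lerDl.
have h2 : s * (`|B| + 1) <= A / 4.
  have -> : A / 4 = A / (4 * (`|B| + 1)) * (`|B| + 1) by field; rewrite gt_eqF// ltr_wpDl.
  by rewrite ler_wpM2r// addr_ge0.
have h3 : - (s * B) <= s * `|B|.
  by rewrite -mulrN ler_wpM2l ?(ltW s0)// -normrN ler_norm.
lra.
Qed.

(** The term [s ^+ 2 *: w] lets a test curve stay exactly on [Q = 0]; it disappears from the
    first-order inequality. *)
Lemma reduced_normal_curve x y r be u w c : reduced_normal x y r be ->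
  (exists2 tau : R, 0 < tau & forall s, 0 < s -> s < tau ->
    [/\ 0 <= Q (x + s *: (u + s *: w)), 0 <= hd y + s * c &
        (hd y + s * c) * Q (x + s *: (u + s *: w)) = 0]) ->
  dot r u + be * c <= 0.
Proof.
move=> rn [tau tau0 curve].
pose M := enorm u + enorm w + `|c|.
have M0 : 0 <= M by rewrite !addr_ge0.
apply: (@first_order_le0 _ (dot r w) M) => // e e0.
have [rho rho0 H] := rn _ e0.
exists (Num.min (Num.min tau 1) (rho / (M + 1))).
  by rewrite !lt_min tau0 ltr01 divr_gt0// ltr_wpDl.
move=> s s0; rewrite !lt_min => /andP[/andP[stau s1]].
rewrite ltr_pdivlMr ?ltr_wpDl// => srho.
have [c1 c2 c3] := curve s s0 stau.
have hb : `|hd y + s * c - hd y| = s * `|c| by rewrite addrAC subrr add0r normrM gtr0_norm.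
have hx : enorm (x + s *: (u + s *: w) - x) <= s * (enorm u + enorm w).
  rewrite addrAC subrr add0r enormZ gtr0_norm// ler_wpM2l ?(ltW s0)//.
  rewrite (le_trans (enormD _ _))// lerD2l enormZ gtr0_norm//.
  by rewrite ler_piMl// ltW.
have hxrho : enorm (x + s *: (u + s *: w) - x) < rho.
  apply: (le_lt_trans hx); apply: le_lt_trans srho; rewrite ler_wpM2l ?(ltW s0)//.
  by rewrite /M; have := normr_ge0 c; lra.
have hbrho : `|hd y + s * c - hd y| < rho.
  rewrite hb; apply: le_lt_trans srho; rewrite ler_wpM2l ?(ltW s0)//.
  by rewrite /M; have := enorm_ge0 u; have := enorm_ge0 w; lra.
have := H _ _ hxrho hbrho c1 c2 c3.
rewrite hb {1}addrAC subrr add0r dotZr dotDr dotZr.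
rewrite (_ : hd y + s * c - hd y = s * c); last by ring.
move=> h; apply: (le_trans _ (le_trans h _)).
  by rewrite le_eqVlt; apply/orP; left; apply/eqP; ring.
rewrite ler_wpM2l ?(ltW e0)// /M mulrDr lerD2r//.
Qed.

Lemma lorentzC x y : lorentz x y = lorentz y x.
Proof. by rewrite /lorentz mulrC dotC. Qed.

Lemma lorentzDl x y u : lorentz (x + y) u = lorentz x u + lorentz y u.
Proof. by rewrite /lorentz hdD tlD dotDl; ring. Qed.

Lemma lorentzZl a x u : lorentz (a *: x) u = a * lorentz x u.
Proof. by rewrite /lorentz hdZ tlZ dotZl; ring. Qed.

Lemma lorentzDr x y u : lorentz u (x + y) = lorentz u x + lorentz u y.
Proof. by rewrite lorentzC lorentzDl !(lorentzC u). Qed.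

Lemma lorentzZr a x u : lorentz u (a *: x) = a * lorentz u x.
Proof. by rewrite lorentzC lorentzZl (lorentzC u). Qed.

Lemma lorentz0r u : lorentz u 0 = 0.
Proof. by rewrite /lorentz hd0 tl0 dot0r mulr0 subr0. Qed.

Definition lorentzDZ := (lorentzDl, lorentzDr, lorentzZl, lorentzZr).

Lemma lorentz_refl x u : lorentz x (refl u) = dot x u.
Proof. by rewrite /lorentz dot_hdtl !hdtlE dotNr opprK. Qed.

Lemma refl_null x : Q x = 0 -> Q (refl x) = 0.
Proof. by rewrite /lorentz !hdtlE dotNl dotNr opprK. Qed.

Lemma curve_expand x u w (s : R) : Q (x + s *: (u + s *: w)) =
  Q x + s * (2 * lorentz x u) + s ^+ 2 * (Q u + 2 * lorentz x w) +
  s ^+ 3 * (2 * lorentz u w) + s ^+ 4 * Q w.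
Proof. by rewrite !lorentzDZ (lorentzC u x) (lorentzC w x) (lorentzC w u); ring. Qed.

Lemma regular_normal_nform x y v : 0 < hd x ->
  regular_normal_cone Om (row_mx x y) v ->
  v = nform x y (coef_al x y v) (coef_be x v) (coef_ga x v) /\
  normal_signs x y (coef_al x y v) (coef_be x v).
Proof.
move=> x0 vn; have rn := regular_reduced_normal x0 vn.
have [qx y0 yq j0] := (Om_posE y x0).1 (regular_normal_in vn).
set r := coef_r x y v in rn; set be := coef_be x v in rn *.
have Nx : 0 < dot x x by rewrite dot_hdtl ltr_pwDl ?dotxx_ge0// mulr_gt0.
(* Where [0 < Q x] every direction is admissible with [hd y] kept at 0, in particular [r] itself. *)
have rpos : 0 < Q x -> r = 0.
  move=> qx0; have y00 : hd y = 0.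
    by move/eqP: yq; rewrite mulf_eq0 (gt_eqF qx0) orbF => /eqP.
  apply: dotxx_eq0; apply/le_anti; rewrite dotxx_ge0 andbT.
  suff : dot r r + be * 0 <= 0 by rewrite mulr0 addr0.
  apply: (reduced_normal_curve (w := 0) rn).
  pose L := 2 * `|lorentz x r| + `|Q r| + 1.
  have L0 : 0 < L by rewrite ltr_wpDl// addr_ge0// mulr_ge0.
  exists (Num.min 1 (Q x / L)); first by rewrite lt_min ltr01 divr_gt0.
  move=> s s0; rewrite lt_min ltr_pdivlMr// => /andP[s1 sL].
  rewrite y00 mulr0 addr0 mul0r lexx; split => //.
  rewrite curve_expand.
  rewrite !lorentz0r !mulr0 !addr0.
  have a1 : - (s * (2 * lorentz x r)) <= s * (2 * `|lorentz x r|).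
    by rewrite -mulrN -mulrN !ler_wpM2l ?(ltW s0)// -normrN ler_norm.
  have a2 : - (s ^+ 2 * Q r) <= s * `|Q r|.
    rewrite -mulrN; apply: (@le_trans _ _ (s ^+ 2 * `|Q r|)).
      by rewrite ler_wpM2l ?sqr_ge0// -normrN ler_norm.
    by rewrite ler_wpM2r// expr2 ler_piMr ?(ltW s0)// ltW.
  by move: sL; rewrite /L; lra.
have rnull : Q x = 0 -> r = (hd r / hd x) *: refl x.
  move=> qx0; clearbody r be.
  (* These equations annihilate every coefficient of [curve_expand], so the curve stays on [Q = 0]
     and [hd y] can be kept fixed whatever its value. *)
  have null u w : lorentz x u = 0 -> Q u + 2 * lorentz x w = 0 -> lorentz u w = 0 ->
      Q w = 0 -> dot r u <= 0.
    move=> h1 h2 h3 h4; suff : dot r u + be * 0 <= 0 by rewrite mulr0 addr0.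
    apply: (reduced_normal_curve (w := w) rn); exists 1 => // s s0 s1.
    by rewrite curve_expand qx0 h1 h2 h3 h4 !(mulr0, addr0).
  have rx : dot r x = 0.
    apply/le_anti; rewrite (null x 0) ?qx0 ?lorentz0r ?mulr0 ?addr0//=.
    rewrite -oppr_le0 -dotNr (null (- x) 0) ?lorentz0r ?mulr0 ?addr0//.
      by rewrite -scaleN1r lorentzZr qx0 mulr0.
    by rewrite -scaleN1r !lorentzDZ qx0 !mulr0.
  (* Up to the factor [hd x ^+ 2 = |tl x|^2], the component of [tl r] orthogonal to [tl x]. *)
  pose u2 := hd x ^+ 2 *: tl r - dot (tl r) (tl x) *: tl x.
  have xx : dot (tl x) (tl x) = hd x ^+ 2.
    by move: qx0; rewrite /lorentz expr2; lra.
  have u2x : dot (tl x) u2 = 0 by rewrite /u2 !dotDZ xx (dotC (tl x) (tl r)); ring.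
  (* For [u = mkv 0 u2] and [w = c *: refl x] one has [Q u = - dot u2 u2] and
     [2 * lorentz x w = 2 * c * dot x x], which cancel. *)
  pose c := dot u2 u2 / (2 * dot x x).
  have ru : dot r (mkv 0 u2) <= 0.
    apply: (null _ (c *: refl x)).
    - by rewrite /lorentz !hdtlE u2x mulr0 subr0.
    - rewrite lorentzZr lorentz_refl /lorentz !hdtlE /c; field; exact: lt0r_neq0.
    - by rewrite lorentzZr lorentz_refl dot_hdtl !hdtlE mul0r dotC u2x addr0 mulr0.
    - by rewrite !lorentzDZ refl_null// !mulr0.
  have u20 : u2 = 0.
    apply: dotxx_eq0; apply/le_anti; rewrite dotxx_ge0 andbT.
    have -> : dot u2 u2 = hd x ^+ 2 * dot r (mkv 0 u2).
      have E a : dot u2 a = hd x ^+ 2 * dot (tl r) a - dot (tl r) (tl x) * dot (tl x) a.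
        by rewrite /u2 dotBl !dotZl.
      by rewrite E u2x mulr0 subr0 dot_hdtl !hdtlE mulr0 add0r.
    by rewrite mulr_ge0_le0// sqr_ge0.
  have hx2 : hd x ^+ 2 != 0 by rewrite expf_neq0// gt_eqF.
  have rx2 : dot (tl r) (tl x) = - (hd r * hd x).
    by move: rx; rewrite dot_hdtl; lra.
  apply: hdtl_inj; rewrite !hdtlE ?divfK ?gt_eqF//.
  apply: (scalerI hx2); rewrite scalerA scalerN.
  move/eqP: u20; rewrite subr_eq0 => /eqP ->; rewrite rx2 -scaleNr.
  by congr (_ *: _); field; rewrite gt_eqF.
have al0 : 0 < Q x -> coef_al x y v = 0 by move=> /rpos r0; rewrite /coef_al -/r r0 hd0 mul0r.
split.
  apply: nform_coef; first by rewrite gt_eqF.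
  have [qx0|qx0] := ltP 0 (Q x); last by apply: rnull; apply/le_anti; rewrite qx0.
  by rewrite al0// scale0r -/r rpos.
(* Only [hd y] moves, with [x] fixed: it may always increase, and may decrease when it is
   positive. *)
have bec c : 0 < c \/ 0 < hd y -> Q x = 0 -> be * c <= 0.
  move=> hc qx0; suff : dot r 0 + be * c <= 0 by rewrite dot0r add0r.
  apply: (reduced_normal_curve (w := 0) rn).
  have [c0|c0] := leP 0 c.
    exists 1 => // s s0 s1; rewrite curve_expand qx0 !lorentz0r !(mulr0, addr0).
    by split=> //; rewrite addr_ge0// mulr_ge0// ltW.
  have y1 : 0 < hd y by case: hc => // hc; have := lt_trans hc c0; rewrite ltxx.
  exists (hd y / - c); first by rewrite divr_gt0// oppr_gt0.
  move=> s s0; rewrite ltr_pdivlMr ?oppr_gt0// => sc.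
  by rewrite curve_expand qx0 !lorentz0r !(mulr0, addr0); split=> //; lra.
split=> //.
- move=> y1; have qx0 : Q x = 0 by move/eqP: yq; rewrite mulf_eq0 (gt_eqF y1) => /eqP.
  apply/le_anti; rewrite -[X in X <= _]mulr1 bec ?ltr01//=; last by left.
  by rewrite -oppr_le0 -mulrN1 bec//; right.
- move=> qx0 y00; split; last by rewrite -[leLHS]mulr1 bec//; left.
  have rE := rnull qx0.
  (* [refl x] points into the cone: [Q (x + s *: refl x) = 2 * s * dot x x], while [hd y] stays
     0. *)
  have : dot r (refl x) <= 0.
    suff : dot r (refl x) + be * 0 <= 0 by rewrite mulr0 addr0.
    apply: (reduced_normal_curve (w := 0) rn); exists 1 => // s s0 s1.
    rewrite curve_expand qx0 !lorentz0r y00 lorentz_refl refl_null// !(mulr0, addr0, add0r) mul0r.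
    by split=> //; rewrite !mulr_ge0// ltW.
  rewrite rE dotZl -/(coef_al x y v) pmulr_lle0//.
  by rewrite dot_hdtl !hdtlE dotNl dotNr opprK -dot_hdtl.
Qed.

End NormalsOm.

(** * Directional normals along arbitrary steps *)

Section Sequences.
Context {R : realType}.

Lemma subsequence_of (A : nat -> Prop) : (forall J, exists j, (J <= j)%N /\ A j) ->
  exists phi : nat -> nat, (forall j, (j <= phi j)%N) /\ forall j, A (phi j).
Proof.
move=> /choice[phi H]; exists phi.
by split=> j; have [] := H j.
Qed.

Lemma cvg_subsequence (T : topologicalType) (u : nat -> T) (l : T) (phi : nat -> nat) :
  (forall j, (j <= phi j)%N) -> u @ \oo --> l -> (fun j => u (phi j)) @ \oo --> l.
Proof.
move=> phij ul; apply: (cvg_comp phi u _ ul).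
move=> P [N _ NP]; exists N => // j /= Nj; apply: NP => /=; exact: leq_trans (phij j).
Qed.

Lemma rV_cvg_unique m (u : nat -> 'rV[R]_m) (a b : 'rV[R]_m) :
  u @ \oo --> a -> u @ \oo --> b -> a = b.
Proof.
move=> ua ub; rewrite -(cvg_lim _ ua); last exact: norm_hausdorff.
by apply: cvg_lim => //; exact: norm_hausdorff.
Qed.

(* A strengthening of [dir_normal_cone] in which the steps are arbitrary: it can be
   realized along the same steps for all the factors of a product. *)
Definition uniform_normal k (C : set 'rV[R]_k) (z d v : 'rV[R]_k) : Prop :=
  forall e : R, 0 < e -> exists2 tau : R, 0 < tau & forall t, 0 < t -> t < tau ->
    exists d' v', [/\ enorm (d' - d) < e, enorm (v' - v) < e &
      regular_normal_cone C (z + t *: d') v'].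

Lemma cvg_row_mx (T : Type) (F : set_system T) {FF : Filter F} k1 k2
    (f : T -> 'rV[R]_k1) (g : T -> 'rV[R]_k2) (a : 'rV[R]_k1) (b : 'rV[R]_k2) :
  f @ F --> a -> g @ F --> b ->
  (fun s => row_mx (f s) (g s)) @ F --> (row_mx a b : 'rV[R]_(k1 + k2)).
Proof.
move=> /cvg_enormP fa /cvg_enormP gb; apply/cvg_enormP => e e0.
have e20 : 0 < e / 2 by rewrite divr_gt0.
move: (fa _ e20) (gb _ e20); apply: filterS2 => s h1 h2.
rewrite opp_row_mx add_row_mx; apply: (le_lt_trans (enorm_row_mx _ _)); lra.
Qed.

Lemma cvg_of_quotient (T : Type) (F : set_system T) {FF : Filter F} k
    (t : T -> R) (p : T -> 'rV[R]_k) (z d : 'rV[R]_k) :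
  t @ F --> (0 : R) -> (\forall s \near F, t s != 0) ->
  (fun s => (t s)^-1 *: (p s - z)) @ F --> d -> p @ F --> z.
Proof.
move=> t0 tn qd.
have : (fun s => z + t s *: ((t s)^-1 *: (p s - z))) @ F --> z + 0 *: d.
  by apply: cvgD; [exact: cvg_cst|exact: cvgZ].
rewrite scale0r addr0; apply: cvg_trans; apply: near_eq_cvg.
by apply: filterS tn => s s0; rewrite scalerA divff// scale1r [z + _]addrC subrK.
Qed.

End Sequences.

(** * Curves realizing directional normals *)

Section UniformOm.
Context {R : realType} {k : nat}.
Implicit Types x y u w r : 'rV[R]_k.+1.
Local Notation Q x := (lorentz x x).

Lemma nform_cvg (T : Type) (F : set_system T) {FF : Filter F}
    (X Y : T -> 'rV[R]_k.+1) x y (a b : T -> R) (al be : R) (g : T -> 'rV[R]_k) ga :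
  X @ F --> x -> Y @ F --> y -> a @ F --> al -> b @ F --> be -> g @ F --> ga ->
  (fun s => nform (X s) (Y s) (a s) (b s) (g s)) @ F --> nform x y al be ga.
Proof.
move=> Xx Yy aal bbe gga; apply: cvg_row_mx; apply: cvg_mkv.
- apply: cvgD; last by apply: cvgM => //; exact: cvg_hd.
  by apply: cvg_dot => //; exact: cvg_tl.
- apply: cvgB; first by apply: cvgZ => //; exact: cvg_hd.
  by apply: cvgZ => //; exact: cvg_tl.
- by apply: cvgD => //; apply: cvg_dot => //; exact: cvg_tl.
- by apply: cvgZ => //; exact: cvg_hd.
Qed.

(** The multipliers are constant along the curve and only the base point moves; [nform] is
    continuous, so the normals converge as the step [s] tends to 0 through all positive values. *)
Lemma uniform_of_curve x y dx dy al be ga (X Y : R -> 'rV[R]_k.+1) :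
  (fun s => s^-1 *: (X s - x)) @ 0^'+ --> dx ->
  (fun s => s^-1 *: (Y s - y)) @ 0^'+ --> dy ->
  (\forall s \near 0^'+, [/\ 0 < hd (X s), Om (row_mx (X s) (Y s)) &
      normal_signs (X s) (Y s) al be]) ->
  uniform_normal Om (row_mx x y) (row_mx dx dy) (nform x y al be ga).
Proof.
move=> qX qY XY e e0.
have id0 : (fun s : R => s) @ 0^'+ --> (0 : R).
  by apply: cvg_at_right_filter; exact: cvg_id.
have idn : \forall s \near (0 : R)^'+, s != 0 by near=> s; rewrite gt_eqF.
have Xx : X @ 0^'+ --> x by exact: (cvg_of_quotient id0 idn qX).
have Yy : Y @ 0^'+ --> y by exact: (cvg_of_quotient id0 idn qY).
have /cvg_enormP/(_ _ e0) c1 : (fun s => row_mx (s^-1 *: (X s - x)) (s^-1 *: (Y s - y)))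
    @ 0^'+ --> (row_mx dx dy : 'rV[R]_(k.+1 + k.+1)).
  exact: cvg_row_mx.
have /cvg_enormP/(_ _ e0) c2 : (fun s => nform (X s) (Y s) al be ga) @ 0^'+ -->
    nform x y al be ga.
  by apply: nform_cvg => //; exact: cvg_cst.
have : \forall s \near (0 : R)^'+, exists d' v', [/\ enorm (d' - row_mx dx dy) < e,
      enorm (v' - nform x y al be ga) < e &
      regular_normal_cone Om (row_mx x y + s *: d') v'].
  near=> s.
  exists (row_mx (s^-1 *: (X s - x)) (s^-1 *: (Y s - y))), (nform (X s) (Y s) al be ga).
  split; [by near: s|by near: s|].
  have s0 : s != 0 by rewrite gt_eqF.
  have -> : row_mx x y + s *: row_mx (s^-1 *: (X s - x)) (s^-1 *: (Y s - y)) =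
      row_mx (X s) (Y s).
    rewrite scale_row_mx add_row_mx !scalerA divff// !scale1r.
    by rewrite ![_ + (_ - _)]addrC !subrK.
  have [h1 h2 h3] : [/\ 0 < hd (X s), Om (row_mx (X s) (Y s)) &
      normal_signs (X s) (Y s) al be] by near: s.
  exact: nform_regular_normal.
move=> [tau /= tau0 H]; exists tau => // t t0 tt; apply: H => //=.
by rewrite sub0r normrN gtr0_norm.
Unshelve. all: by end_near. Qed.

Lemma lift_diff x x' b b' : 0 < hd x -> 0 < hd x' ->
  tl (lift x' b') - tl (lift x b) = (hd x')^-1 *:
    - ((b' - b) *: tl x' + b *: (tl (x' - x)) + hd (x' - x) *: tl (lift x b)).
Proof.
move=> x0 x'0; apply: (scalerI (lt0r_neq0 x'0)); rewrite scalerA divff ?gt_eqF// scale1r.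
have h1 := jordan_lift b' x'0; have h2 := jordan_lift b x0.
rewrite /jordan !hd_mkv in h1 h2.
have {}h1 : hd x' *: tl (lift x' b') = - (b' *: tl x') by apply/eqP; rewrite -addr_eq0 addrC h1.
have {}h2 : hd x *: tl (lift x b) = - (b *: tl x) by apply/eqP; rewrite -addr_eq0 addrC h2.
rewrite scalerBr h1 hdB tlB !scalerBl h2 scalerBr.
by apply/rowP => i; rewrite !mxE; ring.
Qed.

(** The derivative of [lift] at [(x, hd y)] in the direction [(dx, c)], obtained by differentiating
    [jordan x y = 0]. *)
Definition dlift x y dx c : 'rV[R]_k.+1 :=
  mkv c ((hd x)^-1 *: - (c *: tl x + hd y *: tl dx + hd dx *: tl y)).

Lemma lift_quotient (T : Type) (F : set_system T) {FF : Filter F}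
    (t : T -> R) (X : T -> 'rV[R]_k.+1) (b : T -> R) x y dx c :
  0 < hd x -> jordan x y = 0 ->
  t @ F --> (0 : R) -> (\forall s \near F, t s != 0) ->
  (fun s => (t s)^-1 *: (X s - x)) @ F --> dx ->
  (fun s => (t s)^-1 * (b s - hd y)) @ F --> c ->
  (fun s => (t s)^-1 *: (lift (X s) (b s) - y)) @ F --> dlift x y dx c.
Proof.
move=> x0 j0 t0 tn qX qb.
have Xx : X @ F --> x by exact: (cvg_of_quotient t0 tn qX).
have Xpos : \forall s \near F, 0 < hd (X s) by exact: (near_gt0 (cvg_hd Xx) x0).
have : (fun s => mkv ((t s)^-1 * (b s - hd y)) ((hd (X s))^-1 *:
    - (((t s)^-1 * (b s - hd y)) *: tl (X s) + hd y *: tl ((t s)^-1 *: (X s - x)) +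
       hd ((t s)^-1 *: (X s - x)) *: tl y))) @ F --> dlift x y dx c.
  apply: cvg_mkv => //; apply: cvgZ.
    by apply: cvgV; [rewrite gt_eqF|exact: cvg_hd].
  apply: cvgN; apply: cvgD; last first.
    by apply: cvgZ; [exact: cvg_hd|exact: cvg_cst].
  apply: cvgD; first by apply: cvgZ => //; exact: cvg_tl.
  by apply: cvgZ; [exact: cvg_cst|exact: cvg_tl].
apply: cvg_trans; apply: near_eq_cvg; apply: filterS2 Xpos tn => s Xs ts.
rewrite [in RHS](jordan0_lift x0 j0); apply: hdtl_inj; rewrite ?hdZ ?tlZ ?hdB ?tlB ?hd_mkv//.
rewrite tl_mkv lift_diff// -(jordan0_lift x0 j0).
rewrite [in RHS]scalerA [in RHS]mulrC -[in RHS]scalerA; congr (_ *: _).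
rewrite [in RHS]scalerN !scalerDr !scalerA tlB hdB.
by apply/rowP => i; rewrite !mxE; ring.
Qed.

Lemma lorentz_quotient (T : Type) (F : set_system T) {FF : Filter F}
    (t : T -> R) (X : T -> 'rV[R]_k.+1) x dx :
  t @ F --> (0 : R) -> (\forall s \near F, t s != 0) ->
  (fun s => (t s)^-1 *: (X s - x)) @ F --> dx ->
  (fun s => (t s)^-1 * (Q (X s) - Q x)) @ F --> 2 * lorentz x dx.
Proof.
move=> t0 tn qX.
have cl : (fun s => lorentz x ((t s)^-1 *: (X s - x))) @ F --> lorentz x dx.
  apply: cvgB; first by apply: cvgM; [exact: cvg_cst|exact: cvg_hd].
  by apply: cvg_dot; [exact: cvg_cst|exact: cvg_tl].
have : (fun s => 2 * lorentz x ((t s)^-1 *: (X s - x)) +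
    t s * Q ((t s)^-1 *: (X s - x))) @ F --> 2 * lorentz x dx + 0 * Q dx.
  apply: cvgD; first by apply: cvgM => //; exact: cvg_cst.
  by apply: cvgM => //; exact: cvg_lorentz.
rewrite mul0r addr0; apply: cvg_trans; apply: near_eq_cvg; apply: filterS tn => s ts.
set h := X s - x; have -> : X s = x + h by rewrite addrC subrK.
by clearbody h; rewrite !lorentzDZ (lorentzC h x); field.
Qed.

Lemma limit_le0 (u : nat -> R) (l : R) : u @ \oo --> l -> (forall j, u j <= 0) -> l <= 0.
Proof.
move=> ul u0; rewrite -(cvg_lim _ ul)//; apply: limr_le; first by apply: cvgP ul.
by near=> j.
Unshelve. all: by end_near. Qed.

Lemma limit_ge0 (u : nat -> R) (l : R) : u @ \oo --> l -> (forall j, 0 <= u j) -> 0 <= l.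
Proof.
move=> ul u0; rewrite -(cvg_lim _ ul)//; apply: limr_ge; first by apply: cvgP ul.
by near=> j.
Unshelve. all: by end_near. Qed.

Lemma limit_eq0 (u : nat -> R) (l : R) : u @ \oo --> l -> (forall j, u j = 0) -> l = 0.
Proof.
move=> ul u0; apply/le_anti.
by rewrite (limit_le0 ul) ?(limit_ge0 ul)// => j; rewrite u0.
Qed.

(** A directional normal realized by base points that all satisfy [A], so that one sign pattern
    governs all multipliers. *)
Definition normal_seq (A : 'rV[R]_k.+1 -> 'rV[R]_k.+1 -> Prop)
    (x y dx dy : 'rV[R]_k.+1) (v : 'rV[R]_(k.+1 + k.+1)) : Prop :=
  exists (t : nat -> R) (xs ys : nat -> 'rV[R]_k.+1) (vs : nat -> 'rV[R]_(k.+1 + k.+1)),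
  [/\ (forall j, 0 < t j), t @ \oo --> (0 : R),
      (fun j => (t j)^-1 *: (xs j - x)) @ \oo --> dx,
      (fun j => (t j)^-1 *: (ys j - y)) @ \oo --> dy & vs @ \oo --> v] /\
  forall j, [/\ 0 < hd (xs j), regular_normal_cone Om (row_mx (xs j) (ys j)) (vs j) &
    A (xs j) (ys j)].

(** The strata of the complementarity set where [0 < hd x]. The vertex meant below is the corner of
    the angle in [(Q x, hd y)], not the apex of the cone. *)
Definition interior_type x y : Prop := 0 < Q x.
Definition vertex_type x y : Prop := Q x = 0 /\ hd y = 0.
Definition boundary_type x y : Prop := Q x = 0 /\ 0 < hd y.

(** Pigeonhole: if each type occurred only finitely often, a base point beyond all thresholds would
    have no type. *)
Lemma normal_seq_type x y d v : 0 < hd x -> dir_normal_cone Om (row_mx x y) d v ->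
  [\/ normal_seq interior_type x y (lsubmx d) (rsubmx d) v,
      normal_seq vertex_type x y (lsubmx d) (rsubmx d) v |
      normal_seq boundary_type x y (lsubmx d) (rsubmx d) v].
Proof.
move=> x0 [t [ds [vs [[t0 tt] dsd vsv nv]]]].
pose xs j := x + t j *: lsubmx (ds j); pose ys j := y + t j *: rsubmx (ds j).
have pE j : row_mx x y + t j *: ds j = row_mx (xs j) (ys j).
  by rewrite -{1}(hsubmxK (ds j)) scale_row_mx add_row_mx.
have {}nv j : regular_normal_cone Om (row_mx (xs j) (ys j)) (vs j) by rewrite -pE.
have tn j : t j != 0 by rewrite gt_eqF.
have qx : (fun j => (t j)^-1 *: (xs j - x)) @ \oo --> (lsubmx d : 'rV[R]_k.+1).
  rewrite (_ : (fun j => _) = fun j => lsubmx (ds j)); first exact: cvg_lsubmx.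
  by apply/funext => j; rewrite /xs [x + _]addrC addrK scalerA mulVf// scale1r.
have qy : (fun j => (t j)^-1 *: (ys j - y)) @ \oo --> (rsubmx d : 'rV[R]_k.+1).
  rewrite (_ : (fun j => _) = fun j => rsubmx (ds j)); first exact: cvg_rsubmx.
  by apply/funext => j; rewrite /ys [y + _]addrC addrK scalerA mulVf// scale1r.
have xsx : xs @ \oo --> x.
  by apply: (cvg_of_quotient tt _ qx); near=> j.
have [N _ hN] : \forall j \near \oo, 0 < hd (xs j) by exact: (near_gt0 (cvg_hd xsx) x0).
have mk (A : 'rV[R]_k.+1 -> 'rV[R]_k.+1 -> Prop) :
    (forall J, exists j, (J <= j)%N /\ (0 < hd (xs j) /\ A (xs j) (ys j))) ->
    normal_seq A x y (lsubmx d) (rsubmx d) v.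
  move=> /subsequence_of[phi [phij H]].
  exists (fun j => t (phi j)), (fun j => xs (phi j)), (fun j => ys (phi j)),
    (fun j => vs (phi j)); split.
    split; first by move=> j; exact: t0.
    - exact: (cvg_subsequence phij tt).
    - exact: (cvg_subsequence phij qx).
    - exact: (cvg_subsequence phij qy).
    - exact: (cvg_subsequence phij vsv).
  by move=> j; have [h1 h2] := H j; split.
apply: contrapT => n123.
have n1 : ~ normal_seq interior_type x y (lsubmx d) (rsubmx d) v.
  by move=> h; apply: n123; exact: Or31.
have n2 : ~ normal_seq vertex_type x y (lsubmx d) (rsubmx d) v.
  by move=> h; apply: n123; exact: Or32.
have n3 : ~ normal_seq boundary_type x y (lsubmx d) (rsubmx d) v.
  by move=> h; apply: n123; exact: Or33.
have fin (A : 'rV[R]_k.+1 -> 'rV[R]_k.+1 -> Prop) :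
    ~ normal_seq A x y (lsubmx d) (rsubmx d) v ->
    exists J, forall j, (J <= j)%N -> 0 < hd (xs j) -> ~ A (xs j) (ys j).
  move=> nA; apply: contrapT => H; apply: nA; apply: mk => J.
  apply: contrapT => H2; apply: H; exists J => j Jj xj Aj; apply: H2.
  by exists j.
have [J1 H1] := fin _ n1; have [J2 H2] := fin _ n2; have [J3 H3] := fin _ n3.
pose j := maxn N (maxn J1 (maxn J2 J3)).
have jN : (N <= j)%N by rewrite leq_maxl.
have j1 : (J1 <= j)%N by rewrite !leq_max leqnn !orbT.
have j2 : (J2 <= j)%N by rewrite !leq_max leqnn !orbT.
have j3 : (J3 <= j)%N by rewrite !leq_max leqnn !orbT.
have xj := hN j jN.
have [qj yj yqj _] := (Om_posE (ys j) xj).1 (regular_normal_in (nv j)).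
have [q0|q0] := ltP 0 (Q (xs j)); first exact: (H1 j).
have {}q0 : Q (xs j) = 0 by apply/le_anti; rewrite q0 qj.
have [y0|y0] := ltP 0 (hd (ys j)); first by apply: (H3 j).
by apply: (H2 j) => //; split => //; apply/le_anti; rewrite y0 yj.
Unshelve. all: by end_near. Qed.

(** The coefficients depend continuously on [x], [y], [v], so those of the regular normals converge;
    their equalities and weak inequalities can then be passed to [al] and [be]. *)
Lemma normal_seq_nform A x y dx dy v : 0 < hd x -> normal_seq A x y dx dy v ->
  exists al be ga, v = nform x y al be ga /\
  exists a b : nat -> R, [/\ a @ \oo --> al, b @ \oo --> be &
    forall j, exists x' y', A x' y' /\ normal_signs x' y' (a j) (b j)].
Proof.
move=> x0 [t [xs [ys [vs [[t0 tt qx qy vsv] H]]]]].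
have tn : \forall j \near \oo, t j != 0 by near=> j; rewrite gt_eqF.
have xsx : xs @ \oo --> x by exact: (cvg_of_quotient tt tn qx).
have ysy : ys @ \oo --> y by exact: (cvg_of_quotient tt tn qy).
have hdi : (fun j => (hd (xs j))^-1) @ \oo --> (hd x)^-1.
  by apply: cvgV; [rewrite gt_eqF|exact: cvg_hd].
have gcv : (fun j => coef_ga (xs j) (vs j)) @ \oo --> coef_ga x v.
  by apply: cvgZ => //; apply: cvg_tl; exact: cvg_rsubmx.
have bcv : (fun j => coef_be (xs j) (vs j)) @ \oo --> coef_be x v.
  apply: cvgB; first by apply: cvg_hd; exact: cvg_rsubmx.
  by apply: cvg_dot => //; exact: cvg_tl.
have acv : (fun j => coef_al (xs j) (ys j) (vs j)) @ \oo --> coef_al x y v.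
  apply: cvgM => //; apply: cvg_hd; apply: cvgB; first exact: cvg_lsubmx.
  apply: cvg_mkv; first by apply: cvg_dot => //; exact: cvg_tl.
  by apply: cvgZ => //; exact: cvg_hd.
exists (coef_al x y v), (coef_be x v), (coef_ga x v); split; last first.
  exists (fun j => coef_al (xs j) (ys j) (vs j)), (fun j => coef_be (xs j) (vs j)).
  split=> // j; have [h1 h2 h3] := H j; exists (xs j), (ys j); split => //.
  by have [] := regular_normal_nform h1 h2.
have nfcv : (fun j => nform (xs j) (ys j) (coef_al (xs j) (ys j) (vs j))
    (coef_be (xs j) (vs j)) (coef_ga (xs j) (vs j))) @ \oo -->
    nform x y (coef_al x y v) (coef_be x v) (coef_ga x v) by exact: nform_cvg.
have vE : (fun j => nform (xs j) (ys j) (coef_al (xs j) (ys j) (vs j))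
    (coef_be (xs j) (vs j)) (coef_ga (xs j) (vs j))) = vs.
  by apply/funext => j; have [h1 h2 _] := H j; have [] := regular_normal_nform h1 h2.
rewrite vE in nfcv; exact: (rV_cvg_unique vsv nfcv).
Unshelve. all: by end_near. Qed.

Lemma cvg_right0_id : (fun s : R => s) @ 0^'+ --> (0 : R).
Proof. by apply: cvg_at_right_filter; exact: cvg_id. Qed.

Lemma near_right0_neq0 : \forall s \near (0 : R)^'+, s != 0.
Proof. by near=> s; rewrite gt_eqF. Unshelve. all: by end_near. Qed.

Lemma quotient_curve x u (w : R -> 'rV[R]_k.+1) (w0 : 'rV[R]_k.+1) :
  w @ 0^'+ --> w0 ->
  (fun s => s^-1 *: (x + s *: (u + s *: w s) - x)) @ 0^'+ --> u.
Proof.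
move=> ww.
have : (fun s => u + s *: w s) @ 0^'+ --> u + 0 *: w0.
  by apply: cvgD; [exact: cvg_cst|apply: cvgZ => //; exact: cvg_right0_id].
rewrite scale0r addr0; apply: cvg_trans; apply: near_eq_cvg.
apply: filterS near_right0_neq0 => s s0.
by rewrite [x + _]addrC addrK scalerA mulVf// scale1r.
Qed.

(** All base points lie on the graph of [lift], so [dy] is determined by [dx] and [hd dy]. Hence a
    curve need only match these two. *)
Lemma normal_seq_dlift A x y dx dy v : 0 < hd x -> jordan x y = 0 ->
  normal_seq A x y dx dy v -> dy = dlift x y dx (hd dy).
Proof.
move=> x0 j0 [t [xs [ys [vs [[t0 tt qx qy vsv] H]]]]].
have tn : \forall j \near \oo, t j != 0 by near=> j; rewrite gt_eqF.
have qb : (fun j => (t j)^-1 * (hd (ys j) - hd y)) @ \oo --> hd dy.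
  have : (fun j => hd ((t j)^-1 *: (ys j - y))) @ \oo --> hd dy by exact: cvg_hd.
  by under eq_fun do rewrite hdZ hdB.
have cv : (fun j => (t j)^-1 *: (lift (xs j) (hd (ys j)) - y)) @ \oo -->
    dlift x y dx (hd dy) by exact: lift_quotient.
have E : (fun j => (t j)^-1 *: (lift (xs j) (hd (ys j)) - y)) =
    fun j => (t j)^-1 *: (ys j - y).
  apply/funext => j; have [xj /regular_normal_in Oj _] := H j.
  by have [_ _ _ jj] := (Om_posE _ xj).1 Oj; rewrite -(jordan0_lift xj jj).
by rewrite E in cv; exact: (rV_cvg_unique qy cv).
Unshelve. all: by end_near. Qed.

Lemma normal_seq_hd0 A x y dx dy v :
  (forall x' y', 0 < hd x' -> Om (row_mx x' y') -> A x' y' -> hd y' = 0) ->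
  0 < hd x -> normal_seq A x y dx dy v -> hd y = 0 /\ hd dy = 0.
Proof.
move=> A0 x0 [t [xs [ys [vs [[t0 tt qx qy vsv] H]]]]].
have tn : \forall j \near \oo, t j != 0 by near=> j; rewrite gt_eqF.
have ysy : ys @ \oo --> y by exact: (cvg_of_quotient tt tn qy).
have ys0 j : hd (ys j) = 0.
  by have [xj /regular_normal_in Oj Aj] := H j; exact: A0 xj Oj Aj.
have y0 : hd y = 0.
  have cv : (fun j => hd (ys j)) @ \oo --> hd y by exact: cvg_hd.
  exact: (limit_eq0 cv).
split=> //; have cv : (fun j => hd ((t j)^-1 *: (ys j - y))) @ \oo --> hd dy by exact: cvg_hd.
by apply: (limit_eq0 cv) => j; rewrite hdZ hdB ys0 y0 subr0 mulr0.
Unshelve. all: by end_near. Qed.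

Lemma normal_seq_lorentz0 A x y dx dy v : (forall x' y', A x' y' -> Q x' = 0) ->
  0 < hd x -> normal_seq A x y dx dy v -> Q x = 0 /\ lorentz x dx = 0.
Proof.
move=> A0 x0 [t [xs [ys [vs [[t0 tt qx qy vsv] H]]]]].
have tn : \forall j \near \oo, t j != 0 by near=> j; rewrite gt_eqF.
have xsx : xs @ \oo --> x by exact: (cvg_of_quotient tt tn qx).
have xs0 j : Q (xs j) = 0 by have [_ _ Aj] := H j; exact: A0 Aj.
have qx0 : Q x = 0.
  have cv : (fun j => Q (xs j)) @ \oo --> Q x by exact: cvg_lorentz.
  exact: (limit_eq0 cv).
split=> //; have cv : (fun j => (t j)^-1 * (Q (xs j) - Q x)) @ \oo --> 2 * lorentz x dx
  by exact: lorentz_quotient.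
have := limit_eq0 cv; rewrite qx0 => h.
have : 2 * lorentz x dx = 0 by apply: h => j; rewrite xs0 subr0 mulr0.
lra.
Unshelve. all: by end_near. Qed.

Lemma normal_seq_lorentz_ge0 A x y dx dy v : 0 < hd x -> normal_seq A x y dx dy v ->
  Q x = 0 -> 0 <= lorentz x dx.
Proof.
move=> x0 [t [xs [ys [vs [[t0 tt qx qy vsv] H]]]]] qx0.
have tn : \forall j \near \oo, t j != 0 by near=> j; rewrite gt_eqF.
have cv : (fun j => (t j)^-1 * (Q (xs j) - Q x)) @ \oo --> 2 * lorentz x dx
  by exact: lorentz_quotient.
have := limit_ge0 cv; rewrite qx0 => h.
have : 0 <= 2 * lorentz x dx.
  apply: h => j; have [xj /regular_normal_in Oj _] := H j.
  have [qj _ _ _] := (Om_posE _ xj).1 Oj.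
  by rewrite subr0 mulr_ge0// invr_ge0 ltW.
lra.
Unshelve. all: by end_near. Qed.

Lemma dot_self_gt0 x : 0 < hd x -> 0 < dot x x.
Proof. by move=> x0; rewrite dot_hdtl ltr_pwDl ?dotxx_ge0// mulr_gt0. Qed.

Lemma interior_curve x dx : 0 < hd x -> 0 <= Q x -> (Q x = 0 -> 0 <= lorentz x dx) ->
  exists X : R -> 'rV[R]_k.+1, (fun s => s^-1 *: (X s - x)) @ 0^'+ --> dx /\
    \forall s \near 0^'+, 0 < Q (X s).
Proof.
(* If [Q x = 0], the coefficient of [s ^+ 2] becomes [Q dx + 2 + 2 |Q dx| > 0], which decides the
   sign even when the first-order term vanishes. *)
move=> x0 qx ldx; pose M := (1 + `|Q dx|) / hd x.
pose w : 'rV[R]_k.+1 := mkv M 0.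
have lw u : lorentz u w = M * hd u by rewrite /lorentz !hdtlE dot0r subr0 mulrC.
have qX : (fun s => s^-1 *: (x + s *: (dx + s *: w) - x)) @ 0^'+ --> dx.
  by apply: (@quotient_curve x dx (fun=> w) w); exact: cvg_cst.
exists (fun s => x + s *: (dx + s *: w)); split; first exact: qX.
have [q0|q0] := ltP 0 (Q x).
  have cv : (fun s => x + s *: (dx + s *: w)) @ 0^'+ --> x.
    exact: (cvg_of_quotient cvg_right0_id near_right0_neq0 qX).
  exact: (near_gt0 (cvg_lorentz cv) q0).
have {}q0 : Q x = 0 by apply/le_anti; rewrite q0 qx.
have c0 : 0 < Q dx + 2 * lorentz x w.
  rewrite lw /M divfK ?gt_eqF//; have := normr_ge0 (Q dx); have := ler_norm (- Q dx); rewrite normrN; lra.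
have cv : (fun s : R => Q dx + 2 * lorentz x w + s * (2 * lorentz dx w + s * Q w)) @ 0^'+
    --> Q dx + 2 * lorentz x w + 0 * (2 * lorentz dx w + 0 * Q w).
  apply: cvgD; first exact: cvg_cst.
  apply: cvgM; first exact: cvg_right0_id.
  apply: cvgD; first exact: cvg_cst.
  by apply: cvgM; [exact: cvg_right0_id|exact: cvg_cst].
rewrite mul0r addr0 in cv; have pos : \forall s \near (0 : R)^'+,
    0 < Q dx + 2 * lorentz x w + s * (2 * lorentz dx w + s * Q w).
  exact: (near_gt0 cv c0).
near=> s; have s0 : 0 < s by [].
have ps : 0 < Q dx + 2 * lorentz x w + s * (2 * lorentz dx w + s * Q w) by near: s.
rewrite curve_expand q0 add0r.
have -> : s * (2 * lorentz x dx) + s ^+ 2 * (Q dx + 2 * lorentz x w) +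
   s ^+ 3 * (2 * lorentz dx w) + s ^+ 4 * Q w =
   s * (2 * lorentz x dx) + s ^+ 2 * (Q dx + 2 * lorentz x w + s * (2 * lorentz dx w + s * Q w)).
  by ring.
rewrite ltr_wpDl ?mulr_gt0 ?exprn_gt0//.
by rewrite !mulr_ge0// ?ldx// ltW.
Unshelve. all: by end_near. Qed.

(** The correction runs along [refl x]. As this vector is null, the equation for its coefficient is
    linear, with solution [- Q dx / den s]. *)
Lemma boundary_curve x dx : 0 < hd x -> Q x = 0 -> lorentz x dx = 0 ->
  exists X : R -> 'rV[R]_k.+1, (fun s => s^-1 *: (X s - x)) @ 0^'+ --> dx /\
    \forall s \near 0^'+, Q (X s) = 0.
Proof.
move=> x0 q0 ldx; have N0 := dot_self_gt0 x0.
pose den s := 2 * (dot x x + s * dot dx x).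
pose c s := - Q dx / den s.
have denc : den @ 0^'+ --> den 0.
  apply: cvgM; first exact: cvg_cst.
  apply: cvgD; first exact: cvg_cst.
  by apply: cvgM; [exact: cvg_right0_id|exact: cvg_cst].
have den0 : 0 < den 0 by rewrite /den mul0r addr0 mulr_gt0.
have cc : (fun s => c s *: refl x) @ 0^'+ --> c 0 *: refl x.
  apply: cvgZ; last exact: cvg_cst.
  by apply: cvgM; [exact: cvg_cst|apply: cvgV => //; rewrite gt_eqF].
exists (fun s => x + s *: (dx + s *: (c s *: refl x))); split.
  exact: quotient_curve cc.
apply: filterS (near_gt0 denc den0) => s ds.
have cd : c s * den s = - Q dx by rewrite /c divfK// gt_eqF.
rewrite curve_expand q0 ldx !lorentzDZ refl_null// !lorentz_refl.
have -> : 0 + s * (2 * 0) + s ^+ 2 * (Q dx + 2 * (c s * dot x x)) +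
   s ^+ 3 * (2 * (c s * dot dx x)) + s ^+ 4 * (c s * (c s * 0)) =
   s ^+ 2 * (Q dx + c s * den s) by rewrite /den; ring.
by rewrite cd subrr mulr0.
Qed.

Lemma normal_seq_hd_ge0 A x y dx dy v : 0 < hd x -> normal_seq A x y dx dy v ->
  hd y = 0 -> 0 <= hd dy.
Proof.
move=> x0 [t [xs [ys [vs [[t0 tt qx qy vsv] H]]]]] y0.
have cv : (fun j => hd ((t j)^-1 *: (ys j - y))) @ \oo --> hd dy by exact: cvg_hd.
apply: (limit_ge0 cv) => j; have [xj /regular_normal_in Oj _] := H j.
have [_ yj _ _] := (Om_posE _ xj).1 Oj.
by rewrite hdZ hdB y0 subr0 mulr_ge0// invr_ge0 ltW.
Qed.

(** The type of the base points selects the curve: [interior_curve] or [boundary_curve] for [x],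
    followed by [lift] with a first component that is zero, or positive for the boundary type. The
    limiting multipliers satisfy the sign conditions of that type. *)
Lemma uniform_normal_pos x y d v : 0 < hd x -> Om (row_mx x y) ->
  dir_normal_cone Om (row_mx x y) d v -> uniform_normal Om (row_mx x y) d v.
Proof.
move=> x0 Oxy dn; have [qx y0 yq j0] := (Om_posE y x0).1 Oxy.
have id0 := cvg_right0_id; have idn := near_right0_neq0.
rewrite -(hsubmxK d).
set dx := lsubmx d; set dy := rsubmx d.
have Xhd (X : R -> 'rV[R]_k.+1) : (fun s => s^-1 *: (X s - x)) @ 0^'+ --> dx ->
    \forall s \near 0^'+, 0 < hd (X s).
  move=> qX; have cv : X @ 0^'+ --> x by exact: (cvg_of_quotient id0 idn qX).
  exact: (near_gt0 (cvg_hd cv) x0).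
case: (normal_seq_type x0 dn) => ns; have [al [be [ga [-> [a [b [aal bbe ab]]]]]]] :=
    normal_seq_nform x0 ns; have dyE := normal_seq_dlift x0 j0 ns.
- have [X [qX QX]] := interior_curve x0 qx (normal_seq_lorentz_ge0 x0 ns).
  have [y00 dy0] : hd y = 0 /\ hd dy = 0.
    apply: normal_seq_hd0 x0 ns => x' y' x'0 Ox' qx'.
    have [_ _ /eqP] := (Om_posE y' x'0).1 Ox'.
    by rewrite mulf_eq0 (gt_eqF qx') orbF => /eqP.
  have al0 : al = 0.
    by apply: (limit_eq0 aal) => j; have [x' [y' [qx' [h _ _]]]] := ab j; exact: h.
  apply: (@uniform_of_curve _ _ _ _ _ _ _ X (fun s => lift (X s) 0)) => //.
    rewrite -/dy in dyE; rewrite dyE dy0; apply: lift_quotient => //.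
    by rewrite y00; under eq_fun do rewrite subrr mulr0; exact: cvg_cst.
  apply: filterS2 (Xhd _ qX) QX => s hs qs; split=> //.
    by apply/(Om_posE _ hs); rewrite hd_mkv jordan_lift// mul0r ltW.
  by split=> //; rewrite ?hd_mkv ?ltxx// => q0; rewrite q0 ltxx in qs.
- have [q0 ldx] : Q x = 0 /\ lorentz x dx = 0.
    by apply: normal_seq_lorentz0 x0 ns => x' y' [].
  have [y00 dy0] : hd y = 0 /\ hd dy = 0.
    by apply: normal_seq_hd0 x0 ns => x' y' _ _ [].
  have [X [qX QX]] := boundary_curve x0 q0 ldx.
  have al0 : al <= 0.
    apply: (limit_le0 aal) => j; have [x' [y' [[qx' y0'] [_ _ h]]]] := ab j.
    by have [] := h qx' y0'.
  have be0 : be <= 0.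
    apply: (limit_le0 bbe) => j; have [x' [y' [[qx' y0'] [_ _ h]]]] := ab j.
    by have [] := h qx' y0'.
  apply: (@uniform_of_curve _ _ _ _ _ _ _ X (fun s => lift (X s) 0)) => //.
    rewrite -/dy in dyE; rewrite dyE dy0; apply: lift_quotient => //.
    by rewrite y00; under eq_fun do rewrite subrr mulr0; exact: cvg_cst.
  apply: filterS2 (Xhd _ qX) QX => s hs qs; split=> //.
    by apply/(Om_posE _ hs); rewrite hd_mkv jordan_lift// mul0r qs.
  by split=> //; rewrite ?hd_mkv ?qs ltxx.
- have [q0 ldx] : Q x = 0 /\ lorentz x dx = 0.
    by apply: normal_seq_lorentz0 x0 ns => x' y' [].
  have [X [qX QX]] := boundary_curve x0 q0 ldx.
  have be0 : be = 0.
    by apply: (limit_eq0 bbe) => j; have [x' [y' [[_ y0'] [_ h _]]]] := ab j; exact: h.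
  have dyy := normal_seq_hd_ge0 x0 ns.
  (* The extra [s ^+ 2] gives positivity even if [hd y] and [hd dy] both vanish, and leaves the
     direction unchanged. *)
  have bpos : \forall s \near 0^'+, 0 < hd y + s * (hd dy + s).
    have [y1|y1] := ltP 0 (hd y).
      have cv : (fun s => hd y + s * (hd dy + s)) @ 0^'+ --> hd y + 0 * (hd dy + 0).
        apply: cvgD; first exact: cvg_cst.
        by apply: cvgM => //; apply: cvgD => //; exact: cvg_cst.
      by rewrite mul0r addr0 in cv; exact: (near_gt0 cv y1).
    have {}y1 : hd y = 0 by apply/le_anti; rewrite y1 y0.
    near=> s; have s0 : 0 < s by [].
    by rewrite y1 add0r mulr_gt0// ltr_wpDl// dyy.
  apply: (@uniform_of_curve _ _ _ _ _ _ _ X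
      (fun s => lift (X s) (hd y + s * (hd dy + s)))) => //.
    rewrite -/dy in dyE; rewrite [X in _ --> X]dyE; apply: lift_quotient => //.
    have : (fun s => hd dy + s) @ 0^'+ --> hd dy + 0 by apply: cvgD => //; exact: cvg_cst.
    rewrite addr0; apply: cvg_trans; apply: near_eq_cvg.
    by apply: filterS near_right0_neq0 => s s0; rewrite [hd y + _]addrC addrK mulKf.
  near=> s.
  have hs : 0 < hd (X s) by near: s; exact: Xhd.
  have qs : Q (X s) = 0 by near: s.
  have bs : 0 < hd y + s * (hd dy + s) by near: s.
  split=> //.
    by apply/(Om_posE _ hs); rewrite hd_mkv jordan_lift// qs mulr0 (ltW bs).
  by split=> //; rewrite ?hd_mkv ?qs ?ltxx// => _ h; rewrite h ltxx in bs.
Unshelve. all: by end_near. Qed.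

Implicit Types p q d v : 'rV[R]_(k.+1 + k.+1).

(** This symmetry reduces the case [0 < hd y] to the case [0 < hd x]. *)
Definition swap (p : 'rV[R]_(k.+1 + k.+1)) : 'rV[R]_(k.+1 + k.+1) :=
  row_mx (rsubmx p) (lsubmx p).

Lemma swapK p : swap (swap p) = p.
Proof. by rewrite /swap row_mxKl row_mxKr hsubmxK. Qed.

Lemma swapD p q : swap (p + q) = swap p + swap q.
Proof. by rewrite /swap !linearD add_row_mx. Qed.

Lemma swapZ a p : swap (a *: p) = a *: swap p.
Proof. by rewrite /swap !linearZ scale_row_mx. Qed.

Lemma swapB p q : swap (p - q) = swap p - swap q.
Proof. by rewrite swapD -scaleN1r swapZ scaleN1r. Qed.

Lemma dot_swap p q : dot (swap p) (swap q) = dot p q.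
Proof. by rewrite dot_row_mx (dot_split p q) addrC. Qed.

Lemma enorm_swap p : enorm (swap p) = enorm p.
Proof. by rewrite /enorm dot_swap. Qed.

Lemma Om_swap p : Om p -> Om (swap p).
Proof.
rewrite -{1}(hsubmxK p) /swap => /OmE[h1 h2 h3]; apply/OmE.
by split=> //; rewrite dotC.
Qed.

Lemma regular_normal_swap p v :
  regular_normal_cone Om p v -> regular_normal_cone Om (swap p) (swap v).
Proof.
move=> [Op nv]; split; first exact: Om_swap.
move=> e /nv/near_enormP[r r0 H]; apply/near_enormP; exists r => // z zp Oz.
rewrite -(swapK z) -swapB dot_swap enorm_swap; apply: H; last exact: Om_swap.
by rewrite -(swapK p) -swapB enorm_swap.
Qed.

Lemma cvg_swap (u : nat -> 'rV[R]_(k.+1 + k.+1)) (p : 'rV[R]_(k.+1 + k.+1)) :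
  u @ \oo --> p -> (fun j => swap (u j)) @ \oo --> swap p.
Proof.
move/cvg_enormP => up; apply/cvg_enormP => e /up; apply: filterS => j.
by rewrite -swapB enorm_swap.
Qed.

Lemma dir_normal_swap p d v :
  dir_normal_cone Om p d v -> dir_normal_cone Om (swap p) (swap d) (swap v).
Proof.
move=> [t [ds [vs [ht dsd vsv H]]]].
exists t, (fun j => swap (ds j)), (fun j => swap (vs j)); split=> //.
- exact: cvg_swap.
- exact: cvg_swap.
- by move=> j; rewrite -swapZ -swapD; exact: regular_normal_swap.
Qed.

Lemma uniform_normal_swap p d v :
  uniform_normal Om p d v -> uniform_normal Om (swap p) (swap d) (swap v).
Proof.
move=> un e /un[tau tau0 H]; exists tau => // t t0 tt.
have [d' [v' [h1 h2 h3]]] := H t t0 tt; exists (swap d'), (swap v').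
rewrite -!swapB !enorm_swap -swapZ -swapD; split=> //.
exact: regular_normal_swap.
Qed.

Lemma soc_scale x (a : R) : 0 <= a -> soc x -> soc (a *: x).
Proof.
move=> a0 /socE[x0 qx]; apply/socE; rewrite hdZ lorentzZl lorentzZr.
by rewrite !mulr_ge0.
Qed.

Lemma Om_scale p (a : R) : 0 <= a -> Om p -> Om (a *: p).
Proof.
rewrite -(hsubmxK p) scale_row_mx => a0 /OmE[h1 h2 h3]; apply/OmE.
by rewrite !dotDZ h3 !mulr0; split=> //; exact: soc_scale.
Qed.

Lemma regular_normal_scale p v (a : R) : 0 < a ->
  regular_normal_cone Om p v -> regular_normal_cone Om (a *: p) v.
Proof.
move=> a0 [Op nv]; split; first by apply: Om_scale => //; exact: ltW.
move=> e /nv/near_enormP[r r0 H]; apply/near_enormP; exists (a * r).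
  exact: mulr_gt0.
move=> z zp Oz; have zE : z - a *: p = a *: (a^-1 *: z - p).
  by rewrite scalerBr scalerA divff ?gt_eqF// scale1r.
move: zp; rewrite zE enormZ gtr0_norm// ltr_pM2l// => zp.
rewrite dotZr mulrCA ler_pM2l//; apply: H => //.
by apply: Om_scale => //; rewrite invr_ge0 ltW.
Qed.

Lemma uniform_normal_Om p d v : Om p -> dir_normal_cone Om p d v ->
  uniform_normal Om p d v.
Proof.
move=> Op dn; move: (Op) (dn); rewrite -(hsubmxK p).
set x := lsubmx p; set y := rsubmx p => Oxy dxy.
have [/socE[x0 qx] /socE[y0 qy] xy] := (OmE x y).1 Oxy.
have [x1|x1] := ltP 0 (hd x); first exact: uniform_normal_pos.
have [y1|y1] := ltP 0 (hd y).
  have swE : row_mx x y = swap (row_mx y x) by rewrite /swap row_mxKl row_mxKr.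
  have Oyx : Om (row_mx y x) by rewrite -(swapK (row_mx y x)) -swE; exact: Om_swap.
  rewrite swE -(swapK d) -(swapK v); apply: uniform_normal_swap.
  apply: uniform_normal_pos => //.
  by rewrite -(swapK (row_mx y x)) -swE; exact: dir_normal_swap.
have zero u : hd u <= 0 -> soc u -> u = 0.
  move=> u1 /socE[u0 qu]; have hu : hd u = 0 by apply/le_anti; rewrite u1 u0.
  apply: hdtl_inj; rewrite ?hd0 ?tl0//; apply: dotxx_eq0; apply/le_anti.
  by move: qu; rewrite /lorentz hu mul0r sub0r oppr_ge0 dotxx_ge0 andbT.
have [sx sy _] := (OmE x y).1 Oxy.
move: dxy; rewrite (zero x)// (zero y)// row_mx0.
move=> [t [ds [vs [[t0 _] /cvg_enormP dsd /cvg_enormP vsv H]]]] e e0.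
(* At the origin one term is enough: [Om] is a cone, so rescaling its base point gives the same
   direction and normal at every step [s]. *)
have [N _ hN] := filterI (dsd _ e0) (vsv _ e0).
have [h1 h2] := hN N (leqnn N).
exists 1 => // s s0 _; exists (ds N), (vs N); split=> //.
have := H N; rewrite !add0r => nN.
have -> : s *: ds N = (s / t N) *: (t N *: ds N).
  by rewrite scalerA divfK// gt_eqF.
by apply: regular_normal_scale nN; rewrite divr_gt0.
Qed.

End UniformOm.

(** * Products and pairs *)

Section Product.
Context {R : realType} {J : nat} (p : 'I_J -> nat).
Local Notation N := (tdim p).
Local Notation "'E_ i" := 'rV[R]_((p i).+1 + (p i).+1) (at level 8, i at level 2).

(** [Omega] lives in a space ordered by halves, its factors in spaces of pairs of blocks; [pblk] and
    [passm] translate between the two orders. *)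
Definition pblk (z : 'rV[R]_(N + N)) (i : 'I_J) : 'E_i :=
  row_mx (block (lsubmx z) i) (block (rsubmx z) i).

Definition passm (f : forall i, 'E_i) : 'rV[R]_(N + N) :=
  row_mx (\mxrow_i lsubmx (f i)) (\mxrow_i rsubmx (f i)).

Lemma pblkK f i : pblk (passm f) i = f i.
Proof. by rewrite /pblk /block row_mxKl row_mxKr !mxrowK hsubmxK. Qed.

Lemma blockD (x y : 'rV[R]_N) i : block (x + y) i = block x i + block y i.
Proof. by apply/rowP => j; rewrite !mxE. Qed.

Lemma blockZ a (x : 'rV[R]_N) i : block (a *: x) i = a *: block x i.
Proof. by apply/rowP => j; rewrite !mxE. Qed.

Lemma pblkD x y i : pblk (x + y) i = pblk x i + pblk y i.
Proof. by rewrite /pblk !linearD !blockD add_row_mx. Qed.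

Lemma pblkZ a x i : pblk (a *: x) i = a *: pblk x i.
Proof. by rewrite /pblk !linearZ !blockZ scale_row_mx. Qed.

Lemma pblkB x y i : pblk (x - y) i = pblk x i - pblk y i.
Proof. by rewrite pblkD -scaleN1r pblkZ scaleN1r. Qed.

Lemma dot_block (x y : 'rV[R]_N) : dot x y = \sum_i dot (block x i) (block y i).
Proof.
rewrite -{1}(submxrowK x) -{1}(submxrowK y) dotE tr_mxrow mul_mxrow_mxcol summxE.
by apply: eq_bigr => i _; rewrite dotE.
Qed.

Lemma dot_pblk (x y : 'rV[R]_(N + N)) : dot x y = \sum_i dot (pblk x i) (pblk y i).
Proof.
rewrite dot_split !dot_block -big_split /=.
by apply: eq_bigr => i _; rewrite dot_row_mx.
Qed.

Lemma enorm_pblk_le x i : enorm (pblk x i) <= enorm x.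
Proof.
rewrite ler_wsqrtr// (dot_pblk x x) (bigD1 i)//= lerDl.
by apply: sumr_ge0 => j _; exact: dotxx_ge0.
Qed.

Lemma enorm_block_le (x : 'rV[R]_N) i : enorm (block x i) <= enorm x.
Proof.
rewrite ler_wsqrtr// (dot_block x x) (bigD1 i)//= lerDl.
by apply: sumr_ge0 => j _; exact: dotxx_ge0.
Qed.

Lemma enorm_le_pblk x : enorm x <= \sum_i enorm (pblk x i).
Proof.
have s0 : 0 <= \sum_i enorm (pblk x i) by apply: sumr_ge0.
rewrite -(@ler_pXn2r _ 2)// ?nnegrE// enorm_sqr dot_pblk expr2 mulr_suml.
apply: ler_sum => i _; rewrite -enorm_sqr expr2 ler_wpM2l//.
by rewrite (bigD1 i)//= lerDl sumr_ge0.
Qed.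

Lemma cvg_pblk (x : nat -> 'rV[R]_(N + N)) (a : 'rV[R]_(N + N)) i :
  x @ \oo --> a -> (fun j => pblk (x j) i) @ \oo --> pblk a i.
Proof.
move/cvg_enormP => xa; apply/cvg_enormP => e /xa; apply: filterS => j.
by apply: le_lt_trans; rewrite -pblkB enorm_pblk_le.
Qed.

Lemma soc_dot_ge0 k (x y : 'rV[R]_k.+1) : soc x -> soc y -> 0 <= dot x y.
Proof.
rewrite /soc /= -/(tl x) -/(tl y) -/(hd x) -/(hd y) dot_hdtl => hx hy.
have := normr_dot (tl x) (tl y); rewrite ler_norml => /andP[h _].
have : enorm (tl x) * enorm (tl y) <= hd x * hd y by exact: ler_pM.
lra.
Qed.

(** The blocks contribute nonnegative inner products, so the total vanishes exactly when each
    does. *)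
Lemma OmegaE (z : 'rV[R]_(N + N)) :
  Omega (p := p) z <-> forall i, @Omega_ R J p i (pblk z i).
Proof.
split=> [[zl zr zd] i|H].
  rewrite /Omega_ /compl_set /= /pblk row_mxKl row_mxKr; split=> //.
  move: zd; rewrite dot_block => /psumr_eq0P; apply => // j _.
  exact: soc_dot_ge0.
have {}H i : [/\ soc (block (lsubmx z) i), soc (block (rsubmx z) i) &
    dot (block (lsubmx z) i) (block (rsubmx z) i) = 0].
  by have := H i; rewrite /Omega_ /compl_set /= /pblk row_mxKl row_mxKr.
split; [by move=> i; have [] := H i|by move=> i; have [] := H i|].
by rewrite dot_block big1// => i _; have [] := H i.
Qed.

Lemma regular_normal_OmegaE (z v : 'rV[R]_(N + N)) :
  regular_normal_cone (Omega (p := p)) z v <->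
  forall i, regular_normal_cone (@Omega_ R J p i) (pblk z i) (pblk v i).
Proof.
split=> [[Oz nv] i|H].
  have Ozi := (OmegaE z).1 Oz; split=> // e e0.
  have /near_enormP[r r0 {}H] := nv e e0.
  apply/near_enormP; exists r => // z' z'z Oz'.
  (* Only the [i]-th block moves, so inner products and norms reduce to that block. *)
  pose Z := passm (dfwith (pblk z) z').
  have Zi : pblk (Z - z) i = z' - pblk z i by rewrite pblkB pblkK dfwith_in.
  have Zj j : j != i -> pblk (Z - z) j = 0.
    by move=> ji; rewrite pblkB pblkK dfwith_out 1?eq_sym// subrr.
  have dotZ (u : 'rV[R]_(N + N)) : dot u (Z - z) = dot (pblk u i) (z' - pblk z i).
    rewrite dot_pblk (bigD1 i)//= Zi big1 ?addr0// => j ji.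
    by rewrite Zj// dot0r.
  have nZ : enorm (Z - z) = enorm (z' - pblk z i) by rewrite /enorm dotZ Zi.
  rewrite -dotZ -nZ; apply: H; first by rewrite nZ.
  by apply/OmegaE => j; rewrite pblkK; case: dfwithP.
have Oz : Omega (p := p) z by apply/OmegaE => i; have [] := H i.
split=> // e e0.
(* [J.+1] keeps the tolerance positive when [J = 0]. *)
have eJ0 : 0 < e / J.+1%:R by rewrite divr_gt0.
have H2 i : \forall z' \near z, @Omega_ R J p i (pblk z' i) ->
    dot (pblk v i) (pblk z' i - pblk z i) <= e / J.+1%:R * enorm (pblk z' i - pblk z i).
  have [_ /(_ _ eJ0)/near_enormP[r r0 {}H]] := H i.
  apply/near_enormP; exists r => // z' z'z; apply: H.
  by apply: le_lt_trans z'z; rewrite -pblkB enorm_pblk_le.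
apply: filterS (filter_forall _ H2) => z' Hz' /OmegaE Oz'.
rewrite dot_pblk; apply: (@le_trans _ _ (\sum_(i < J) e / J.+1%:R * enorm (z' - z))).
  apply: ler_sum => i _; rewrite pblkB; apply: (le_trans (Hz' i (Oz' i))).
  by rewrite -pblkB ler_wpM2l ?enorm_pblk_le// ltW.
rewrite sumr_const card_ord -[leLHS]mulr_natl mulrA ler_wpM2r//.
by rewrite mulrCA ger_pMr// ler_pdivrMr// mul1r ler_nat.
Qed.

Lemma tangent_Omega_pblk (z d : 'rV[R]_(N + N)) i :
  tangent_cone (Omega (p := p)) z d ->
  tangent_cone (@Omega_ R J p i) (pblk z i) (pblk d i).
Proof.
move=> [t [us [ht usd H]]]; exists t, (fun j => pblk (us j) i); split=> //.
  exact: cvg_pblk.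
by move=> j; rewrite -pblkZ -pblkD; exact: (OmegaE _).1.
Qed.

Lemma dir_normal_Omega_pblk (z d v : 'rV[R]_(N + N)) i :
  dir_normal_cone (Omega (p := p)) z d v ->
  dir_normal_cone (@Omega_ R J p i) (pblk z i) (pblk d i) (pblk v i).
Proof.
move=> [t [ds [vs [ht dsd vsv H]]]].
exists t, (fun j => pblk (ds j) i), (fun j => pblk (vs j) i); split=> //.
- exact: cvg_pblk.
- exact: cvg_pblk.
- by move=> j; rewrite -pblkZ -pblkD; exact: (regular_normal_OmegaE _ _).1.
Qed.

Lemma min_half_lt (a b : R) : 0 < a -> 0 < b ->
  Num.min a b / 2 < a /\ Num.min a b / 2 < b.
Proof. by case: (leP a b) => ? ? ?; split; lra. Qed.

Lemma common_threshold (P : 'I_J -> R -> Prop) :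
  (forall i, exists2 tau : R, 0 < tau & forall t, 0 < t -> t < tau -> P i t) ->
  exists2 tau : R, 0 < tau & forall t, 0 < t -> t < tau -> forall i, P i t.
Proof.
move=> H; have H2 i : \forall t \near (0 : R)^'+, P i t.
  have [tau tau0 Hi] := H i; exists tau => //= t.
  by rewrite /ball_ /= sub0r normrN => tt t0; apply: Hi => //; rewrite -(gtr0_norm t0).
have [tau /= tau0 {}H] : \forall t \near (0 : R)^'+, forall i, P i t.
  exact: filter_forall.
exists tau => // t t0 tt; apply: H => //=.
by rewrite sub0r normrN gtr0_norm.
Qed.

(** For each tolerance the finitely many thresholds of [uniform_normal] have a common one, so a
    single step serves all blocks. *)
Lemma dir_normal_Omega (z d v : 'rV[R]_(N + N)) : Omega (p := p) z ->
  (forall i, dir_normal_cone (@Omega_ R J p i) (pblk z i) (pblk d i) (pblk v i)) ->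
  dir_normal_cone (Omega (p := p)) z d v.
Proof.
move=> /OmegaE Oz H.
have un i := uniform_normal_Om (Oz i) (H i).
have ex (m : nat) : exists tdv : R * 'rV[R]_(N + N) * 'rV[R]_(N + N),
    let e := m.+1%:R^-1 in
    [/\ 0 < tdv.1.1 < e, enorm (tdv.1.2 - d) <= J%:R * e, enorm (tdv.2 - v) <= J%:R * e &
      regular_normal_cone (Omega (p := p)) (z + tdv.1.1 *: tdv.1.2) tdv.2].
  have e0 : 0 < (m.+1%:R^-1 : R) by rewrite invr_gt0.
  have [tau tau0 {}un] := common_threshold (fun i => un i _ e0).
  pose t : R := Num.min tau m.+1%:R^-1 / 2.
  have t0 : 0 < t by rewrite divr_gt0// lt_min tau0 e0.
  have [tt te] : t < tau /\ t < m.+1%:R^-1.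
    exact: min_half_lt.
  have {}un i := cid (un t t0 tt i).
  pose d' i := projT1 (un i).
  have v'P i : exists v', [/\ enorm (d' i - pblk d i) < m.+1%:R^-1,
    enorm (v' - pblk v i) < m.+1%:R^-1 &
    regular_normal_cone Om (pblk z i + t *: d' i) v'] by exact: (projT2 (un i)).
  pose v' i := projT1 (cid (v'P i)).
  have dvP i : [/\ enorm (d' i - pblk d i) < m.+1%:R^-1,
    enorm (v' i - pblk v i) < m.+1%:R^-1 &
    regular_normal_cone Om (pblk z i + t *: d' i) (v' i)] by exact: (projT2 (cid (v'P i))).
  have sumJ (f : forall i, 'E_i) (a : 'rV[R]_(N + N)) :
      (forall i, enorm (f i - pblk a i) < m.+1%:R^-1) ->
      enorm (passm f - a) <= J%:R * m.+1%:R^-1.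
    move=> fa; apply: (le_trans (enorm_le_pblk _)).
    apply: (@le_trans _ _ (\sum_(i < J) m.+1%:R^-1)).
      by apply: ler_sum => i _; rewrite pblkB pblkK ltW.
    by rewrite sumr_const card_ord -[leLHS]mulr_natl.
  exists (t, passm d', passm v') => /=; split.
  - by rewrite t0 te.
  - by apply: sumJ => i; have [] := dvP i.
  - by apply: sumJ => i; have [] := dvP i.
  - apply/regular_normal_OmegaE => i; rewrite pblkD pblkZ !pblkK.
    by have [] := dvP i.
have [f fP] := choice ex.
have small (u : nat -> 'rV[R]_(N + N)) (a : 'rV[R]_(N + N)) :
    (forall m, enorm (u m - a) <= J%:R * m.+1%:R^-1) -> u @ \oo --> a.
  move=> ua; apply/cvg_enormP => e e0.
  have eJ : 0 < e / J.+1%:R by rewrite divr_gt0.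
  apply: filterS (near_invn_lt eJ) => m; rewrite ltr_pdivlMr// => h.
  apply: (le_lt_trans (ua m)); apply: le_lt_trans h.
  by rewrite mulrC ler_wpM2l ?invr_ge0// ler_nat.
exists (fun m => (f m).1.1), (fun m => (f m).1.2), (fun m => (f m).2); split.
- split=> [m|]; first by have [/andP[]] := fP m.
  apply: cvg_near0 => e e0; apply: filterS (near_invn_lt e0) => m.
  by have [/andP[h1 h2] _ _ _] := fP m; rewrite gtr0_norm//; exact: lt_trans.
- by apply: small => m; have [] := fP m.
- by apply: small => m; have [] := fP m.
- by move=> m; have [] := fP m.
Qed.

(** The base points of the normals lie in [C]. This supplies the tangency premises wherever (B) is
    applied to given normals. *)
Lemma dir_normal_tangent k (C : set 'rV[R]_k) z d v :
  dir_normal_cone C z d v -> tangent_cone C z d.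
Proof.
move=> [t [ds [vs [ht dsd _ H]]]]; exists t, ds; split=> // j.
exact: regular_normal_in (H j).
Qed.

Lemma closed_soc k : closed (@soc R k).
Proof.
have -> : @soc R k = (fun x : 'rV[R]_k.+1 => enorm (tl x) - hd x) @^-1` [set t | t <= 0].
  by apply/seteqP; split=> x /=; rewrite /soc /= subr_le0.
apply: closed_comp; last exact: closed_le.
move=> x _; apply: (@cvgB _ _ _ (nbhs x)).
  exact: (cvg_enorm (@cvg_tl R k _ (nbhs x) _ id x (@cvg_id _ _))).
exact: (@cvg_hd R k _ (nbhs x) _ id x (@cvg_id _ _)).
Qed.

Lemma closed_compl_set k (K : set 'rV[R]_k) : closed K -> closed (compl_set K).
Proof.
move=> clK.
have cl : continuous (fun z : 'rV[R]_(k + k) => lsubmx z).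
  by move=> z; exact: (@cvg_lsubmx R _ (nbhs z) _ _ _ id z (@cvg_id _ _)).
have cr : continuous (fun z : 'rV[R]_(k + k) => rsubmx z).
  by move=> z; exact: (@cvg_rsubmx R _ (nbhs z) _ _ _ id z (@cvg_id _ _)).
have cd : continuous (fun z : 'rV[R]_(k + k) => dot (lsubmx z) (rsubmx z)).
  move=> z; apply: (@cvg_dot R _ (nbhs z)); [exact: cl|exact: cr].
have -> : compl_set K = ((fun z : 'rV[R]_(k + k) => lsubmx z) @^-1` K `&`
    (fun z : 'rV[R]_(k + k) => rsubmx z) @^-1` K) `&`
    (fun z : 'rV[R]_(k + k) => dot (lsubmx z) (rsubmx z)) @^-1` [set 0].
  by apply/seteqP; split=> z /= => [[? ? ?]|[[? ?] ?]].
apply: closedI; first by apply: closedI; apply: closed_comp.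
by apply: closed_comp => //; exact: closed_eq.
Qed.

Lemma closed_Omega : closed (Omega (R := R) (p := p)).
Proof.
have -> : Omega (R := R) (p := p) = \bigcap_(i in setT)
    ((fun z : 'rV[R]_(N + N) => pblk z i) @^-1` (@Omega_ R J p i)).
  by apply/seteqP; split=> z => [/OmegaE H i _|H]; [exact: H|apply/OmegaE => i; exact: H].
apply: closed_bigI => i _; apply: closed_comp; last exact/closed_compl_set/closed_soc.
move=> z _; apply/(@cvg_enormP R _ (nbhs z)) => e e0.
apply/near_enormP; exists e => // y yz; apply: le_lt_trans yz.
by rewrite -pblkB enorm_pblk_le.
Qed.

(** Nearest points in the factors assemble to a point of the product; this leads to the blockwise
    residual of [local_error_bound]. *)
Lemma dist_Omega_le (z : 'rV[R]_(N + N)) :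
  dist (Omega (p := p)) z <= \sum_i dist (@Omega_ R J p i) (pblk z i).
Proof.
have ex i : exists c, @Omega_ R J p i c /\ dist (@Omega_ R J p i) (pblk z i) = enorm (pblk z i - c).
  have O0 : @Omega_ R J p i !=set0.
    have s0 : soc (0 : 'rV[R]_(p i).+1) by apply/socE; rewrite hd0 lorentz0r.
    by exists (row_mx 0 0); apply/OmE; rewrite dot0l.
  have [c] := dist_attained (pblk z i) (closed_compl_set (@closed_soc (p i))) O0.
  by exists c.
pose c i := projT1 (cid (ex i)).
have cP i : @Omega_ R J p i (c i) /\ dist (@Omega_ R J p i) (pblk z i) = enorm (pblk z i - c i).
  exact: (projT2 (cid (ex i))).
have Oc : Omega (p := p) (passm c) by apply/OmegaE => i; rewrite pblkK; exact: (cP i).1.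
apply: (le_trans (dist_le z Oc)); apply: (le_trans (enorm_le_pblk _)).
by apply: ler_sum => i _; rewrite pblkB pblkK (cP i).2.
Qed.

Lemma dot_ext k (a b : 'rV[R]_k) : (forall u, dot u a = dot u b) -> a = b.
Proof.
move=> ab; apply/eqP; rewrite -subr_eq0; apply/eqP; apply: dotxx_eq0.
by rewrite dotBr ab subrr.
Qed.

Lemma linear_cvg n k (g : {linear 'rV[R]_n -> 'rV[R]_k}) (K : R) :
  (forall x, enorm (g x) <= K * enorm x) -> continuous g.
Proof.
move=> gK z; apply/(@cvg_enormP R _ (nbhs z)) => e e0.
have K0 : 0 < `|K| + 1 by rewrite ltr_wpDl.
apply/near_enormP; exists (e / (`|K| + 1)); first by rewrite divr_gt0.
move=> y; rewrite ltr_pdivlMr// => h; rewrite -linearB; apply: le_lt_trans (gK _) _.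
apply: le_lt_trans h; rewrite mulrC ler_wpM2l// (le_trans (ler_norm _))// lerDl//.
Qed.

Lemma linear_comp_jac n k l (g : {linear 'rV[R]_k -> 'rV[R]_l}) (K : R)
    (f : 'rV[R]_n -> 'rV[R]_k) z :
  (forall x, enorm (g x) <= K * enorm x) -> differentiable f z ->
  differentiable (g \o f) z /\ forall w, jac (g \o f) z w = g (jac f z w).
Proof.
move=> /linear_cvg gc fz.
have gd : differentiable g (f z) by exact: linear_differentiable.
split; first exact: differentiable_comp.
by move=> w; rewrite /jac /jacobian !mul_rV_lin1 diff_comp//= diff_lin.
Qed.

Lemma jac_component n (f : 'rV[R]_n -> 'rV[R]_N) i z w : differentiable f z ->
  jac (component f i) z w = block (jac f z w) i.
Proof.
move=> fz.
have bl : linear (fun x : 'rV[R]_N => block x i) by move=> a u v; rewrite blockD blockZ.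
pose l := GRing.isLinear.Build R 'rV[R]_N 'rV[R]_(p i).+1 _ (fun x => block x i) bl.
pose g : {linear 'rV[R]_N -> 'rV[R]_(p i).+1} := HB.pack (fun x : 'rV[R]_N => block x i) l.
have gK x : enorm (g x) <= 1 * enorm x by rewrite mul1r; exact: enorm_block_le.
by have [_ /(_ w)] := linear_comp_jac gK fz.
Qed.

Lemma jacT_components n (f : 'rV[R]_n -> 'rV[R]_N) z (lam : 'rV[R]_N) :
  differentiable f z ->
  \sum_i jacT (component f i) z (block lam i) = jacT f z lam.
Proof.
move=> fz; apply: dot_ext => u; rewrite -dot_jac dot_block.
rewrite dotE linear_sum mulmx_sumr summxE; apply: eq_bigr => i _.
by rewrite -dotE -dot_jac jac_component.
Qed.

End Product.

Lemma jacD {R : realType} n k (f g : 'rV[R]_n -> 'rV[R]_k) z w :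
  differentiable f z -> differentiable g z -> jac (f + g) z w = jac f z w + jac g z w.
Proof.
move=> df dg; rewrite /jac /jacobian [in LHS]mul_rV_lin1.
rewrite [in X in _ = X + _]mul_rV_lin1 [in X in _ = _ + X]mul_rV_lin1.
exact: (congr1 (fun h : 'rV[R]_n -> 'rV[R]_k => h w) (diffD df dg)).
Qed.

(** * Jacobians of paired maps *)

Section Pairing.
Context {R : realType} {n k1 k2 : nat}.
Implicit Types (f : 'rV[R]_n -> 'rV[R]_k1) (g : 'rV[R]_n -> 'rV[R]_k2).

(** The pair is the sum of [f] and [g] composed with the linear injections into the two halves. *)
Lemma row_mx_diff f g z : differentiable f z -> differentiable g z ->
  differentiable (fun z => row_mx (f z) (g z)) z /\
  'J (fun z => row_mx (f z) (g z)) z = row_mx ('J f z) ('J g z).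
Proof.
move=> fz gz.
have ll : linear (fun x : 'rV[R]_k1 => row_mx x (0 : 'rV[R]_k2)).
  by move=> a u v; rewrite scale_row_mx add_row_mx scaler0 addr0.
have lr : linear (fun x : 'rV[R]_k2 => row_mx (0 : 'rV[R]_k1) x).
  by move=> a u v; rewrite scale_row_mx add_row_mx scaler0 addr0.
have [hl hlE] : exists h : {linear 'rV[R]_k1 -> 'rV[R]_(k1 + k2)},
    forall x, h x = row_mx x 0.
  pose m := GRing.isLinear.Build R 'rV[R]_k1 'rV[R]_(k1 + k2) _ _ ll.
  by exists (HB.pack_for {linear 'rV[R]_k1 -> 'rV[R]_(k1 + k2)} (fun x : 'rV[R]_k1 => row_mx x (0 : 'rV[R]_k2)) m).
have [hr hrE] : exists h : {linear 'rV[R]_k2 -> 'rV[R]_(k1 + k2)},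
    forall x, h x = row_mx 0 x.
  pose m := GRing.isLinear.Build R 'rV[R]_k2 'rV[R]_(k1 + k2) _ _ lr.
  by exists (HB.pack_for {linear 'rV[R]_k2 -> 'rV[R]_(k1 + k2)} (fun x : 'rV[R]_k2 => row_mx (0 : 'rV[R]_k1) x) m).
have hlK x : enorm (hl x) <= 1 * enorm x.
  by rewrite hlE mul1r (le_trans (enorm_row_mx _ _))// enorm0 addr0.
have hrK x : enorm (hr x) <= 1 * enorm x.
  by rewrite hrE mul1r (le_trans (enorm_row_mx _ _))// enorm0 add0r.
have [dl jl] := linear_comp_jac hlK fz; have [dr jr] := linear_comp_jac hrK gz.
have E : (fun z => row_mx (f z) (g z)) = (hl \o f) + (hr \o g).
  by apply/funext => y; rewrite fctE /= hlE hrE add_row_mx addr0 add0r.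
have dE : differentiable (fun z => row_mx (f z) (g z)) z.
  by rewrite E; exact: differentiableD.
split=> //; apply/row_matrixP => i; rewrite !rowE.
have -> : delta_mx 0 i *m 'J (fun z => row_mx (f z) (g z)) z =
    jac (hl \o f) z (delta_mx 0 i) + jac (hr \o g) z (delta_mx 0 i).
  by rewrite E; exact: jacD.
by rewrite jl jr hlE hrE mul_mx_row /jac add_row_mx addr0 add0r.
Qed.

Lemma normr_row_mx m (A : 'M[R]_(m, k1)) (B : 'M[R]_(m, k2)) :
  `|row_mx A B| <= `|A| + `|B|.
Proof.
rewrite [leLHS]mx_normrE; apply/bigmax_leP; split=> [|[i j] _ /=]; first by rewrite addr_ge0.
have [s ->|s ->] := split_ordP j; rewrite ?row_mxEl ?row_mxEr.
  rewrite -[leLHS]addr0 lerD// [`|A|]mx_normrE.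
  exact: (le_bigmax _ (fun ij : 'I_m * 'I_k1 => `|A ij.1 ij.2|) (i, s)).
rewrite -[leLHS]add0r lerD// [`|B|]mx_normrE.
exact: (le_bigmax _ (fun ij : 'I_m * 'I_k2 => `|B ij.1 ij.2|) (i, s)).
Qed.

Lemma C1_row_mx f g : C1 f -> C1 g -> C1 (fun z => row_mx (f z) (g z)).
Proof.
move=> [df Jf] [dg Jg]; split=> [z|z]; first by have [] := row_mx_diff (df z) (dg z).
apply/(@cvgrPdist_lt _ _ _ (nbhs z)) => e e0.
have e20 : 0 < e / 2 by rewrite divr_gt0.
have := Jf z; move/(@cvgrPdist_lt _ _ _ (nbhs z)) => /(_ _ e20).
have := Jg z; move/(@cvgrPdist_lt _ _ _ (nbhs z)) => /(_ _ e20).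
apply: filterS2 => y h1 h2.
rewrite (row_mx_diff (df z) (dg z)).2 (row_mx_diff (df y) (dg y)).2.
rewrite opp_row_mx add_row_mx; apply: (le_lt_trans (normr_row_mx _ _)); lra.
Qed.

Lemma jac_row_mx f g z w : differentiable f z -> differentiable g z ->
  jac (fun z => row_mx (f z) (g z)) z w = row_mx (jac f z w) (jac g z w).
Proof. by move=> df dg; rewrite /jac (row_mx_diff df dg).2 mul_mx_row. Qed.

Lemma jacT_row_mx f g z a b : differentiable f z -> differentiable g z ->
  jacT (fun z => row_mx (f z) (g z)) z (row_mx a b) = jacT f z a + jacT g z b.
Proof.
by move=> df dg; rewrite /jacT (row_mx_diff df dg).2 tr_row_mx mul_row_col.
Qed.

End Pairing.

Theorem theorem7p3 (R : realType) (J n l : nat) (p : 'I_J -> nat)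
    (F : 'rV[R]_n -> 'rV[R]_l) (G H : 'rV[R]_n -> 'rV[R]_(tdim p))
    (Lam : set 'rV[R]_l) (zs : 'rV[R]_n)
    (Lam_closed : closed Lam) (F_C1 : C1 F) (G_C1 : C1 G) (H_C1 : C1 H)
    (zs_feasible : feasible F G H Lam zs)
    (F_subregular : metrically_subregular F Lam zs) :
  (blockwise_condition F G H Lam zs <-> full_condition F G H Lam zs) /\
  (blockwise_condition F G H Lam zs -> local_error_bound F G H Lam zs).
Proof.
have [dG _] := G_C1; have [dH _] := H_C1.
pose P z : 'rV[R]_(tdim p + tdim p) := row_mx (G z) (H z).
have OP z : Omega (P z) <-> [/\ prod_soc (G z), prod_soc (H z) & dot (G z) (H z) = 0].
  by rewrite /Omega /compl_set /P /= row_mxKl row_mxKr.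
have Ozs : Omega (P zs) by case: zs_feasible => *; apply/OP; split.
have bE (a b : 'rV[R]_(tdim p)) i : pblk (row_mx a b) i = row_mx (block a i) (block b i).
  by rewrite /pblk row_mxKl row_mxKr.
have jbE w i : pblk (row_mx (jac G zs w) (jac H zs w)) i =
    row_mx (jac (component G i) zs w) (jac (component H i) zs w).
  by rewrite bE !jac_component.
have eqE lG lH : \sum_(i < J) (jacT (component G i) zs (block lG i) +
    jacT (component H i) zs (block lH i)) = jacT G zs lG + jacT H zs lH.
  by rewrite big_split; congr (_ + _); exact: jacT_components.
have AB : blockwise_condition F G H Lam zs -> full_condition F G H Lam zs.
  move=> A w w0 TF TO lF lG lH eq NF NO.
  apply: (A w w0 TF _ lF) => //.
  - by move=> i; rewrite -jbE -bE; exact: tangent_Omega_pblk.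
  - by rewrite eqE addrA.
  - by move=> i; rewrite -jbE -!bE; exact: dir_normal_Omega_pblk.
have BA : full_condition F G H Lam zs -> blockwise_condition F G H Lam zs.
  move=> B w w0 TF TO lF lG lH eq NF NO.
  (* Here the blockwise normals, each with its own steps, must be merged; the tangency premise of
     (B) is then read off from the merged normal. *)
  have NOm : dir_normal_cone (Omega (p := p)) (P zs)
      (row_mx (jac G zs w) (jac H zs w)) (row_mx lG lH).
    by apply: dir_normal_Omega => // i; rewrite jbE !bE; exact: NO.
  apply: (B w w0 TF _ lF) => //; first exact: dir_normal_tangent NOm.
  by rewrite -addrA -eqE.
split; first by split.
move=> /AB B.
have PC1 : C1 P by exact: C1_row_mx.
have : error_bound F P Lam (Omega (p := p)) zs.
  apply: directional_error_bound => //; first exact: closed_Omega.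
    by case: zs_feasible.
  move=> w w0 nu mu; rewrite -(hsubmxK mu) jacT_row_mx// jac_row_mx// => eq NF NO.
  have [|||-> ->] := B w w0 _ _ nu (lsubmx mu) (rsubmx mu) _ NF NO.
  - exact: dir_normal_tangent NF.
  - exact: dir_normal_tangent NO.
  - by rewrite -addrA addrC.
  - by rewrite row_mx0.
move=> [kappa [kappa0 eb]]; exists kappa; split=> //.
apply: filterS eb => z ebz.
have <- : solution_set F P Lam (Omega (p := p)) = feasible F G H Lam.
  by apply/seteqP; split=> y [] => [LF /OP[]|? ? ? ?]; split=> //; apply/OP.
apply: (le_trans ebz); rewrite ler_wpM2l ?(ltW kappa0)// lerD2l.
apply: (le_trans (dist_Omega_le _)).
by apply: ler_sum => i _; rewrite /P bE.
Qed.
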